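(* Let $\sigma>0$, $N\ge1$, $f(x)=\frac1N\sum_{i=1}^N f_i(x)$ with $f_i:\mathbb{R}^n\to\mathbb{R}$ locally Lipschitz, and $g(x)=f(x)+\frac{\sigma}{2}\|x\|^2$. Assume: (1) for each $i\in[N]$, $f_i$ is a definable function that admits a definable set-valued mapping $\mathcal{D}_{f_i}$ as its conservative field; (2) $\sup_{i\in[N],\,x\in\mathbb{R}^n}\|\mathcal{D}_{f_i}(x)\|<\infty$; (3) $f$ is bounded from below. Let $\{x_k\}$ be generated by the AdamD method described in the context, with safeguard parameter $\varepsilon>0$, constant stepsize $0<\eta\le\frac{\varepsilon}{\sigma}$, $\beta\in(0,1)$, and a positive sequence $\{\theta_k\}$ satisfying $\sum_{k=0}^\infty\theta_k=\infty$ and $\lim_{k\to\infty}\theta_k\log(k)=0$. Then almost surely, any cluster point of $\{x_k\}$ is a $\mathcal{D}_g$-stationary point of $g$, and the sequence $\{g(x_k)\}$ converges.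
   Context: $[N]=\{1,\dots,N\}$. Powers, square roots, inverses and adding a scalar to a vector are entrywise; $\odot$ is the entrywise product; for a set $\mathcal{X}\subset\mathbb{R}^n$, $\|\mathcal{X}\|=\sup\{\|w\|:w\in\mathcal{X}\}$. ''Definable'' means definable in a fixed o-minimal structure (a set-valued mapping is definable if its graph is). AdamD method: given $x_0\in\mathbb{R}^n$, $m_0\in\mathbb{R}^n$, $v_0\in\mathbb{R}^n_+$, for $k=0,1,2,\dots$: independently sample $i_k$ (uniformly) from $[N]$ and compute $g_k\in\mathcal{D}_{f_{i_k}}(x_k)$; set $m_{k+1}=(1-\theta_k)m_k+\theta_k g_k$; $v_{k+1}=(1-\beta)v_k+\beta g_k^2$; $x_{k+1}=x_k-\eta(\sqrt{v_{k+1}}+\varepsilon)^{-1}\odot(m_{k+1}+\sigma x_k)$. A conservative field on $\mathbb{R}^n$ is a graph-closed set-valued mapping $\mathcal{D}:\mathbb{R}^n\rightrightarrows\mathbb{R}^n$ with nonempty compact values such that $\int_0^1\max_{v\in\mathcal{D}(\gamma(t))}\langle\gamma'(t),v\rangle\,dt=0$ for every absolutely continuous $\gamma:[0,1]\to\mathbb{R}^n$ with $\gamma(0)=\gamma(1)$. A function $f$ admits $\mathcal{D}$ as its conservative field if $f(\gamma(1))=f(\gamma(0))+\int_0^1\max_{d\in\mathcal{D}(\gamma(t))}\langle\gamma'(t),d\rangle\,dt$ for every absolutely continuous $\gamma:[0,1]\to\mathbb{R}^n$. The conservative fields used for $f$ and $g$ are $\mathcal{D}_f(x):=\mathrm{conv}\left(\frac1N\sum_{i=1}^N\mathcal{D}_{f_i}(x)\right)$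 and $\mathcal{D}_g(x):=\mathcal{D}_f(x)+\sigma x$. A point $x$ is $\mathcal{D}_g$-stationary for $g$ if $0\in\mathrm{conv}(\mathcal{D}_g(x))$ (i.e. $0\in\mathcal{D}_g(x)$ here). *)

(* Defs.v *)
From HB Require Import structures.
From mathcomp Require Import all_boot all_order all_algebra.
From mathcomp Require Import all_classical all_reals all_analysis.
(* mpoly is not imported: its notations clash with those of mathcomp-analysis *)
From mathcomp Require mpoly.

Set Implicit Arguments.
Unset Strict Implicit.
Unset Printing Implicit Defensive.

Import Order.TTheory GRing.Theory Num.Theory numFieldNormedType.Exports.

Local Open Scope classical_set_scope.
Local Open Scope ring_scope.

(* Vectors of R^n are rows 'rV[R]_n.  The library norm `|x| on 'rV[R]_n is the
   max norm; it is used below only for notions that do not depend on the choice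
   of the norm (topology, Lipschitz and absolute continuity).  The Euclidean
   norm is [enorm]. *)

Definition dotv (R : realType) (n : nat) (u v : 'rV[R]_n) : R :=
  \sum_(l < n) u 0 l * v 0 l.

Definition enorm (R : realType) (n : nat) (u : 'rV[R]_n) : R :=
  Num.sqrt (dotv u u).

Definition set_enorm (R : realType) (n : nat) (X : set 'rV[R]_n) : \bar R :=
  ereal_sup [set (enorm w)%:E | w in X].

Definition locally_lipschitz (R : realType) (n : nat) (f : 'rV[R]_n -> R) :
    Prop :=
  forall x : 'rV[R]_n, exists2 U : set 'rV[R]_n,
    nbhs x U & [lipschitz f z | z in U].

Definition convex_hull (R : realType) (n : nat) (X : set 'rV[R]_n) :
    set 'rV[R]_n :=
  smallest (@convex_set R (convex_lmodType 'rV[R]_n)) X.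

(* O-minimal structures expanding the real field *)

Record o_minimal (R : realType) (S : forall n : nat, set (set 'rV[R]_n)) :
    Prop := OMinimal {
  omin_setC : forall n (A : set 'rV[R]_n), S n A -> S n (~` A);
  omin_setU : forall n (A B : set 'rV[R]_n), S n A -> S n B -> S n (A `|` B);
  omin_prodr : forall n (A : set 'rV[R]_n), S n A ->
    S (n + 1)%N [set z : 'rV[R]_(n + 1) | A (lsubmx z)];
  omin_prodl : forall n (A : set 'rV[R]_n), S n A ->
    S (1 + n)%N [set z : 'rV[R]_(1 + n) | A (rsubmx z)];
  omin_proj : forall n (A : set 'rV[R]_(n + 1)), S (n + 1)%N A ->
    S n [set lsubmx z | z in A];
  omin_algebraic : forall n (p : mpoly.mpoly n R),
    S n [set x : 'rV[R]_n | mpoly.meval (x 0) p = 0];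
  (* an [interval R] may be a point, open, closed or unbounded on either side *)
  omin_tame : forall A : set 'rV[R]_1, S 1%N A <->
    exists s : seq (interval R),
      A = [set x : 'rV[R]_1 | exists2 J, J \in s & x 0 0 \in J] }.

Definition definable_fun (R : realType) (S : forall n : nat, set (set 'rV[R]_n))
    (n : nat) (f : 'rV[R]_n -> R) : Prop :=
  S (n + 1)%N [set z : 'rV[R]_(n + 1) | rsubmx z 0 0 = f (lsubmx z)].

Definition definable_map (R : realType) (S : forall n : nat, set (set 'rV[R]_n))
    (n : nat) (D : 'rV[R]_n -> set 'rV[R]_n) : Prop :=
  S (n + n)%N [set z : 'rV[R]_(n + n) | D (lsubmx z) (rsubmx z)].

(* Curves on [0, 1] are functions on R of which only the restriction to [0, 1]
   matters. *)
Definition abs_continuous01 (R : realType) (n : nat) (gamma : R -> 'rV[R]_n) :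
    Prop :=
  forall e : R, 0 < e -> exists2 d : R, 0 < d &
    forall (r : nat) (a b : 'I_r -> R),
      (forall j, 0 <= a j /\ a j <= b j /\ b j <= 1) ->
      trivIset [set: 'I_r] (fun j => `]a j, b j[%classic) ->
      \sum_(j < r) (b j - a j) < d ->
      \sum_(j < r) `|gamma (b j) - gamma (a j)| < e.

(* The supremum is a maximum when D has nonempty compact values.  The integral
   is extended-real valued and is finite only if the integrand is integrable
   (+oo - +oo is -oo), so an equation giving it a finite value includes
   integrability.  Where gamma is not differentiable, a null set, derive1 gamma
   is a fixed default value. *)
Definition path_integral (R : realType) (n : nat)
    (D : 'rV[R]_n -> set 'rV[R]_n) (gamma : R -> 'rV[R]_n) : \bar R :=
  (\int[lebesgue_measure]_(t in `[0%R, 1%R])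
     (sup [set dotv (derive1 gamma t) d | d in D (gamma t)])%:E)%E.

Definition conservative_field (R : realType) (n : nat)
    (D : 'rV[R]_n -> set 'rV[R]_n) : Prop :=
  [/\ closed [set p : 'rV[R]_n * 'rV[R]_n | D p.1 p.2],
      forall x, D x !=set0,
      forall x, compact (D x) &
      forall gamma : R -> 'rV[R]_n, abs_continuous01 gamma ->
        gamma 0 = gamma 1 -> path_integral D gamma = 0%E].

Definition admits_conservative_field (R : realType) (n : nat)
    (f : 'rV[R]_n -> R) (D : 'rV[R]_n -> set 'rV[R]_n) : Prop :=
  conservative_field D /\
  forall gamma : R -> 'rV[R]_n, abs_continuous01 gamma ->
    ((f (gamma 1%R))%:E = (f (gamma 0%R))%:E + path_integral D gamma)%E.

Definition mean_fun (R : realType) (n N : nat) (f_ : 'I_N -> 'rV[R]_n -> R)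
    (x : 'rV[R]_n) : R :=
  N%:R^-1 * \sum_(i < N) f_ i x.

Definition reg_fun (R : realType) (n N : nat) (sigma : R)
    (f_ : 'I_N -> 'rV[R]_n -> R) (x : 'rV[R]_n) : R :=
  mean_fun f_ x + sigma / 2 * enorm x ^+ 2.

Definition mean_field (R : realType) (n N : nat)
    (D_ : 'I_N -> 'rV[R]_n -> set 'rV[R]_n) (x : 'rV[R]_n) : set 'rV[R]_n :=
  convex_hull [set N%:R^-1 *: \sum_(i < N) d i
              | d in [set d : 'I_N -> 'rV[R]_n | forall i, D_ i x (d i)]].

Definition reg_field (R : realType) (n N : nat) (sigma : R)
    (D_ : 'I_N -> 'rV[R]_n -> set 'rV[R]_n) (x : 'rV[R]_n) : set 'rV[R]_n :=
  [set d + sigma *: x | d in mean_field D_ x].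

Definition stationary (R : realType) (n : nat)
    (D : 'rV[R]_n -> set 'rV[R]_n) (x : 'rV[R]_n) : Prop :=
  convex_hull (D x) 0.

(* The sigma-algebra generated by i_0, g_0, ..., i_(k-1), g_(k-1); the iterates
   x_j, m_j, v_j with j <= k are functions of these. *)
Definition history (d : measure_display) (T : measurableType d) (R : realType)
    (n N : nat) (idx : nat -> T -> 'I_N) (g : nat -> T -> 'rV[R]_n) (k : nat) :
    set (set T) :=
  <<s \bigcup_(j in `I_k)
        (preimage_set_system [set: T] (idx j) [set: set 'I_N] `|`
         \bigcup_(l in [set: 'I_n])
           preimage_set_system [set: T] (fun w => g j w 0 l) measurable) >>.

(* The selection g_k in D_{f_{i_k}}(x_k) is an arbitrary random vector: it need
   not be a function of the past and of i_k.  The index i_k is independent of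
   everything that was drawn before it. *)
Record adamD (d : measure_display) (T : measurableType d) (R : realType)
    (P : probability T R) (n N : nat)
    (D_ : 'I_N -> 'rV[R]_n -> set 'rV[R]_n)
    (sigma eps eta beta : R) (theta : nat -> R) (x0 m0 v0 : 'rV[R]_n)
    (idx : nat -> T -> 'I_N) (g x m v : nat -> T -> 'rV[R]_n) : Prop := AdamD {
  adamD_idx_measurable : forall k i, measurable (idx k @^-1` [set i]);
  adamD_idx_uniform : forall k i, P (idx k @^-1` [set i]) = (N%:R^-1)%:E;
  adamD_idx_indep : forall k i (A : set T), history idx g k A ->
    P (A `&` idx k @^-1` [set i]) = (P A * P (idx k @^-1` [set i]))%E;
  adamD_g_measurable : forall k l,
    measurable_fun [set: T] (fun w => g k w 0 l);
  adamD_g : forall k w, D_ (idx k w) (x k w) (g k w);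
  adamD_x0 : forall w, x 0%N w = x0;
  adamD_m0 : forall w, m 0%N w = m0;
  adamD_v0 : forall w, v 0%N w = v0;
  adamD_m : forall k w,
    m k.+1 w = (1 - theta k) *: m k w + theta k *: g k w;
  adamD_v : forall k w, v k.+1 w =
    \row_l ((1 - beta) * v k w 0 l + beta * g k w 0 l ^+ 2);
  adamD_x : forall k w, x k.+1 w =
    \row_l (x k w 0 l - eta * ((Num.sqrt (v k.+1 w 0 l) + eps)^-1 *
                               (m k.+1 w 0 l + sigma * x k w 0 l))) }.

(* Main.v *)
Require Import Defs.
From HB Require Import structures.
From mathcomp Require Import all_boot all_order all_algebra.
From mathcomp Require Import all_classical all_reals all_analysis.
From mathcomp Require Import measurable_realfun.
From mathcomp Require Import ring lra.
Import Order.TTheory GRing.Theory Num.Theory numFieldNormedType.Exports.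
Local Open Scope classical_set_scope.
Local Open Scope ring_scope.

Set Implicit Arguments.
Unset Strict Implicit.
Unset Printing Implicit Defensive.

(** Support functions replace sets throughout.  Let H(q, x) be the support function
of D_g(x) in the direction q, that is the mean over i of max <q, d>, d in
D_{f_i}(x), plus sigma <q, x> ([reg_suppf]).  By convex separation x is
stationary iff H(q, x) >= 0 for all q ([reg_suppf_ge0_stationary]).

Reduction to a subgradient method.  Put y_k = - m_k / sigma and
a_k = theta_k / sigma.  The momentum recursion says
y_{k+1} = y_k - a_k (g_k + sigma y_k), which is a stochastic subgradient method
for g with steps tending to 0, except that g_k is taken at x_k and not at y_k.
The preconditioner does not occur in it.  The update of x is, coordinatewise,
x_{k+1} - y_{k+1} = (1 - r) (x_k - y_{k+1}), where r is at most 1 because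
eta <= eps / sigma, and is bounded away from 0 because v is bounded.  As
y_{k+1} - y_k tends to 0, so does x_k - y_k ([x_sub_y_cvg0]), although eta is
constant.  It remains to treat y.

Noise.  The selection g_k need not depend measurably on the past and i_k, but
<p, g_k> is at most the support function of D_{f_{i_k}}(x_k) at p, and this
random variable has, given the past, the mean over i as its expectation.  The
excess over the mean is a bounded martingale difference.  An exponential bound,
with a parameter of order log n for the windows that start at n, gives tails of
order n^-2 because a_k log k tends to 0.  By Borel-Cantelli, almost surely the
weighted noise over every window of clock length at most T that starts late
enough is at most any given e > 0 ([oracle_noise_vanishes]).  From here on a
single trajectory is considered.

Limit curves.  In the clock tau_k = a_0 + ... + a_{k-1}, limits Y of the paths
started ever later are Lipschitz and satisfy - <p, Y'> <= H(p, Y).  At p = - Y'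
this reads |Y'|^2 <= H(- Y', Y), and the right side is the integrand which the
conservative field formula gives for g along Y run backwards
([reg_fun_curve]).  So g does not increase along Y, and it drops below g(Y(0))
if Y(0) is not critical ([Y_nonincreasing], [Y_decreasing]).

Convergence of the values.  Suppose that g(y_k) oscillates across an interval.
The interval contains a value c that is not critical; let b be its upper end.
Take excursions of g(y_k) from below c to above b.  Their starting points
accumulate at a point of level c, from where g drops below c within some time
T; hence the excursions last at most T, and in the limit Y climbs from c to b,
which is impossible ([no_excursion]).  Once g(y_k) converges, g is constant
along every limit curve, so that cluster points are critical
([approximation_convergence]).

Noncritical values are dense ([critical_values_codense]).  Definability enters
only here.  If all values in an interval were critical, then a definable choice
of critical points z(t) with g(z(t)) = t would be, on a smaller interval,
continuous with monotone coordinates, by the monotonicity theorem of o-minimal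
structures ([definable_monotone_continuous]).  Such a curve has finite length,
so it is Lipschitz in a new parameter.  The integrand H is nonnegative along
it, whichever way it is run, so g does not decrease when it is run backwards:
a contradiction. *)

(** * Lipschitz functions of one real variable *)

Lemma lipschitz_continuous (R : realType) (V : normedModType R) (f : R -> V) (L : R) :
  (forall s t, `|f s - f t| <= L * `|s - t|) -> continuous f.
Proof.
move=> fL t.
have L0 : 0 <= L.
  by have := le_trans (normr_ge0 _) (fL 1 0); rewrite subr0 normr1 mulr1.
apply/cvgrPdist_lt => e e0; near=> s.
rewrite (le_lt_trans (fL _ _))// (@le_lt_trans _ _ ((L + 1) * `|t - s|))//.
  by rewrite ler_wpM2r// lerDl.
rewrite -ltr_pdivlMl ?ltr_wpDl//; near: s.
have e1 : 0 < (L + 1)^-1 * e by rewrite mulr_gt0// invr_gt0 ltr_wpDl.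
by apply/nbhs_ballP; exists ((L + 1)^-1 * e).
Unshelve. all: by end_near. Qed.

Section LipschitzFTC.
Variable R : realType.
Local Notation mu := (@lebesgue_measure R).

(** Both measures are infima over covers by half-open intervals, and on such an
interval the bound is the hypothesis on G. *)
Lemma stieltjes_le_lebesgue (G : cumulative R R) (C : R) :
  0 < C -> (forall a b, a <= b -> G b - G a <= C * (b - a)) ->
  forall A, (lebesgue_stieltjes_measure G A <= C%:E * mu A)%E.
Proof.
move=> C0 GC A; rewrite -lee_pdivrMl//.
rewrite /lebesgue_measure /lebesgue_stieltjes_measure /measure_extension.
apply: le_ereal_inf_tmp => _ [F [mF AF] <-].
rewrite lee_pdivrMl// -nneseriesZl; last by move=> *; exact: wlength_ge0.
apply: (@le_trans _ _ (\big[+%E/0%E]_(0 <= k <oo) wlength G (F k))).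
  by apply: ereal_inf_lbound; exists F.
apply: lee_nneseries => [i _ _|i _]; first exact: wlength_ge0.
have /ocitvP [->|[[a b] /= ab ->]] := mF i.
  rewrite [X in (_ * X)%E](_ : _ = 0%E); last exact: wlength0.
  by rewrite (wlength0 G) mule0.
rewrite [X in (_ * X)%E](_ : _ = (b - a)%:E); last exact/wlength_itv_bnd/ltW.
rewrite [X in (X <= _)%E](_ : _ = (G b - G a)%:E); last exact/wlength_itv_bnd/ltW.
by rewrite -EFinM lee_fin; exact/GC/ltW.
Qed.

(** F t + L t is nondecreasing, and its Stieltjes measure is at most 2 L + 1 times
Lebesgue measure.  Its Radon-Nikodym density, minus L, is the derivative of F at
every Lebesgue point. *)
Lemma lipschitz_FTC (F : R -> R) (L : R) :
  (forall s t, `|F s - F t| <= L * `|s - t|) ->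
  exists f : R -> R, [/\ measurable_fun setT f,
    mu.-integrable `[0%R, 1%R] (EFin \o f),
    ((F 1 - F 0)%:E = \int[mu]_(t in `[0%R, 1%R]) (f t)%:E)%E &
    {ae mu, forall t, t \in `]0, 1[ -> derivable F t 1 /\ derive1 F t = f t}].
Proof.
move=> FL.
have L0 : 0 <= L by have := le_trans (normr_ge0 _) (FL 1 0); rewrite subr0 normr1 mulr1.
(* adding L t makes F nondecreasing, as a Stieltjes measure requires *)
pose G0 t := F t + L * t.
have G0nd : nondecreasing G0.
  move=> s t st; rewrite /G0 -subr_ge0.
  have := FL s t; rewrite ler_norml (distrC s) (ger0_norm (_ : 0 <= t - s)) ?subr_ge0//.
  by move=> /andP[_]; lra.
have Fc : continuous F := lipschitz_continuous FL.
have G0c : right_continuous G0.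
  apply/right_continuousW => t; apply: cvgD; first exact: Fc.
  by apply: cvgM; [exact: cvg_cst|exact: cvg_id].
pose GI := isCumulative.Build R _ R G0 G0nd G0c.
pose G : cumulative R R := HB.pack G0 GI.
pose nu0 := lebesgue_stieltjes_measure G.
have nu0le := @stieltjes_le_lebesgue G (2 * L + 1).
have {}nu0le : forall A, (nu0 A <= (2 * L + 1)%:E * mu A)%E.
  apply: nu0le; first lra.
  move=> a b ab; rewrite /G /= /G0.
  have := FL b a; rewrite ler_norml (ger0_norm (_ : 0 <= b - a)) ?subr_ge0//.
  by move=> /andP[_]; lra.
have mD : measurable (`]0, 1]%classic : set (measurableTypeR R)) by exact: measurable_itv.
have nuD : (nu0 `]0%R, 1%R]%classic < +oo)%E.
  rewrite (le_lt_trans (nu0le _))// lebesgue_measure_itv/= lte_fin ltr01.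
  by rewrite -EFinD -EFinM ltry.
pose nu := mfrestr mD nuD.
have numu : nu `<< mu.
  apply/null_content_dominatesP => A mA muA0.
  apply/eqP; rewrite eq_le measure_ge0 andbT /nu /mfrestr /mrestr (le_trans (nu0le _))//.
  rewrite [X in (_ * X)%E](_ : _ = 0%E) ?mule0//.
  by apply: (@subset_measure0 _ _ _ mu _ A) => //; exact: measurableI.
have [h [h0 hfin hint hE]] := radon_nikodym_sigma_finite numu.
pose f0 := fine \o h.
have f0h : EFin \o f0 = h by apply/funext => t /=; rewrite fineK.
have f0int : mu.-integrable setT (EFin \o f0) by rewrite f0h.
have mf0 : measurable_fun setT f0.
  by have /integrableP[/measurable_EFinP] := f0int.
have f0E x : x \in `[0, 1] -> (\int[mu]_(t in `]0%R, x]) (f0 t)%:E)%E = (G0 x - G0 0)%:E.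
  rewrite in_itv/= => /andP[x0 x1].
  have -> : (\int[mu]_(t in `]0%R, x]) (f0 t)%:E = \int[mu]_(t in `]0%R, x]) h t)%E.
    by rewrite -f0h.
  rewrite -hE; last exact: measurable_itv.
  change (nu0 (`]0, x]%classic `&` `]0, 1]%classic) = (G0 x - G0 0)%:E).
  rewrite (_ : _ `&` _ = `]0, x]%classic); last first.
    by apply/setIidl => t /=; rewrite !in_itv/= => /andP[-> /le_trans]; apply.
  rewrite /nu0 /lebesgue_stieltjes_measure /measure_extension measurable_mu_extE/=; last first.
    exact: is_ocitv.
  by rewrite wlength_itv_bnd.
exists (fun t => f0 t - L); split.
- exact: measurable_funB.
- rewrite (_ : EFin \o _ = (EFin \o f0) \- (EFin \o cst L))%E; last by apply/funext => t; rewrite /= EFinB.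
  apply: integrableB => //.
    by apply: integrableS f0int => //.
  apply/integrableP; split; first exact/measurable_EFinP.
  rewrite /= integral_cst//=.
  by rewrite lebesgue_measure_itv/= lte_fin ltr01 -EFinD -EFinM ltry.
- under eq_integral do rewrite EFinB.
  rewrite integralB_EFin//; last 2 first.
  + by apply: integrableS f0int => //.
  + apply/integrableP; split; first exact/measurable_EFinP.
    rewrite /= integral_cst//=.
    by rewrite lebesgue_measure_itv/= lte_fin ltr01 -EFinD -EFinM ltry.
  rewrite -integral_itv_obnd_cbnd; last exact/measurable_EFinP/measurable_funTS.
  rewrite f0E ?in_itv/= ?ler01 ?lexx// integral_cst//=.
  rewrite lebesgue_measure_itv/= lte_fin ltr01 oppr0 adde0 mule1 -EFinB /G0.
  by congr EFin; ring.
- have locf : locally_integrable setT f0.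
    by apply: open_integrable_locally => //; exact: openT.
  have := lebesgue_differentiation locf.
  apply: filterS; first exact: (ae_filter_ringOfSetsType mu).
  move=> x lx; rewrite in_itv/= => /andP[x0 x1].
  have i1 : mu.-integrable [set` Interval (BRight 0) (BRight 1)] (EFin \o f0).
    by apply: integrableS f0int => //.
  have [dx dE] := FTC1_lebesgue_pt x1 i1 x0 lx.
  set Phi := fun y => _ in dx dE.
  have nE : {near x, (fun y => Phi y - L * y + F 0) =1 F}.
    have : x \in `]0, 1[ by rewrite in_itv/= x0.
    move/near_in_itvoo; apply: filterS => y; rewrite in_itv/= => /andP[y0 y1].
    rewrite /Phi /Rintegral f0E ?in_itv/= ?ltW// /G0; ring.
  have dP : is_derive x 1 Phi (f0 x).
    by apply: DeriveDef => //; rewrite -derive1E.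
  have dL : is_derive x 1 (fun y => Phi y - L * y + F 0) (f0 x - L).
    have -> : (fun y => Phi y - L * y + F 0) = Phi - (L \*: id) + cst (F 0) by apply/funext.
    apply: is_derive_eq; rewrite addr0; congr (_ - _).
    by rewrite /GRing.scale/= mulr1.
  have [d1 d2] := dL.
  split; first exact: near_eq_derivable nE d1.
  by rewrite derive1E -(near_eq_derive _ nE).
Unshelve. all: by end_near. Qed.
End LipschitzFTC.

(** * The scalar product and support functions *)

Lemma continuous_big_sum (R : realType) (T : topologicalType) (I : Type)
    (r : seq I) (F : I -> T -> R) :
  (forall i, continuous (F i)) -> continuous (fun u => \sum_(i <- r) F i u).
Proof.
move=> Fc; elim: r => [|i r IH].
  by under eq_fun do rewrite big_nil; move=> u; exact: cvg_cst.
under eq_fun do rewrite big_cons.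
by move=> u; apply: cvgD; [exact: Fc|exact: IH].
Qed.

Section Vec.
Variables (R : realType) (n : nat).
Implicit Types u v p q x y z : 'rV[R]_n.

Lemma coord_le_norm u l : `|u 0 l| <= `|u|.
Proof. by rewrite [leRHS]/Num.Def.normr/= mx_normrE; exact: (le_bigmax _ _ (0, l)). Qed.

Lemma norm_le_coord u (c : R) : 0 <= c -> (forall l, `|u 0 l| <= c) -> `|u| <= c.
Proof.
move=> c0 uc; rewrite [leLHS]/Num.Def.normr/= mx_normrE bigmax_le//= => -[i j] _.
by rewrite (ord1 i).
Qed.

Lemma dotvDr p u v : dotv p (u + v) = dotv p u + dotv p v.
Proof. by rewrite /dotv -big_split/=; apply: eq_bigr => l _; rewrite mxE mulrDr. Qed.

Lemma dotvZr p (a : R) u : dotv p (a *: u) = a * dotv p u.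
Proof. by rewrite /dotv mulr_sumr; apply: eq_bigr => l _; rewrite mxE mulrCA. Qed.

Lemma dotvC u v : dotv u v = dotv v u.
Proof. by rewrite /dotv; apply: eq_bigr => l _; rewrite mulrC. Qed.

Lemma dotvDl p u v : dotv (u + v) p = dotv u p + dotv v p.
Proof. by rewrite !(dotvC _ p) dotvDr. Qed.

Lemma dotvZl p (a : R) u : dotv (a *: u) p = a * dotv u p.
Proof. by rewrite !(dotvC _ p) dotvZr. Qed.

Lemma dotvNr p u : dotv p (- u) = - dotv p u.
Proof. by rewrite -scaleN1r dotvZr mulN1r. Qed.

Lemma dotvNl p u : dotv (- u) p = - dotv u p.
Proof. by rewrite -scaleN1r dotvZl mulN1r. Qed.

Lemma dotv0l u : dotv 0 u = 0.
Proof. by rewrite -(scale0r 0) dotvZl mul0r. Qed.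

Lemma dotv0r u : dotv u 0 = 0. Proof. by rewrite dotvC dotv0l. Qed.

Lemma dotvBr p u v : dotv p (u - v) = dotv p u - dotv p v.
Proof. by rewrite dotvDr dotvNr. Qed.

Lemma dotvBl p u v : dotv (u - v) p = dotv u p - dotv v p.
Proof. by rewrite dotvDl dotvNl. Qed.

Lemma dotv_sumr (I : Type) (r : seq I) (P : pred I) p (F : I -> 'rV[R]_n) :
  dotv p (\sum_(i <- r | P i) F i) = \sum_(i <- r | P i) dotv p (F i).
Proof.
apply: (big_ind2 (fun u a => dotv p u = a)) => // [|u a v b <- <-].
  exact: dotv0r.
exact: dotvDr.
Qed.

Lemma dotv_ge0 u : 0 <= dotv u u.
Proof. by apply: sumr_ge0 => l _; rewrite -expr2 sqr_ge0. Qed.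

Lemma dotv_eq0 u : dotv u u = 0 -> u = 0.
Proof.
move=> /eqP; rewrite psumr_eq0; last by move=> l _; rewrite -expr2 sqr_ge0.
move=> /allP h; apply/rowP => l; rewrite mxE.
by have := h l (mem_index_enum _); rewrite /= -expr2 sqrf_eq0 => /eqP.
Qed.

Lemma dotv_norm u v : `|dotv u v| <= n%:R * (`|u| * `|v|).
Proof.
rewrite (le_trans (ler_norm_sum _ _ _))//.
rewrite mulr_natl -[X in _ *+ X](card_ord n) -sumr_const.
apply: ler_sum => l _; rewrite normrM.
by apply: ler_pM => //; exact: coord_le_norm.
Qed.

Lemma coord_le_enorm u l : `|u 0 l| <= enorm u.
Proof.
rewrite -sqrtr_sqr ler_wsqrtr// /dotv (bigD1 l)//= -expr2 lerDl.
by apply: sumr_ge0 => j _; rewrite -expr2 sqr_ge0.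
Qed.

Lemma norm_le_enorm u : `|u| <= enorm u.
Proof. by apply: norm_le_coord; [exact: sqrtr_ge0|move=> l; exact: coord_le_enorm]. Qed.

Lemma enorm_sqr u : enorm u ^+ 2 = dotv u u.
Proof. by rewrite sqr_sqrtr// dotv_ge0. Qed.

Lemma continuous_coord l : continuous (fun u : 'rV[R]_n => u 0 l).
Proof. exact: coord_continuous. Qed.

Lemma continuous_dotv p : continuous (dotv p).
Proof.
apply: (continuous_big_sum (F := fun l u => p 0 l * u 0 l)) => l u.
by apply: continuousM; [exact: cst_continuous|exact: continuous_coord].
Qed.

Lemma continuous_dotvv : continuous (fun u : 'rV[R]_n => dotv u u).
Proof. apply: (continuous_big_sum (F := fun l (u : 'rV[R]_n) => u 0 l * u 0 l)) => l u.
by apply: continuousM; exact: continuous_coord. Qed.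

(** The support function of X at q.  It determines the closed convex hull of X, which
is why it can stand for the set in what follows. *)
Definition suppf (X : set 'rV[R]_n) q : R := sup [set dotv q d | d in X].

Section SupportFunction.
Variables (X : set 'rV[R]_n) (M : R).
Hypotheses (X0 : X !=set0) (XM : forall d, X d -> `|d| <= M).

Lemma suppf_has_sup q : has_sup [set dotv q d | d in X].
Proof.
split; first by case: X0 => d Xd; exists (dotv q d), d.
exists (n%:R * (`|q| * M)) => _ [d Xd <-].
rewrite (le_trans (ler_norm _))// (le_trans (dotv_norm _ _))//.
by rewrite ler_wpM2l// ler_wpM2l// XM.
Qed.

Lemma suppf_ub q d : X d -> dotv q d <= suppf X q.
Proof. by move=> Xd; apply: ub_le_sup; [case: (suppf_has_sup q)|exists d]. Qed.

Lemma suppf_le q (c : R) : (forall d, X d -> dotv q d <= c) -> suppf X q <= c.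
Proof.
by move=> h; apply: ge_sup; [case: (suppf_has_sup q)|move=> _ [d Xd <-]; exact: h].
Qed.

Lemma suppf_lip q q' : suppf X q <= suppf X q' + n%:R * M * `|q - q'|.
Proof.
apply: suppf_le => d Xd; rewrite -[q in leLHS](subrK q') addrC dotvDl lerD ?suppf_ub//.
rewrite (le_trans (ler_norm _))// (le_trans (dotv_norm _ _))//.
by rewrite -mulrA ler_wpM2l// mulrC ler_wpM2r// XM.
Qed.

Lemma suppf_norm q : `|suppf X q| <= n%:R * M * `|q|.
Proof.
have b d : X d -> `|dotv q d| <= n%:R * M * `|q|.
  move=> Xd; rewrite (le_trans (dotv_norm _ _))//.
  by rewrite -mulrA ler_wpM2l// mulrC ler_wpM2r// XM.
rewrite ler_norml; apply/andP; split.
  case: X0 => d Xd; rewrite (le_trans _ (suppf_ub q Xd))//.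
  by have := b _ Xd; rewrite ler_norml => /andP[].
by apply: suppf_le => d Xd; rewrite (le_trans (ler_norm _))// b.
Qed.

Lemma suppfZ (a : R) q : 0 <= a -> suppf X (a *: q) = a * suppf X q.
Proof.
move=> a0; apply/eqP; rewrite eq_le; apply/andP; split.
  by apply: suppf_le => d Xd; rewrite dotvZl ler_wpM2l// suppf_ub.
have [a00|a0'] := eqVneq a 0.
  by rewrite a00 mul0r; case: X0 => d Xd; rewrite (le_trans _ (suppf_ub _ Xd))// scale0r dotv0l.
have {a0'}a0 : 0 < a by rewrite lt_def a0'.
rewrite -ler_pdivlMl//; apply: suppf_le => d Xd.
by rewrite ler_pdivlMl// -dotvZl suppf_ub.
Qed.

End SupportFunction.

Lemma bounded_closed_ball (M : R) : compact [set d : 'rV[R]_n | `|d| <= M].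
Proof.
apply: bounded_closed_compact.
  by exists M; split; [exact: num_real|move=> x Mx d /= dM; rewrite (le_trans dM)// ltW].
apply: (@closed_comp _ _ (fun d : 'rV[R]_n => `|d|) [set y | y <= M]).
  by move=> x _; exact: norm_continuous.
exact: closed_le.
Qed.

(** By closedness of the graph, a point d outside D z stays outside D x for x near z;
compactness of the ball of radius M makes this uniform in d. *)
Lemma suppf_usc (D : 'rV[R]_n -> set 'rV[R]_n) (M : R) z p (c : R) :
  closed [set u : 'rV[R]_n * 'rV[R]_n | D u.1 u.2] ->
  (forall x, D x !=set0) -> (forall x d, D x d -> `|d| <= M) ->
  suppf (D z) p < c -> \forall x \near z, suppf (D x) p < c.
Proof.
move=> Dcl D0 DM hc.
pose c' := (suppf (D z) p + c) / 2.
have hc' : suppf (D z) p < c' by rewrite /c'; lra.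
have c'c : c' < c by rewrite /c'; lra.
have := @bounded_closed_ball M => /compact_near_coveringP.
move=> /(_ _ (nbhs z) (fun x d => D x d -> dotv p d <= c')) H.
have {}H : \forall x \near z, [set d : 'rV[R]_n | `|d| <= M] `<=`
    (fun d => D x d -> dotv p d <= c').
  apply: H => d dM.
  have [pd|pd] := ltP (dotv p d) c'.
    have cd : \forall d' \near d, dotv p d' < c'.
      exact: (@continuous_dotv p d) _ (lt_nbhsl pd).
    exists ([set d' | dotv p d' < c'], setT) => /=; first by split=> //; exact: filterT.
    by move=> [d' x] /= [/ltW].
  have nD : ~ D z d.
    by move=> Dd; have := le_lt_trans (suppf_ub (D0 z) (DM z) p Dd) hc'; rewrite ltNge pd.
  have : open (~` [set u : 'rV[R]_n * 'rV[R]_n | D u.1 u.2]) by exact/closed_openC.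
  rewrite openE => /(_ (z, d) nD) [[A B] /= [Az Bd] AB].
  exists (B, A) => //= -[d' x] /= [Bd' Ax] Dx.
  by have := AB (x, d') (conj Ax Bd') Dx.
apply: filterS H => x H; apply: le_lt_trans c'c.
apply: (suppf_le (D0 x) (@DM x)) => d Dd; apply: H => //=; exact: DM Dd.
Qed.

End Vec.

(** * The chain rule along Lipschitz curves *)

Lemma rV_rat_approx (R : realType) (n : nat) (x : 'rV[R]_n) (e : R) : 0 < e ->
  exists q : 'rV[rat]_n, forall l, `|x 0 l - ratr (q 0 l)| < e.
Proof.
move=> e0.
have h l : exists q : rat, `|x 0 l - ratr q| < e.
  have [q] := @rat_in_itvoo R (x 0 l - e) (x 0 l + e) ltac:(lra).
  rewrite in_itv/= => /andP[q1 q2]; exists q.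
  by rewrite ltr_norml; apply/andP; split; lra.
exists (\row_l projT1 (cid (h l))) => l; rewrite mxE.
by case: cid.
Qed.

(** An open set is a countable union of rational boxes, and the preimage of a box is
controlled coordinate by coordinate. *)
Lemma measurable_preimage_open d (T : measurableType d) (R : realType) (n : nat)
    (u : T -> 'rV[R]_n) (U : set 'rV[R]_n) :
  (forall l, measurable_fun setT (fun t => u t 0 l)) -> open U ->
  measurable (u @^-1` U).
Proof.
move=> mu oU.
pose box (a : 'rV[rat]_n * nat) : set 'rV[R]_n :=
  [set x | forall l, `|x 0 l - ratr (a.1 0 l)| < a.2.+1%:R^-1].
pose cell k : set 'rV[R]_n := if unpickle k is Some a then
   (if `[< box a `<=` U >] then box a else set0) else set0.
have -> : u @^-1` U = \bigcup_k (u @^-1` (cell k)).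
  apply/seteqP; split => t /=; last first.
    move=> [k _]; rewrite /cell; case: unpickle => // a /=.
    by case: asboolP => // aU /aU.
  move=> Ut; have := oU; rewrite openE => /(_ _ Ut) /nbhs_ballP[e /= e0 eU].
  have [k ke] : exists k, k.+1%:R^-1 < e / 2.
    have e2 : 0 < e / 2 by rewrite divr_gt0.
    near \oo => k; exists k.
    by near: k; exact: (near_infty_natSinv_lt (PosNum e2)).
  have [q qx] := rV_rat_approx (u t) (ltac:(by rewrite invr_gt0) : 0 < k.+1%:R^-1).
  exists (pickle (q, k)) => //=; rewrite /cell pickleK.
  case: asboolP => [_ //|]; case => y yb; apply: eU.
  rewrite mx_norm_ball /ball_/=.
  rewrite (@le_lt_trans _ _ (2 * k.+1%:R^-1))//; last by rewrite mulrC -ltr_pdivlMr.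
  apply: norm_le_coord => [|l]; first by rewrite mulr_ge0.
  rewrite !mxE -(subrKA (ratr (q 0 l))) (le_trans (ler_normD _ _))//.
  rewrite mulr_natl mulr2n; apply: lerD; apply: ltW; first exact: qx.
  by rewrite distrC; exact: yb.
apply: bigcupT_measurable => k; rewrite /cell; case: unpickle => [a|]; last first.
  by rewrite preimage_set0.
case: asboolP => _; last by rewrite preimage_set0.
rewrite (_ : _ @^-1` _ = \bigcap_(l in [set: 'I_n])
   (setT `&` (fun t => u t 0 l) @^-1` (ball (ratr (a.1 0 l) : R) (a.2.+1%:R^-1)))); last first.
  apply/seteqP; split => t /=.
    by move=> h l _; split => //=; rewrite /ball/= distrC; exact: h.
  by move=> h l; have [_] := h l I; rewrite /ball/= distrC.
apply: fin_bigcap_measurable => // l _; apply: mu => //.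
exact: measurable_ball.
Unshelve. all: by end_near. Qed.

Section null_eq.
Context d (T : measurableType d) (R : realType) (mu : {measure set T -> \bar R}).
Local Open Scope ereal_scope.

Import HBNNSimple.

(** The integral of f is a supremum over simple functions below f; restricted to the
complement of N, such a function is below g.  Working with simple functions covers
integrands that are not known to be measurable, such as that of [path_integral]. *)
Lemma ge0_le_integral_null (f g : T -> \bar R) (N : set T) :
  measurable N -> mu N = 0 -> (forall x, 0 <= f x) -> (forall x, 0 <= g x) ->
  (forall x, ~ N x -> f x = g x) -> \int[mu]_x f x <= \int[mu]_x g x.
Proof.
move=> mN N0 f0 g0 fg; rewrite !ge0_integralTE//.
apply: ge_ereal_sup => _ [h /= hf <-].
have mNC := measurableC mN.
rewrite (_ : sintegral mu h = sintegral mu (proj_nnsfun h mNC)).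
  apply: ereal_sup_ubound; exists (proj_nnsfun h mNC) => //= x.
  rewrite mindicE; case: (pselect (N x)) => Nx.
    by rewrite memNset ?mulr0//=; apply.
  by rewrite mem_set ?mulr1// -fg.
rewrite -!integralT_nnsfun.
apply: ge0_ae_eq_integral => //.
- exact/measurable_EFinP.
- exact/measurable_EFinP.
- by move=> x _; rewrite lee_fin.
- by move=> x _; rewrite lee_fin.
exists N; split => // x /= /not_implyP[_ hx]; apply: contrapT => Nx; apply: hx.
by rewrite mindicE mem_set// mulr1.
Qed.

Lemma integral_eq_null (f g : T -> \bar R) (D N : set T) :
  measurable N -> mu N = 0 -> (forall x, D x -> ~ N x -> f x = g x) ->
  \int[mu]_(x in D) f x = \int[mu]_(x in D) g x.
Proof.
move=> mN N0 fg.
have e (h h' : T -> \bar R) : (forall x, 0 <= h x) -> (forall x, 0 <= h' x) ->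
    (forall x, ~ N x -> h x = h' x) -> \int[mu]_x h x = \int[mu]_x h' x.
  move=> h0 h'0 hh; apply/eqP; rewrite eq_le !(@ge0_le_integral_null _ _ N)//.
  by move=> x Nx; rewrite hh.
have fgD x : ~ N x -> (f \_ D) x = (g \_ D) x.
  by move=> Nx; rewrite !patchE; case: ifPn => // /set_mem Dx; exact: fg.
rewrite integral_mkcond [RHS]integral_mkcond integralE [RHS]integralE.
congr (_ - _); apply: e => // x Nx.
- by rewrite !funeposE fgD.
- by rewrite !funenegE fgD.
Qed.

End null_eq.

Section Curve.
Variables (R : realType) (n : nat).
Local Notation mu := (@lebesgue_measure R).

(** A derivative that is measurable and bounded everywhere.  The endpoints belong to
the null set because the derivative there depends on gamma outside [0, 1]. *)
Lemma lipschitz_curve_derivative (gamma : R -> 'rV[R]_n) (L : R) :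
  (forall s t, `|gamma s - gamma t| <= L * `|s - t|) ->
  exists dg : R -> 'rV[R]_n, exists N : set R,
    [/\ measurable N, mu N = 0%E, forall l, measurable_fun setT (fun t => dg t 0 l),
       forall t, `|dg t| <= L &
       forall t, t \in `[0, 1] -> ~ N t -> 
         [/\ t \in `]0, 1[, derivable gamma t 1 & derive1 gamma t = dg t] ].
Proof.
move=> gL.
have L0 : 0 <= L.
  by have := le_trans (normr_ge0 _) (gL 1 0); rewrite subr0 normr1 mulr1.
have coordL l s t : `|gamma s 0 l - gamma t 0 l| <= L * `|s - t|.
  rewrite (le_trans _ (gL s t))//.
  by have := coord_le_norm (gamma s - gamma t) l; rewrite !mxE.
have H l := cid (lipschitz_FTC (coordL l)).
pose f l := projT1 (H l).
have mf l : measurable_fun setT (f l) by rewrite /f; case: (H l) => ? [].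
have fae l : {ae mu, forall t, t \in `]0, 1[ ->
    derivable (fun t => gamma t 0 l) t 1 /\ derive1 (fun t => gamma t 0 l) t = f l t}.
  by rewrite /f; case: (H l) => ? [].
have : {ae mu, forall t, forall l, t \in `]0, 1[ ->
    derivable (fun t => gamma t 0 l) t 1 /\ derive1 (fun t => gamma t 0 l) t = f l t}.
  by apply: filter_forall => l; exact: fae.
move=> [N0 [mN0 N00 N0P]].
pose N := N0 `|` ([set 0] `|` [set 1]).
have mN : measurable N by do 2?apply: measurableU.
have good t : t \in `[0, 1] -> ~ N t ->
  [/\ t \in `]0, 1[, derivable gamma t 1 & derive1 gamma t = \row_l f l t].
  rewrite in_itv/= => /andP[t0 t1] /not_orP[N0t /not_orP[/eqP t0' /eqP t1']].
  have t01 : t \in `]0, 1[ by rewrite in_itv/= !lt_def t0 t1 t0' eq_sym t1'.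
  have Ht l : derivable (fun t => gamma t 0 l) t 1 /\ derive1 (fun t => gamma t 0 l) t = f l t.
    have : forall l, t \in `]0, 1[ ->
      derivable (fun t => gamma t 0 l) t 1 /\ derive1 (fun t => gamma t 0 l) t = f l t.
      by apply: contrapT => h; apply: N0t; exact: N0P.
    by move=> /(_ l t01).
  have dg : derivable gamma t 1.
    by apply/derivable_mxP => i l; rewrite (ord1 i); case: (Ht l).
  split => //; rewrite derive1E derive_mx//; apply/rowP => l; rewrite !mxE.
  by rewrite -derive1E; case: (Ht l).
have mNC : measurable (`[0, 1]%classic `\` N : set R) by exact: measurableD.
exists (fun t => if t \in (`[0, 1]%classic `\` N) then \row_l f l t else 0), N.
split => //.
- have m1 (r : R) : mu [set r] = 0%E by exact: lebesgue_measure_set1.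
  have m01 : mu ([set 0] `|` [set 1]) = 0%E.
    by rewrite measureU0//; exact: m1.
  by rewrite measureU0//; exact: measurableU.
- move=> l.
  rewrite (_ : (fun _ => _) = (fun t => \1_(`[0, 1]%classic `\` N) t * f l t)).
    by apply: measurable_funM => //; exact: measurable_indic.
  apply/funext => t; rewrite indicE; case: ifPn => _.
    by rewrite mxE mul1r.
  by rewrite mxE mul0r.
- move=> t; case: ifPn => [/set_mem[/= t01 Nt]|_]; last by rewrite normr0.
  have [_ dg <-] := good _ t01 Nt.
  have dc : h^-1 *: (gamma (h + t) - gamma t) @[h --> 0^'] --> derive1 gamma t.
    rewrite derive1E; move: dg; rewrite /derivable /derive.
    under eq_fun do rewrite /= [_%:A]mulr1.
    by [].
  apply: (cvgr_to_le (F := 0^') (f := fun h : R => `|h^-1 *: (gamma (h + t) - gamma t)|)).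
    exact: cvg_norm dc.
  near=> h.
  rewrite normrZ normfV mulrC ler_pdivrMr.
    by rewrite (le_trans (gL _ _))// addrK.
  by rewrite normr_gt0; near: h; exact: nbhs_dnbhs_neq.
- move=> t t01 Nt; have [h1 h2 h3] := good _ t01 Nt; split => //.
  by rewrite mem_set.
Unshelve. all: by end_near. Qed.

Lemma lipschitz_abs_continuous01 (gamma : R -> 'rV[R]_n) (L : R) :
  (forall s t, `|gamma s - gamma t| <= L * `|s - t|) -> abs_continuous01 gamma.
Proof.
move=> gL e e0.
have L0 : 0 <= L.
  by have := le_trans (normr_ge0 _) (gL 1 0); rewrite subr0 normr1 mulr1.
exists (e / (L + 1)); first by rewrite divr_gt0// ltr_wpDl.
move=> r a b ab _; rewrite ltr_pdivlMr ?ltr_wpDl// => h; apply: le_lt_trans h.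
rewrite mulr_suml; apply: ler_sum => j _; rewrite (le_trans (gL _ _))//.
have [_ [ajb _]] := ab j.
by rewrite ger0_norm ?subr_ge0// mulrC ler_wpM2l ?subr_ge0// lerDl.
Qed.

Variables (N : nat) (f_ : 'I_N -> 'rV[R]_n -> R)
  (D_ : 'I_N -> 'rV[R]_n -> set 'rV[R]_n) (sigma M : R).
Hypothesis DM : forall i x d, D_ i x d -> `|d| <= M.
Hypothesis Dcons : forall i, admits_conservative_field (f_ i) (D_ i).

(** The support function at q of [reg_field sigma D_ x]: support functions are
additive, and taking the convex hull does not change them. *)
Definition reg_suppf (q x : 'rV[R]_n) : R :=
  N%:R^-1 * \sum_(i < N) suppf (D_ i x) q + sigma * dotv q x.

(** The support function is upper semicontinuous in the point and Lipschitz in the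
direction, so its strict sublevel sets are open in both variables together. *)
Lemma measurable_suppf dT (T : measurableType dT) i (q x : T -> 'rV[R]_n) :
  (forall l, measurable_fun setT (fun t => q t 0 l)) ->
  (forall l, measurable_fun setT (fun t => x t 0 l)) ->
  measurable_fun setT (fun t => suppf (D_ i (x t)) (q t)).
Proof.
have [[Dcl D0 _ _] _] := Dcons i.
move=> mq mx; apply: (measurability _ (RGenInftyO.measurableE R)) => //.
move=> _ [_ [c ->] <-]; rewrite setTI.
pose U := [set u : 'rV[R]_(n + n) | suppf (D_ i (rsubmx u)) (lsubmx u) < c].
rewrite (_ : _ @^-1` _ = (fun t => row_mx (q t) (x t)) @^-1` U); last first.
  apply/seteqP; split => t; rewrite /U /= in_itv/= row_mxKl row_mxKr; by [].
apply: measurable_preimage_open => [l|].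
  case: (split_ordP l) => k ->; first by under eq_fun do rewrite row_mxEl; exact: mq.
  by under eq_fun do rewrite row_mxEr; exact: mx.
rewrite openE => u /= Uu.
have {}Uu : suppf (D_ i (rsubmx u)) (lsubmx u) < c := Uu.
have M0 : 0 <= M by have [d Dd] := D0 0; rewrite (le_trans _ (DM Dd)).
pose e := (c - suppf (D_ i (rsubmx u)) (lsubmx u)) / 2.
have e0 : 0 < e by rewrite divr_gt0// subr_gt0.
have h1 : \forall x' \near rsubmx u, suppf (D_ i x') (lsubmx u) < c - e.
  by apply: (@suppf_usc _ _ _ M) => //; [exact: (DM (i := i))|rewrite /e; lra].
have h2 : \forall u' \near u, suppf (D_ i (rsubmx u')) (lsubmx u) < c - e.
  exact: (@continuous_rsubmx _ _ _ _ u) _ h1.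
have h3 : \forall u' \near u, `|lsubmx u - lsubmx u'| < e / (n%:R * M + 1).
  have := @continuous_lsubmx R 1 n n u.
  by move/cvgrPdist_lt; apply; rewrite divr_gt0// ltr_wpDl// mulr_ge0.
near=> u'.
have := @suppf_lip _ _ (D_ i (rsubmx u')) M (D0 _) (@DM i _) (lsubmx u') (lsubmx u).
move=> /le_lt_trans; apply.
have k2 : suppf (D_ i (rsubmx u')) (lsubmx u) < c - e by near: u'.
have : `|lsubmx u - lsubmx u'| < e / (n%:R * M + 1) by near: u'.
rewrite ltr_pdivlMr ?ltr_wpDl ?mulr_ge0// distrC => k3.
have := normr_ge0 (lsubmx u' - lsubmx u); rewrite -/(U u') /U.
move: k2 k3; set A := suppf _ _; set B := `|_|; nra.
Unshelve. all: by end_near. Qed.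

(** Integrability is bundled with the value so that finite sums of integrands can be
handled term by term. *)
Definition has_integral01 (phi : R -> R) (a : R) :=
  mu.-integrable `[0%R, 1%R] (EFin \o phi) /\
  (\int[mu]_(t in `[0%R, 1%R]) (phi t)%:E = a%:E)%E.

Lemma has_integral01D phi psi a b :
  has_integral01 phi a -> has_integral01 psi b ->
  has_integral01 (fun t => phi t + psi t) (a + b).
Proof.
move=> [ip pa] [iq qb]; split.
  rewrite (_ : EFin \o _ = (EFin \o phi) \+ (EFin \o psi))%E; last first.
    by apply/funext => t; rewrite /= EFinD.
  exact: integrableD.
under eq_integral do rewrite EFinD.
by rewrite integralD_EFin// pa qb.
Qed.

Lemma has_integral01Z (c : R) phi a :
  has_integral01 phi a -> has_integral01 (fun t => c * phi t) (c * a).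
Proof.
move=> [ip pa]; split.
  rewrite (_ : EFin \o _ = (fun t => c%:E * (EFin \o phi) t))%E; last first.
    by apply/funext => t; rewrite /= EFinM.
  exact: integrableZl.
under eq_integral do rewrite EFinM.
by rewrite integralZl// pa.
Qed.

Lemma has_integral01_bounded (phi : R -> R) (B : R) :
  measurable_fun setT phi -> (forall t, `|phi t| <= B) ->
  mu.-integrable `[0%R, 1%R] (EFin \o phi).
Proof.
move=> mphi phiB; apply: measurable_bounded_integrable.
- exact: measurable_itv.
- by rewrite /= lebesgue_measure_itv/= lte_fin ltr01 oppr0 adde0 ltry.
- exact: measurable_funTS.
- by exists B; split; [exact: num_real|move=> x Bx t _; exact: le_trans (phiB t) (ltW Bx)].
Qed.

Lemma has_integral01_cst (c : R) : has_integral01 (fun=> c) c.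
Proof.
split; first exact: (@has_integral01_bounded _ `|c|).
rewrite integral_cst//= lebesgue_measure_itv/= lte_fin ltr01 oppr0 adde0.
by rewrite mule1.
Qed.

Lemma has_integral01_sum (I : Type) (r : seq I) (phi : I -> R -> R) (a : I -> R) :
  (forall i, has_integral01 (phi i) (a i)) ->
  has_integral01 (fun t => \sum_(i <- r) phi i t) (\sum_(i <- r) a i).
Proof.
move=> pa; elim: r => [|i r IH].
  by under eq_fun do rewrite big_nil; rewrite big_nil; exact: has_integral01_cst.
under eq_fun do rewrite big_cons; rewrite big_cons.
exact: has_integral01D.
Qed.

Lemma derive_dotvv (gamma : R -> 'rV[R]_n) t : derivable gamma t 1 ->
  derivable (fun t => dotv (gamma t) (gamma t)) t 1 /\
  derive1 (fun t => dotv (gamma t) (gamma t)) t = 2 * dotv (derive1 gamma t) (gamma t).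
Proof.
move=> dg.
have dl l : is_derive t 1 (fun t => gamma t 0 l) (derive1 gamma t 0 l).
  apply: DeriveDef; first by have /derivable_mxP := dg; apply.
  by rewrite derive1E derive_mx// mxE.
have : is_derive t 1 (\sum_(l < n) ((fun t => gamma t 0 l) * (fun t => gamma t 0 l)))
  (2 * dotv (derive1 gamma t) (gamma t)).
  apply: is_derive_eq; rewrite /dotv mulr_sumr; apply: eq_bigr => l _.
  by rewrite /GRing.scale/=; ring.
have -> : \sum_(l < n) ((fun t => gamma t 0 l) * (fun t => gamma t 0 l)) =
   (fun t => dotv (gamma t) (gamma t)).
  by apply/funext => s; rewrite /dotv fct_sumE.
by case=> d1 d2; split=> //; rewrite derive1E.
Qed.

(** The derivative of g along gamma is [reg_suppf] at the velocity: the conservative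
field formula says so for each f_i, and the quadratic term contributes
sigma <gamma', gamma>.  Only velocities where gamma is differentiable matter. *)
Lemma reg_fun_curve (gamma : R -> 'rV[R]_n) (L B delta : R) :
  (forall s t, `|gamma s - gamma t| <= L * `|s - t|) -> (forall t, `|gamma t| <= B) ->
  (forall t, t \in `]0, 1[ -> derivable gamma t 1 ->
     delta <= reg_suppf (derive1 gamma t) (gamma t)) ->
  reg_fun sigma f_ (gamma 0) + delta <= reg_fun sigma f_ (gamma 1).
Proof.
move=> gL gB gd.
have [dg [N1 [mN1 N10 mdg dgL dgE]]] := lipschitz_curve_derivative gL.
have gac := lipschitz_abs_continuous01 gL.
have mg l : measurable_fun setT (fun t => gamma t 0 l).
  apply: continuous_measurable_fun => t.
  apply: (@continuous_comp _ _ _ gamma (fun u : 'rV[R]_n => u 0 l)); last exact: continuous_coord.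
  exact: lipschitz_continuous gL _.
have SL s t : `|dotv (gamma s) (gamma s) - dotv (gamma t) (gamma t)| <=
    (n%:R * L * (2 * B)) * `|s - t|.
  rewrite (_ : _ - _ = dotv (gamma s - gamma t) (gamma s + gamma t)); last first.
    by rewrite dotvBl !dotvDr (dotvC (gamma t) (gamma s)); ring.
  rewrite (le_trans (dotv_norm _ _))// -!mulrA ler_wpM2l//.
  rewrite (_ : L * _ = (L * `|s - t|) * (2 * B)); last by ring.
  apply: ler_pM => //; rewrite (le_trans (ler_normD _ _))//.
  by rewrite mulr_natl mulr2n lerD.
have [q [mq iq qE qd]] := lipschitz_FTC SL.
have [N2 [mN2 N20 N2P]] := qd.
have I2 : has_integral01 (fun t => 2 * dotv (dg t) (gamma t))
   (dotv (gamma 1) (gamma 1) - dotv (gamma 0) (gamma 0)).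
  split.
    apply: (@has_integral01_bounded _ (2 * (n%:R * (L * B)))) => [|t].
      by apply: measurable_funM => //; apply: measurable_sum => l; exact: measurable_funM.
    rewrite normrM ger0_norm// ler_wpM2l// (le_trans (dotv_norm _ _))// ler_wpM2l//.
    by rewrite ler_pM.
  rewrite qE; apply: (@integral_eq_null _ _ _ mu _ _ _ (N1 `|` N2)).
  - exact: measurableU.
  - by rewrite measureU0.
  move=> t t01 /not_orP[Nt1 Nt2]; congr EFin.
  have [t01' d1 d2] := dgE _ t01 Nt1.
  have h : t \in `]0, 1[ -> derivable (fun t => dotv (gamma t) (gamma t)) t 1 /\
    derive1 (fun t => dotv (gamma t) (gamma t)) t = q t.
    by apply: contrapT => h; apply: Nt2; exact: N2P.
  by rewrite -(h t01').2 (derive_dotvv d1).2 d2.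
have If i : has_integral01 (fun t => suppf (D_ i (gamma t)) (dg t)) (f_ i (gamma 1) - f_ i (gamma 0)).
  have [[Dcl D0 _ _] Dint] := Dcons i.
  split.
    apply: (@has_integral01_bounded _ (n%:R * M * L)) => [|t]; first exact: measurable_suppf.
    have M0 : 0 <= M by have [d Dd] := D0 0; rewrite (le_trans _ (DM Dd)).
    by rewrite (le_trans (suppf_norm (D0 _) (@DM i _) _))// ler_wpM2l// mulr_ge0.
  transitivity (path_integral (D_ i) gamma).
    apply: (@integral_eq_null _ _ _ mu _ _ _ N1) => // t t01 Nt; congr EFin.
    by have [_ _ <-] := dgE _ t01 Nt.
  have := Dint _ gac.
  case: path_integral => [r [->]||] //; congr EFin; ring.
have := has_integral01D (has_integral01D (has_integral01Z N%:R^-1 (has_integral01_sum (index_enum 'I_N) If))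
   (has_integral01Z (sigma / 2) I2)) (has_integral01_cst (- delta)).
set phi := fun t => _; set a := _ - delta => -[_ phia].
suff : (0 <= a%:E)%E.
  rewrite lee_fin /a /reg_fun /mean_fun !enorm_sqr sumrB; lra.
rewrite -phia (@integral_eq_null _ _ _ mu _ (fun t => `|phi t|%:E) _ N1)//.
  by apply: integral_ge0 => t _; rewrite lee_fin.
move=> t /= t01 Nt; congr EFin; rewrite ger0_norm// /phi subr_ge0.
have [t01' d1 d2] := dgE _ t01 Nt.
have := gd _ t01' d1; rewrite d2 /reg_suppf; lra.
Qed.
End Curve.

(** * Points of the convex hull of a compact set *)

Section Separation.
Variables (R : realType) (n : nat).

Definition simplex_comb (k : nat) (X : set 'rV[R]_n) (z : 'rV[R]_n) :=
  exists (lam : 'I_k -> R) (x : 'I_k -> 'rV[R]_n),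
    [/\ forall i, 0 <= lam i, \sum_i lam i = 1, forall i, X (x i) &
        z = \sum_i lam i *: x i].

Lemma simplex_comb_convex k X z (C : set 'rV[R]_n) :
  @convex_set R (convex_lmodType 'rV[R]_n) C -> X `<=` C ->
  simplex_comb k X z -> C z.
Proof.
move=> cC XC [lam [x [l0 l1 Xx ->]]].
elim: k => [|k IH] in lam x l0 l1 Xx *.
  by move: l1; rewrite big_ord0 => /eqP; rewrite eq_sym oner_eq0.
rewrite big_ord_recl; set z1 := \sum_(i < k) _.
have l01 : lam ord0 <= 1.
  by rewrite -l1 big_ord_recl lerDl sumr_ge0.
have [e|ne] := eqVneq (lam ord0) 1.
  have z0 : z1 = 0.
    rewrite /z1 big1// => i _.
    have : \sum_(i < k) lam (lift ord0 i) = 0.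
      by move: l1; rewrite big_ord_recl e -[RHS]addr0 => /addrI.
    move/eqP; rewrite psumr_eq0// => /allP/(_ i (mem_index_enum _))/eqP ->.
    by rewrite scale0r.
  by rewrite z0 e scale1r addr0; exact: XC.
have l1' : 0 < 1 - lam ord0 by rewrite subr_gt0 lt_def eq_sym ne l01.
have Cz : C ((1 - lam ord0)^-1 *: z1).
  rewrite /z1 scaler_sumr; under eq_bigr do rewrite scalerA.
  apply: IH => // [i|].
    by rewrite mulr_ge0// invr_ge0 ltW.
  rewrite -mulr_sumr; have : \sum_(i < k) lam (lift ord0 i) = 1 - lam ord0.
    by rewrite -l1 big_ord_recl addrC addKr.
  by move=> ->; rewrite mulVf// gt_eqF.
have t01 : Itv.spec (Itv.num_sem (R := R)) (Itv.Real `[0%Z, 1%Z]) (lam ord0).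
  by rewrite /= /Itv.num_sem/= num_real/= in_itv/= l0 l01.
have := cC (x ord0) ((1 - lam ord0)^-1 *: z1) (Itv.mk t01).
rewrite !inE => /(_ (XC _ (Xx _)) Cz).
rewrite /conv/= scalerA [X in X *: z1](_ : _ = 1) ?scale1r// mulfV// gt_eqF//.
Qed.

(** Caratheodory: n + 2 points of R^n are affinely dependent, and moving the
coefficients along the dependency until the first of them vanishes drops a point. *)
Lemma simplex_comb_reduce X z :
  simplex_comb n.+2 X z -> simplex_comb n.+1 X z.
Proof.
move=> [mu [x [m0 m1 Xx zE]]].
pose A : 'M[R]_(n.+2, n + 1) := \matrix_i row_mx (x i) 1%:M.
have : kermx A != 0.
  rewrite kermx_eq0 /row_free neq_ltn; apply/orP; left.
  by rewrite (leq_ltn_trans (rank_leq_col _))// addn1.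
move=> /rowV0Pn[nu /sub_kermxP nuA nu0].
have nuE : \sum_i nu 0 i *: row_mx (x i) (1%:M : 'rV[R]_1) = 0.
  by transitivity (nu *m A) => //; rewrite mulmx_sum_row; apply: eq_bigr => i _; rewrite rowK.
have nux : \sum_i nu 0 i *: x i = 0.
  have := congr1 lsubmx nuE; rewrite linear0 => {2}<-.
  rewrite linear_sum; apply: eq_bigr => i _.
  by rewrite linearZ/= row_mxKl.
have nu1 : \sum_i nu 0 i = 0.
  have := congr1 (fun u => rsubmx u 0 0) nuE; rewrite linear0 [RHS]mxE => {2}<-.
  rewrite linear_sum summxE; apply: eq_bigr => i _.
  by rewrite linearZ/= row_mxKr !mxE eqxx mulr1.
have [i0 i0P] : exists i, 0 < nu 0 i.
  apply: contrapT => /forallNP h; move/negP: nu0; apply; apply/eqP/rowP => i.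
  have h' j : 0 <= - nu 0 j by rewrite oppr_ge0 leNgt; apply/negP/h.
  have : \sum_i - nu 0 i = 0 by rewrite sumrN nu1 oppr0.
  move/eqP; rewrite psumr_eq0// => /allP/(_ i (mem_index_enum _)).
  by rewrite oppr_eq0 mxE => /eqP.
pose r i := mu i / nu 0 i.
pose j := [arg min_(i < i0 | 0 < nu 0 i) r i]%O.
have [jP jmin] : 0 < nu 0 j /\ forall i, 0 < nu 0 i -> r j <= r i.
  by rewrite /j; case: arg_minP => // k kP kmin; split.
have r0 : 0 <= r j by rewrite divr_ge0// ltW.
pose mu' i := mu i - r j * nu 0 i.
have mu'0 i : 0 <= mu' i.
  rewrite /mu' subr_ge0; have [np|np] := ltP 0 (nu 0 i).
    by rewrite -ler_pdivlMr// jmin.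
  by rewrite (le_trans _ (m0 i))// mulr_ge0_le0.
have mu'j : mu' j = 0 by rewrite /mu' /r divfK ?subrr// gt_eqF.
have mu'1 : \sum_i mu' i = 1 by rewrite sumrB m1 -mulr_sumr nu1 mulr0 subr0.
have mu'z : \sum_i mu' i *: x i = z.
  under eq_bigr do rewrite scalerBl -scalerA.
  by rewrite sumrB -scaler_sumr nux scaler0 subr0.
have big_lift (V : nmodType) (F : 'I_n.+2 -> V) :
    \sum_i F i = F j + \sum_(i < n.+1) F (lift j i).
  by rewrite (bigD1_ord j).
exists (fun i => mu' (lift j i)), (fun i => x (lift j i)); split => //.
- by rewrite -mu'1 big_lift mu'j add0r.
- by rewrite -mu'z big_lift mu'j scale0r add0r.
Qed.


(** With the number of points fixed, the combinations are a continuous image of a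
compact set of coefficients and points. *)
Lemma simplex_comb_minimizer X : X !=set0 -> compact X ->
  exists2 q, simplex_comb n.+1 X q &
    forall z, simplex_comb n.+1 X z -> dotv q q <= dotv z z.
Proof.
move=> [x0 Xx0] cX.
pose T : 'I_n.+1 -> topologicalType := fun=> (R * 'rV[R]_n)%type.
pose K0 : set (prod_topology T) := [set f | forall i, (`[0, 1]%classic `*` X) (f i)].
have cK0 : compact K0.
  apply: (@tychonoff _ T (fun=> `[0, 1]%classic `*` X)) => i.
  by apply: compact_setX => //; exact: segment_compact.
have pc i : continuous (fun f : prod_topology T => f i).
  exact: (@proj_continuous _ T i).
have c1 i : continuous (fun f : prod_topology T => (f i).1).
  by move=> f; apply: continuous_comp; [exact: pc|exact: cvg_fst].
have c2 i : continuous (fun f : prod_topology T => (f i).2).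
  by move=> f; apply: continuous_comp; [exact: pc|exact: cvg_snd].
pose K := K0 `&` [set f : prod_topology T | \sum_i (f i).1 = 1].
have cK : compact K.
  apply: compact_closedI => //.
  apply: (@closed_comp _ _ (fun f : prod_topology T => \sum_i (f i).1) [set 1]).
    by move=> f _; exact: (continuous_big_sum (F := fun i (f : prod_topology T) => (f i).1)).
  exact: closed_eq.
pose comb (f : prod_topology T) := \sum_i (f i).1 *: (f i).2.
have combc : continuous (fun f => dotv (comb f) (comb f)).
  have cl l : continuous (fun f => comb f 0 l).
    have -> : (fun f : prod_topology T => comb f 0 l) =
        (fun f : prod_topology T => \sum_i (f i).1 * (f i).2 0 l).
      by apply/funext => f; rewrite /comb summxE; apply: eq_bigr => i _; rewrite mxE.
    apply: (continuous_big_sum (F := fun i (f : prod_topology T) => (f i).1 * (f i).2 0 l)).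
    move=> i f.
    apply: (@continuousM _ _ (fun f : prod_topology T => (f i).1)
      (fun f : prod_topology T => (f i).2 0 l)); first exact: c1.
    exact: (continuous_comp (c2 i f) (@continuous_coord _ _ l _)).
  apply: (continuous_big_sum (F := fun l (f : prod_topology T) => comb f 0 l * comb f 0 l)) => l f.
  by apply: (@continuousM _ _ (fun f : prod_topology T => comb f 0 l)); exact: cl.
have K_nonempty : K !=set0.
  exists (fun i => ((i == ord0)%:R, x0)); split => [i|] /=.
    by rewrite in_itv/=; case: (i == ord0); rewrite ?lexx ?ler01.
  by rewrite (bigD1 ord0)//= big1 ?addr0// => i /negbTE ->.
have [f fK fmin] := compact_EVT_min K_nonempty cK (continuous_subspaceT combc).
have cmin z : simplex_comb n.+1 X z -> dotv (comb f) (comb f) <= dotv z z.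
  move=> [lam [x [l0 l1 Xx ->]]].
  have /fmin : (fun i => (lam i, x i)) \in K.
    rewrite inE; split => //= i; split => //=; rewrite in_itv/= l0/=.
    by rewrite -l1 (bigD1 i)//= lerDl sumr_ge0.
  by [].
exists (comb f) => //.
move: fK; rewrite inE => -[fK0 f1].
exists (fun i => (f i).1), (fun i => (f i).2); split => // i.
- by have [/=] := fK0 i; rewrite in_itv/= => /andP[].
- by have [] := fK0 i.
Qed.

(** Let q be the combination of X - w of least norm.  If q is nonzero, some y in X - w
has <q, y> <= 0, and moving from q towards y decreases the norm. *)
Lemma convex_hull_separation (X : set 'rV[R]_n) (w : 'rV[R]_n) :
  compact X -> (forall p, exists2 x, X x & dotv p w <= dotv p x) ->
  convex_hull X w.
Proof.
move=> cX Xp.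
have X0 : X !=set0 by have [x] := Xp 0; exists x.
pose Y := [set x - w | x in X].
have cY : compact Y.
  apply: continuous_compact => //; apply: continuous_subspaceT => x.
  apply: (@continuousB _ _ _ id (cst w)); last exact: cst_continuous.
  by move=> ?; exact.
have Y0 : Y !=set0 by have [x Xx] := X0; exists (x - w), x.
have [q Yq qmin] := simplex_comb_minimizer Y0 cY.
suff q0 : q = 0.
  move: Yq; rewrite q0 => -[lam [y [l0 l1 Yy yE]]].
  move=> C [/= cC XC].
  apply: (@simplex_comb_convex n.+1 X _ C) => //.
  exists lam, (fun i => y i + w); split => // [i|].
    by have [x Xx <-] := Yy i; rewrite subrK.
  under eq_bigr do rewrite scalerDr.
  by rewrite big_split/= -yE add0r -scaler_suml l1 scale1r.
apply: dotv_eq0; apply/eqP; rewrite eq_le dotv_ge0 andbT leNgt; apply/negP => qq.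
have [x Xx] := Xp (- q); rewrite -subr_ge0 -dotvBr dotvNl oppr_ge0 => qx.
pose y := x - w; have Yy : Y y by exists x.
pose A := dotv q q; pose B := dotv y y.
have A0 : 0 < A by [].
have B0 : 0 <= B by exact: dotv_ge0.
(* below A / (A + B), which minimizes the norm in the case <q, y> = 0 *)
pose t := A / (A + B + A).
have t0 : 0 < t by rewrite divr_gt0//; lra.
have t1 : t < 1 by rewrite ltr_pdivrMr; lra.
have tE : t * (A + B + A) = A by rewrite divfK// gt_eqF//; lra.
have : simplex_comb n.+1 Y ((1 - t) *: q + t *: y).
  apply: simplex_comb_reduce.
  have [lam [z [l0 l1 Yz ->]]] := Yq.
  (* a combination of n + 2 points, with y as the first *)
  pose lam' (i : 'I_n.+2) := oapp (fun j : 'I_n.+1 => (1 - t) * lam j) t (unlift ord0 i).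
  pose z' (i : 'I_n.+2) := oapp z y (unlift ord0 i).
  have lam'0 : lam' ord0 = t by rewrite /lam' unlift_none.
  have lam'S i : lam' (lift ord0 i) = (1 - t) * lam i by rewrite /lam' liftK.
  have z'0 : z' ord0 = y by rewrite /z' unlift_none.
  have z'S i : z' (lift ord0 i) = z i by rewrite /z' liftK.
  exists lam', z'; split.
  - by move=> i; rewrite /lam'; case: unlift => [j|]/=; [rewrite mulr_ge0//; lra|exact: ltW].
  - rewrite big_ord_recl lam'0; under eq_bigr do rewrite lam'S.
    by rewrite -mulr_sumr l1; ring.
  - by move=> i; rewrite /z'; case: unlift.
  - rewrite [RHS]big_ord_recl lam'0 z'0 addrC; congr (_ + _).
    under [RHS]eq_bigr do rewrite lam'S z'S -scalerA.
    by rewrite scaler_sumr.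
move=> /qmin.
rewrite dotvDl !dotvDr !dotvZl !dotvZr (dotvC y q) -/A -/B.
move: qx; rewrite -/y; set C := dotv q y => qx.
rewrite leNgt => /negP; apply.
have : t * t * (A + B + A) = t * A by rewrite -mulrA tE.
have tA : 0 < t * A by rewrite mulr_gt0.
have ttA : 0 <= t * t * A by apply: mulr_ge0; [apply: mulr_ge0|]; exact: ltW.
have : (1 - t) * t * C <= 0.
  by apply: mulr_ge0_le0 => //; apply: mulr_ge0; lra.
nra.
Qed.

End Separation.

(** * Definable predicates *)

Import (canonicals) mpoly.

Section Definable.
Variables (R : realType) (S : forall n : nat, set (set 'rV[R]_n)).
Hypothesis HS : o_minimal S.

(** Definability of a predicate on environments, i.e. assignments of reals to n
variables, which is easier to transform than a set of row vectors. *)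
Definition dfn n (P : ('I_n -> R) -> Prop) := S [set x : 'rV[R]_n | P (x 0)].

Lemma dfn_ext n (P Q : ('I_n -> R) -> Prop) :
  (forall f, P f <-> Q f) -> dfn P -> dfn Q.
Proof.
by move=> PQ; rewrite /dfn (_ : [set x : 'rV_n | P (x 0)] = [set x : 'rV_n | Q (x 0)])//;
  apply/seteqP; split => x /= /PQ.
Qed.

Lemma dfnI n (A : set 'rV[R]_n) (P : ('I_n -> R) -> Prop) :
  S A -> (forall x, A x <-> P (x 0)) -> dfn P.
Proof. by move=> SA AP; rewrite /dfn (_ : [set x | _] = A)//; apply/seteqP; split => x /= /AP. Qed.

Lemma dfn_not n (P : ('I_n -> R) -> Prop) : dfn P -> dfn (fun f => ~ P f).
Proof. exact: (omin_setC HS). Qed.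

Lemma dfn_or n (P Q : ('I_n -> R) -> Prop) :
  dfn P -> dfn Q -> dfn (fun f => P f \/ Q f).
Proof. exact: (omin_setU HS). Qed.

Lemma dfn_and n (P Q : ('I_n -> R) -> Prop) :
  dfn P -> dfn Q -> dfn (fun f => P f /\ Q f).
Proof.
move=> /dfn_not dP /dfn_not dQ; apply: dfn_ext (dfn_not (dfn_or dP dQ)) => f.
by split; [move=> /not_orP[/contrapT ? /contrapT ?]|move=> [? ?] []].
Qed.

Lemma dfn_cast m n (e : m = n) (P : ('I_m -> R) -> Prop) :
  dfn P -> dfn (fun f : 'I_n -> R => P (fun i => f (cast_ord e i))).
Proof.
case: _ / e; apply: dfn_ext => f.
by rewrite (_ : (fun i => _) = f)//; apply/funext => i; rewrite cast_ord_id.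
Qed.

Lemma dfn_padl k n (P : ('I_n -> R) -> Prop) :
  dfn P -> dfn (fun f : 'I_(k + n) -> R => P (fun i => f (rshift k i))).
Proof.
move=> dP; elim: k => [|k IH].
  apply: dfn_ext dP => f; rewrite (_ : (fun i => _) = f)//.
  by apply/funext => i; congr f; apply/val_inj.
apply: (dfnI (omin_prodl HS IH)) => x /=.
rewrite (_ : (fun i => _) = (fun i : 'I_n => x 0 (rshift k.+1 i)))//.
by apply/funext => i; rewrite mxE; congr (x _ _); apply/val_inj.
Qed.

Definition glue (T : Type) n k (f : 'I_n -> T) (g : 'I_k -> T) (i : 'I_(n + k)) : T :=
  match fintype.split i with inl i => f i | inr j => g j end.

Lemma glueK T n k (h : 'I_(n + k) -> T) :
  glue (fun i => h (lshift k i)) (fun j => h (rshift n j)) = h.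
Proof.
by apply/funext => i; rewrite /glue; case: (split_ordP i) => j ->;
  rewrite ?split_lshift ?split_rshift.
Qed.

Lemma glue_l T n k (f : 'I_n -> T) (g : 'I_k -> T) i : glue f g (lshift k i) = f i.
Proof. by rewrite /glue (unsplitK (inl _ i)). Qed.

Lemma glue_r T n k (f : 'I_n -> T) (g : 'I_k -> T) j : glue f g (rshift n j) = g j.
Proof. by rewrite /glue (unsplitK (inr _ j)). Qed.

Lemma dfn_ex1 n (P : ('I_(n + 1) -> R) -> Prop) :
  dfn P -> dfn (fun f => exists y : 'I_1 -> R, P (glue f y)).
Proof.
move=> dP; apply: (dfnI (omin_proj HS dP)) => x /=; split.
  move=> [z Pz <-]; exists (fun j => z 0 (rshift n j)).
  rewrite (_ : lsubmx z 0 = (fun i => z 0 (lshift 1 i))) ?glueK//.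
  by apply/funext => i; rewrite mxE.
move=> [y Py]; exists (\row_i glue (x 0) y i).
  by rewrite (_ : (\row__ _) 0 = glue (x 0) y)//; apply/funext => i; rewrite mxE.
by apply/rowP => i; rewrite !mxE glue_l.
Qed.

(** By induction on k, since the projection axiom concerns a single variable. *)
Lemma dfn_ex n k (P : ('I_(n + k) -> R) -> Prop) :
  dfn P -> dfn (fun f => exists y : 'I_k -> R, P (glue f y)).
Proof.
elim: k P => [|k IH] P dP.
  have := dfn_cast (addn0 n) dP; apply: dfn_ext => f; split => [Pf|[y]].
    exists (fun=> 0); rewrite (_ : glue _ _ = (fun i => f (cast_ord (addn0 n) i)))//.
    apply/funext => i; case: (split_ordP i) => [j ->|[]//].
    by rewrite glue_l; congr f; apply/val_inj.
  rewrite (_ : glue _ _ = (fun i => f (cast_ord (addn0 n) i)))//.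
  apply/funext => i; case: (split_ordP i) => [j ->|[]//].
  by rewrite glue_l; congr f; apply/val_inj.
have e : (n + k.+1 = (n + k) + 1)%N by rewrite addn1 addnS.
have := IH _ (dfn_ex1 (dfn_cast e dP)); apply: dfn_ext => f.
have gE (y : 'I_k -> R) (z : 'I_1 -> R) (w : 'I_k.+1 -> R) :
    (forall j : 'I_k, w (widen_ord (leqnSn k) j) = y j) -> w ord_max = z 0 ->
    (fun i => glue (glue f y) z (cast_ord e i)) = glue f w.
  move=> wy wz; apply/funext => i; case: (split_ordP i) => j ->.
    rewrite glue_l (_ : cast_ord _ _ = lshift 1 (lshift k j)) ?glue_l//.
    exact/val_inj.
  rewrite glue_r; have [jk|jk] := ltnP j k.
    rewrite (_ : cast_ord _ _ = lshift 1 (rshift n (Ordinal jk))); last exact/val_inj.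
    by rewrite glue_l glue_r -wy; congr w; apply/val_inj.
  have jE : j = ord_max by apply/val_inj/eqP; rewrite /= eqn_leq jk -ltnS ltn_ord.
  rewrite (_ : cast_ord _ _ = rshift (n + k) 0); last first.
    by apply/val_inj; rewrite /= jE /= addn0.
  by rewrite glue_r -wz jE.
split=> [[y [z Pz]]|[w Pw]].
  exists (fun j : 'I_k.+1 => if insub (val j) is Some i then y i else z 0).
  rewrite -(gE y z)// => [j|]; last by rewrite insubF//= ltnn.
  by rewrite /= (_ : insub _ = Some j)// insubT// => ?; congr Some; apply/val_inj.
exists (fun j => w (widen_ord (leqnSn k) j)), (fun=> w ord_max).
by rewrite (gE _ _ w).
Qed.

Definition polyf n (F : ('I_n -> R) -> R) :=
  exists p : mpoly.mpoly n R, forall f, F f = mpoly.meval f p.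

Lemma dfn_eq0 n (F : ('I_n -> R) -> R) : polyf F -> dfn (fun f => F f = 0).
Proof. by move=> [p Fp]; apply: (dfnI (omin_algebraic HS p)) => x /=; rewrite Fp. Qed.

Lemma polyf_var n (i : 'I_n) : polyf (fun f => f i).
Proof. by exists (mpoly.mpolyX R (mpoly.mnm1 i)) => f; rewrite mpoly.mevalXU. Qed.

Lemma polyf_cst n (c : R) : polyf (fun _ : 'I_n -> R => c).
Proof. by exists (mpoly.mpolyC n c) => f; rewrite mpoly.mevalC. Qed.

Lemma polyfD n (F G : ('I_n -> R) -> R) :
  polyf F -> polyf G -> polyf (fun f => F f + G f).
Proof. by move=> [p Fp] [q Gq]; exists (p + q) => f; rewrite mpoly.mevalD Fp Gq. Qed.

Lemma polyfM n (F G : ('I_n -> R) -> R) :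
  polyf F -> polyf G -> polyf (fun f => F f * G f).
Proof. by move=> [p Fp] [q Gq]; exists (p * q) => f; rewrite mpoly.mevalM Fp Gq. Qed.

Lemma polyfN n (F : ('I_n -> R) -> R) : polyf F -> polyf (fun f => - F f).
Proof. by move=> [p Fp]; exists (- p) => f; rewrite mpoly.mevalN Fp. Qed.

Lemma dfn_true n : dfn (fun _ : 'I_n -> R => True).
Proof. by apply: dfn_ext (dfn_eq0 (polyf_cst n 0)). Qed.

Lemma dfn_forall (J : finType) n (P : J -> ('I_n -> R) -> Prop) :
  (forall j, dfn (P j)) -> dfn (fun f => forall j, P j f).
Proof.
move=> dP.
have h (s : seq J) : dfn (fun f => forall j, j \in s -> P j f).
  elim: s => [|j s IH]; first by apply: dfn_ext (dfn_true n).
  apply: dfn_ext (dfn_and (dP j) IH) => f; split => [[Pj Ps] i|h].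
    by rewrite inE => /orP[/eqP->|/Ps].
  by split=> [|i si]; apply: h; rewrite inE ?eqxx ?si ?orbT.
by apply: dfn_ext (h (enum J)) => f; split => h' j; have := h' j; rewrite mem_enum => H *; apply: H.
Qed.

(** The substituted environment is reached through a fresh block of variables y,
constrained by the equations y_i = f (s i) and then projected away. *)
Lemma dfn_reindex j k (s : 'I_j -> 'I_k) (P : ('I_j -> R) -> Prop) :
  dfn P -> dfn (fun f => P (fun i => f (s i))).
Proof.
move=> /(@dfn_padl k) dP.
have dE : dfn (fun f : 'I_(k + j) -> R => forall i, f (lshift j (s i)) + - f (rshift k i) = 0).
  by apply: dfn_forall => i; apply/dfn_eq0/polyfD; [|apply: polyfN]; exact: polyf_var.
apply: dfn_ext (dfn_ex (dfn_and dP dE)) => f; split => [[y [Py ye]]|Pf].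
  rewrite (_ : (fun i => _) = (fun i => glue f y (rshift k i)))//.
  apply/funext => i; have := ye i; rewrite glue_l => /eqP; rewrite subr_eq0 => /eqP ->//.
exists (fun i => f (s i)); split => [|i]; last by rewrite glue_l glue_r subrr.
rewrite (_ : (fun i => _) = (fun i => f (s i)))//.
by apply/funext => i; rewrite glue_r.
Qed.

End Definable.

Section DefT.
Variables (R : realType) (S : forall n : nat, set (set 'rV[R]_n)).
Hypothesis HS : o_minimal S.

(** Environments indexed by an arbitrary finite type: a variable is then named by a
constructor, a quantifier adds a summand to the index type, and renaming is
reindexing along a function. *)
Definition definable (I : finType) (P : (I -> R) -> Prop) :=
  dfn S (fun f : 'I_#|I| -> R => P (fun i => f (enum_rank i))).

Lemma definable_ext (I : finType) (P Q : (I -> R) -> Prop) :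
  (forall e, P e <-> Q e) -> definable P -> definable Q.
Proof. by move=> PQ; apply: dfn_ext => f; exact: PQ. Qed.

Lemma definable_dfn (I : finType) k (s : I -> 'I_k) (P : (I -> R) -> Prop) :
  definable P -> dfn S (fun f : 'I_k -> R => P (fun i => f (s i))).
Proof.
move=> /(dfn_reindex HS (fun i => s (enum_val i))); apply: dfn_ext => f.
by rewrite (_ : (fun i => f (s (enum_val (enum_rank i)))) = (fun i => f (s i)))//;
  apply/funext => i; rewrite enum_rankK.
Qed.

Lemma dfn_definable (I : finType) k (t : 'I_k -> I) (P : ('I_k -> R) -> Prop) :
  dfn S P -> definable (fun e => P (fun j => e (t j))).
Proof. exact: (dfn_reindex HS (fun j => enum_rank (t j))). Qed.

Lemma definable_reindex (I J : finType) (s : J -> I) (P : (J -> R) -> Prop) :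
  definable P -> definable (fun e => P (fun j => e (s j))).
Proof. exact: (definable_dfn (fun j => enum_rank (s j))). Qed.

Lemma definable_not (I : finType) (P : (I -> R) -> Prop) :
  definable P -> definable (fun e => ~ P e).
Proof. exact: dfn_not. Qed.

Lemma definable_and (I : finType) (P Q : (I -> R) -> Prop) :
  definable P -> definable Q -> definable (fun e => P e /\ Q e).
Proof. exact: dfn_and. Qed.

Lemma definable_or (I : finType) (P Q : (I -> R) -> Prop) :
  definable P -> definable Q -> definable (fun e => P e \/ Q e).
Proof. exact: dfn_or. Qed.

Lemma definable_imp (I : finType) (P Q : (I -> R) -> Prop) :
  definable P -> definable Q -> definable (fun e => P e -> Q e).
Proof.
move=> dP dQ; apply: definable_ext (definable_or (definable_not dP) dQ) => e.
by split=> [[//|//]|PQ]; have [/PQ|] := pselect (P e); [right|left].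
Qed.

Lemma definable_forall_fin (I J : finType) (P : J -> (I -> R) -> Prop) :
  (forall j, definable (P j)) -> definable (fun e => forall j, P j e).
Proof. by move=> dP; apply: (dfn_forall HS). Qed.

Lemma definable_ex (I J : finType) (P : (I -> R) -> (J -> R) -> Prop) :
  definable (fun h : I + J -> R => P (fun i => h (inl i)) (fun j => h (inr j))) ->
  definable (fun e => exists g : J -> R, P e g).
Proof.
pose s (x : I + J) : 'I_(#|I| + #|J|) :=
  match x with inl i => lshift _ (enum_rank i) | inr j => rshift _ (enum_rank j) end.
move=> /(definable_dfn s) /(dfn_ex HS); apply: dfn_ext => f.
have E (y : 'I_#|J| -> R) : (fun i => glue f y (s (inl i))) = (fun i => f (enum_rank i)) /\
   (fun j => glue f y (s (inr j))) = (fun j => y (enum_rank j)).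
  by split; apply/funext => i; rewrite /= ?glue_l ?glue_r.
split=> [[y]|[g Pg]].
  by rewrite (E y).1 (E y).2 => Py; exists (fun j => y (enum_rank j)).
exists (fun j => g (enum_val j)); rewrite (E _).1 (E _).2.
by rewrite (_ : (fun j => _) = g)//; apply/funext => j; rewrite enum_rankK.
Qed.

Lemma definable_all (I J : finType) (P : (I -> R) -> (J -> R) -> Prop) :
  definable (fun h : I + J -> R => P (fun i => h (inl i)) (fun j => h (inr j))) ->
  definable (fun e => forall g : J -> R, P e g).
Proof.
move=> /definable_not /(@definable_ex I J (fun e g => ~ P e g)) /definable_not.
apply: definable_ext => e; split => [h g|h [g]]; last by apply; exact: h.
by apply: contrapT => Pn; apply: h; exists g.
Qed.

Lemma definable_exR (I : finType) (P : (I -> R) -> R -> Prop) :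
  definable (fun h : I + unit -> R => P (fun i => h (inl i)) (h (inr tt))) ->
  definable (fun e => exists y : R, P e y).
Proof.
move=> /(@definable_ex I unit (fun e g => P e (g tt))); apply: definable_ext => e.
by split=> [[g]|[y Py]]; [exists (g tt)|exists (fun=> y)].
Qed.

Lemma definable_allR (I : finType) (P : (I -> R) -> R -> Prop) :
  definable (fun h : I + unit -> R => P (fun i => h (inl i)) (h (inr tt))) ->
  definable (fun e => forall y : R, P e y).
Proof.
move=> /(@definable_all I unit (fun e g => P e (g tt))); apply: definable_ext => e.
by split=> [h y|h g]; [exact: (h (fun=> y))|exact: h].
Qed.

Definition polyT (I : finType) (F : (I -> R) -> R) :=
  polyf (fun f : 'I_#|I| -> R => F (fun i => f (enum_rank i))).

Lemma polyT_var (I : finType) (i : I) : polyT (fun e => e i).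
Proof. exact: polyf_var. Qed.

Lemma polyT_cst (I : finType) (c : R) : polyT (fun _ : I -> R => c).
Proof. exact: polyf_cst. Qed.

Lemma polyTD (I : finType) (F G : (I -> R) -> R) :
  polyT F -> polyT G -> polyT (fun e => F e + G e).
Proof. exact: polyfD. Qed.

Lemma polyTM (I : finType) (F G : (I -> R) -> R) :
  polyT F -> polyT G -> polyT (fun e => F e * G e).
Proof. exact: polyfM. Qed.

Lemma polyTN (I : finType) (F : (I -> R) -> R) : polyT F -> polyT (fun e => - F e).
Proof. exact: polyfN. Qed.

Lemma polyTB (I : finType) (F G : (I -> R) -> R) :
  polyT F -> polyT G -> polyT (fun e => F e - G e).
Proof. by move=> pF pG; apply: polyTD => //; exact: polyTN. Qed.

Lemma polyT_sum (I : finType) (J : Type) (r : seq J) (F : J -> (I -> R) -> R) :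
  (forall j, polyT (F j)) -> polyT (fun e => \sum_(j <- r) F j e).
Proof.
move=> pF; elim: r => [|j r IH].
  by under eq_fun do rewrite big_nil; exact: polyT_cst.
by under eq_fun do rewrite big_cons; exact: polyTD.
Qed.

Lemma polyT_reindex (I J : finType) (s : J -> I) (F : (J -> R) -> R) :
  polyT F -> polyT (fun e => F (fun j => e (s j))).
Proof.
move=> [p Fp].
exists (mpoly.comp_mpoly [tuple mpoly.mpolyX R (mpoly.mnm1 (enum_rank (s (enum_val i)))) | i < #|J|] p) => f.
rewrite mpoly.comp_mpoly_meval.
have := Fp (fun i => f (enum_rank (s (enum_val i)))).
rewrite (_ : (fun i => f (enum_rank (s (enum_val (enum_rank i))))) =
   (fun j => f (enum_rank (s j)))); last by apply/funext => j; rewrite enum_rankK.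
move=> ->; apply: mpoly.meval_eq => i.
by rewrite tnth_mktuple mpoly.mevalXU.
Qed.

Lemma definable_eq (I : finType) (F G : (I -> R) -> R) :
  polyT F -> polyT G -> definable (fun e => F e = G e).
Proof.
move=> pF pG; have := dfn_eq0 HS (polyTB pF pG); apply: dfn_ext => f.
by split => [/eqP|->]; [rewrite subr_eq0 => /eqP|rewrite subrr].
Qed.

(** F <= G iff G - F is a square. *)
Lemma definable_le (I : finType) (F G : (I -> R) -> R) :
  polyT F -> polyT G -> definable (fun e => F e <= G e).
Proof.
move=> pF pG.
have : definable (fun h : I + unit -> R =>
    G (fun i => h (inl i)) - F (fun i => h (inl i)) = h (inr tt) * h (inr tt)).
  apply: definable_eq; last by apply: polyTM; exact: polyT_var.
  exact: (polyT_reindex (@inl I unit) (polyTB pG pF)).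
move=> /(@definable_exR I (fun e y => G e - F e = y * y)); apply: definable_ext => e.
split=> [[y yE]|FG]; first by rewrite -subr_ge0 yE -expr2 sqr_ge0.
by exists (Num.sqrt (G e - F e)); rewrite -expr2 sqr_sqrtr// subr_ge0.
Qed.

Lemma tame_unit (phi : R -> Prop) :
  definable (fun e : unit -> R => phi (e tt)) ->
  exists s : seq (interval R), forall x, phi x <-> exists2 J, J \in s & x \in J.
Proof.
move=> /(definable_dfn (fun _ => ord0 : 'I_1)) /(omin_tame HS)[s sE].
exists s => x.
have := congr1 (fun A => A (\row_(i < 1) x)) sE; rewrite /= !mxE => pE.
by rewrite -pE.
Qed.


Lemma definable_lt (I : finType) (F G : (I -> R) -> R) :
  polyT F -> polyT G -> definable (fun e => F e < G e).
Proof.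
move=> pF pG; apply: definable_ext (definable_not (definable_le pG pF)) => e.
by rewrite ltNge; split => /negP.
Qed.
End DefT.

(** * Definable functions of one real variable *)

Section Clamp.
Variable R : realType.
Implicit Types p q t : R.

Definition clamp p q t := Num.max p (Num.min t q).

Lemma clamp_itv p q t : p <= q -> p <= clamp p q t <= q.
Proof. by move=> pq; rewrite /clamp le_max lexx ge_max pq ge_min lexx orbT. Qed.

Lemma clamp_id p q t : p <= t <= q -> clamp p q t = t.
Proof. by move=> /andP[pt tq]; rewrite /clamp min_l// max_r. Qed.

Lemma clamp_homo p q : {homo clamp p q : x y / x <= y}.
Proof.
move=> x y xy; rewrite /clamp ge_max !le_max lexx/= le_min !ge_min xy !lexx !orbT.
by rewrite ?orbT.
Qed.

Lemma clamp_lip p q x y : `|clamp p q x - clamp p q y| <= `|x - y|.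
Proof.
suff H x' y' : x' <= y' -> `|clamp p q x' - clamp p q y'| <= `|x' - y'|.
  have [/H//|/ltW/H] := leP x y.
  by rewrite distrC (distrC y).
move=> xy; rewrite ler0_norm ?subr_le0 ?clamp_homo// ler0_norm ?subr_le0//.
rewrite /clamp; have [h1|h1] := leP x' q; have [h2|h2] := leP y' q.
- by have [h3|h3] := leP p x'; have [h4|h4] := leP p y'; lra.
- by have [h3|h3] := leP p x'; have [h4|h4] := leP p q; lra.
- by have [h3|h3] := leP p q; have [h4|h4] := leP p y'; lra.
- by rewrite subrr oppr0 oppr_ge0 subr_le0.
Qed.

Lemma clamp_continuous p q : continuous (clamp p q).
Proof. by apply: (@lipschitz_continuous _ _ _ 1) => s t; rewrite mul1r; exact: clamp_lip. Qed.

End Clamp.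

Section Monotone.
Variables (R : realType) (S : forall n : nat, set (set 'rV[R]_n)).
Hypothesis HS : o_minimal S.
Local Notation definable := (definable S).
Local Notation definable1 phi := (definable (fun e : unit -> R => phi (e tt))).

Lemma itv_convex (J : interval R) x y z : x \in J -> y \in J -> x <= z <= y -> z \in J.
Proof. by move=> xJ yJ; exact: (@interval_is_interval _ J x y). Qed.

(** A finite union of intervals either contains a subinterval of [a, b] or misses one:
go through the intervals, shrinking [a, b] away from each that meets it in at most
a point. *)
Lemma definable_dichotomy (phi : R -> Prop) a b : definable1 phi -> a < b ->
  exists p q, [/\ a <= p, p < q, q <= b &
    (forall t, p <= t <= q -> phi t) \/ (forall t, p <= t <= q -> ~ phi t)].
Proof.
move=> /(tame_unit HS)[s sE].
suff H : forall a b, a < b -> exists p q, [/\ a <= p, p < q, q <= b &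
    (exists2 J, J \in s & forall t, p <= t <= q -> t \in J) \/
    (forall t J, J \in s -> p <= t <= q -> t \notin J)].
  move=> /H[p [q [ap pq qb [[J Js h]|h]]]]; exists p, q; split => //; [left|right] => t tpq.
    by apply/sE; exists J => //; exact: h.
  by move=> /sE[J Js]; apply/negP; exact: h.
elim: (s) => [|J s' IH] {}a {}b ab.
  by exists a, b; split => //; right.
have [[x [y [ax xy yb xJ yJ]]]|noJ] :=
    pselect (exists x y, [/\ a <= x, x < y, y <= b, x \in J & y \in J]).
  exists x, y; split => //; left; exists J; first by rewrite mem_head.
  by move=> t; exact: itv_convex.
have [c [d [ac cd db cdJ]]] : exists c d, [/\ a <= c, c < d, d <= b & forall t, c <= t <= d -> t \notin J].
  have [[x [ax xb xJ]]|noJ1] := pselect (exists x, [/\ a <= x, x < b & x \in J]).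
    exists ((x + b) / 2), b; split => //; [lra|lra|] => t /andP[t1 t2].
    apply/negP => tJ; apply: noJ; exists x, t; split => //; lra.
  exists a, ((a + b) / 2); split => //; [lra|lra|] => t /andP[t1 t2].
  apply/negP => tJ; apply: noJ1; exists t; split => //; lra.
have [p [q [cp pq qd [[K Ks h]|h]]]] := IH _ _ cd.
  exists p, q; split; [lra|by []|lra|left]; exists K => //.
  by rewrite inE Ks orbT.
exists p, q; split; [lra|by []|lra|right] => t K; rewrite inE => /orP[/eqP ->|Ks] tpq.
  by apply: cdJ; lra.
exact: h.
Qed.

(** An interval that accumulates at t from the right contains a right neighbourhood
of t. *)
Lemma definable_germ_right (phi : R -> Prop) t : definable1 phi ->
  exists2 d, 0 < d & (forall s, t < s < t + d -> phi s) \/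
                     (forall s, t < s < t + d -> ~ phi s).
Proof.
move=> /(tame_unit HS)[s sE].
suff [d d0 H] : exists2 d, 0 < d &
    (exists2 J, J \in s & forall u, t < u < t + d -> u \in J) \/
    (forall u J, J \in s -> t < u < t + d -> u \notin J).
  exists d => //; case: H => [[J Js h]|h]; [left|right] => u tu.
    by apply/sE; exists J => //; exact: h.
  by move=> /sE[J Js]; apply/negP; exact: h.
elim: (s) => [|J s' [d d0 IH]].
  by exists 1 => //; right.
have [[e [e0 eJ]]|noJ] := pselect (exists e, 0 < e /\ forall u, t < u < t + e -> u \notin J).
  exists (Num.min d e); first by rewrite lt_min d0.
  have de u : t < u < t + Num.min d e -> t < u < t + d /\ t < u < t + e.
    move=> /andP[-> h]; split => /=; apply: lt_le_trans h _; rewrite lerD2l ge_min lexx ?orbT//.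
  case: IH => [[K Ks h]|h]; [left|right].
    by exists K => [|u /de[? _]]; [rewrite inE Ks orbT|exact: h].
  move=> u K; rewrite inE => /orP[/eqP->|Ks] /de[u1 u2]; first exact: eJ.
  exact: h.
have accJ e : 0 < e -> exists2 u, t < u < t + e & u \in J.
  move=> e0; apply: contrapT => h; apply: noJ; exists e; split => // u tu.
  by apply/negP => uJ; apply: h; exists u.
have [v /andP[tv _] vJ] := accJ 1 ltr01.
exists (v - t); first lra.
left; exists J; first exact: mem_head.
move=> u /andP[tu uv]; have [w /andP[tw wu] wJ] := accJ (u - t) ltac:(lra).
by apply: (itv_convex wJ vJ); lra.
Qed.

(** An interval with two points contains a segment. *)
Lemma definable_finite_or_itv (phi : R -> Prop) : definable1 phi ->
  finite_set [set x | phi x] \/ exists c d, c < d /\ forall t, c <= t <= d -> phi t.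
Proof.
move=> /(tame_unit HS)[s sE].
suff [h|[J Js [x [y [xy xJ yJ]]]]] : finite_set [set x | exists2 J, J \in s & x \in J] \/
   exists2 J, J \in s & exists x y, [/\ x < y, x \in J & y \in J].
- by left; rewrite (_ : [set x | phi x] = [set x | exists2 J, J \in s & x \in J])//;
    apply/seteqP; split => x /sE.
- right; exists x, y; split => // t txy; apply/sE; exists J => //.
  exact: itv_convex xJ yJ txy.
elim: (s) => [|J s' [IH|[K Ks h]]].
- by left; rewrite (_ : [set x | _] = set0)//; apply/seteqP; split => x //= [].
- have [[x [y xyJ]]|noJ] := pselect (exists x y, [/\ x < y, x \in J & y \in J]).
    by right; exists J; [exact: mem_head|exists x, y].
  left; apply: (@sub_finite_set _ _ ([set x | x \in J] `|` [set x | exists2 J, J \in s' & x \in J])).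
    by move=> x /= [K]; rewrite inE => /orP[/eqP-> xJ|Ks xK]; [left|right; exists K].
  rewrite finite_setU; split => //.
  have [[x xJ]|h] := pselect (exists x, x \in J); last first.
    by rewrite (_ : [set x | _] = set0)//; apply/seteqP; split => x //= xJ; apply: h; exists x.
  apply: (@sub_finite_set _ _ [set x]) => // y yJ /=.
  have [xy|yx|//] := ltgtP x y; exfalso; apply: noJ; first by exists x, y.
  by exists y, x.
- by right; exists K => //; rewrite inE Ks orbT.
Qed.

Local Notation definable2 G := (definable (fun e : unit + unit -> R => G (e (inl tt)) (e (inr tt)))).

(** Definability is a property of the relation G; h is the function that it defines
on [a, b]. *)
Definition graph_on (G : R -> R -> Prop) (h : R -> R) a b :=
  forall t, a <= t <= b -> forall y, G t y <-> y = h t.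

(** The relation rel holds between h t and h s for all s close to t on the side given by
the sign of sg.  It is stated through the graph G of h, so that it is definable in t. *)
Definition germ (G : R -> R -> Prop) (sg : R) (rel : R -> R -> Prop) (t : R) :=
  exists d, 0 < d /\ forall s, 0 < sg * (s - t) -> sg * (s - t) < d ->
    exists y, exists y', G t y /\ G s y' /\ rel y y'.

Lemma definable_germ G sg rel : definable2 G -> definable2 rel -> definable1 (germ G sg rel).
Proof.
move=> dG drel.
apply: (definable_exR HS (P := fun e d => 0 < d /\ forall s, 0 < sg * (s - e tt) ->
  sg * (s - e tt) < d -> exists y, exists y', G (e tt) y /\ G s y' /\ rel y y')).
apply: (definable_and HS).
  by apply: (definable_lt HS); [exact: polyT_cst|exact: polyT_var].
apply: (definable_allR HS (P := fun (e : unit + unit -> R) s => 0 < sg * (s - e (inl tt)) ->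
  sg * (s - e (inl tt)) < e (inr tt) ->
  exists y, exists y', G (e (inl tt)) y /\ G s y' /\ rel y y')).
have pv : polyT (fun e : unit + unit + unit -> R => sg * (e (inr tt) - e (inl (inl tt)))).
  by apply: polyTM; [exact: polyT_cst|apply: polyTB; exact: polyT_var].
apply: (definable_imp HS); first by apply: (definable_lt HS) => //; exact: polyT_cst.
apply: (definable_imp HS); first by apply: (definable_lt HS) => //; exact: polyT_var.
apply: (definable_exR HS (P := fun (e : unit + unit + unit -> R) y => exists y',
  G (e (inl (inl tt))) y /\ G (e (inr tt)) y' /\ rel y y')).
apply: (definable_exR HS (P := fun (e : unit + unit + unit + unit -> R) y' =>
  G (e (inl (inl (inl tt)))) (e (inr tt)) /\ G (e (inl (inr tt))) y' /\ rel (e (inr tt)) y')).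
pose I5 := (unit + unit + unit + unit + unit)%type.
apply: (definable_and HS).
  exact: (definable_reindex HS (fun u : unit + unit =>
    (match u with inl _ => inl (inl (inl (inl tt))) | inr _ => inl (inr tt) end) : I5) dG).
apply: (definable_and HS).
  exact: (definable_reindex HS (fun u : unit + unit =>
    (match u with inl _ => inl (inl (inr tt)) | inr _ => inr tt end) : I5) dG).
exact: (definable_reindex HS (fun u : unit + unit =>
    (match u with inl _ => inl (inr tt) | inr _ => inr tt end) : I5) drel).
Qed.

Lemma definable_compose_opp G : definable2 G ->
  definable2 (fun t y => G (- t) y) /\ definable2 (fun t y => G t (- y)).
Proof.
move=> dG; split.
  apply: (@definable_ext _ _ _ (fun e : unit + unit -> R => exists u, u = - e (inl tt) /\ G u (e (inr tt)))).
    by move=> e; split=> [[u [-> //]]|?]; exists (- e (inl tt)).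
  apply: (definable_exR HS (P := fun (e : unit + unit -> R) u => u = - e (inl tt) /\ G u (e (inr tt)))).
  apply: (definable_and HS).
    by apply: (definable_eq HS); [|apply: polyTN]; exact: polyT_var.
  exact: (definable_reindex HS (fun u : unit + unit =>
    (match u with inl _ => inr tt | inr _ => inl (inr tt) end) : (unit + unit + unit)%type) dG).
apply: (@definable_ext _ _ _ (fun e : unit + unit -> R => exists u, u = - e (inr tt) /\ G (e (inl tt)) u)).
  by move=> e; split=> [[u [-> //]]|?]; exists (- e (inr tt)).
apply: (definable_exR HS (P := fun (e : unit + unit -> R) u => u = - e (inr tt) /\ G (e (inl tt)) u)).
apply: (definable_and HS).
  by apply: (definable_eq HS); [|apply: polyTN]; exact: polyT_var.
exact: (definable_reindex HS (fun u : unit + unit =>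
  (match u with inl _ => inl (inl tt) | inr _ => inr tt end) : (unit + unit + unit)%type) dG).
Qed.

Lemma definable_slice G (rel : R -> R -> Prop) r : definable2 G -> definable2 rel ->
  definable1 (fun s => exists y, G s y /\ rel r y).
Proof.
move=> dG drel.
apply: (@definable_ext _ _ _ (fun e : unit -> R => exists u, u = r /\ exists y, G (e tt) y /\ rel u y)).
  by move=> e; split=> [[u [-> //]]|?]; exists r.
apply: (definable_exR HS (P := fun (e : unit -> R) u => u = r /\ exists y, G (e tt) y /\ rel u y)).
apply: (definable_and HS).
  by apply: (definable_eq HS); [exact: polyT_var|exact: polyT_cst].
apply: (definable_exR HS (P := fun (e : unit + unit -> R) y => G (e (inl tt)) y /\ rel (e (inr tt)) y)).
apply: (definable_and HS).
  exact: (definable_reindex HS (fun u : unit + unit =>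
    (match u with inl _ => inl (inl tt) | inr _ => inr tt end) : (unit + unit + unit)%type) dG).
exact: (definable_reindex HS (fun u : unit + unit =>
    (match u with inl _ => inl (inr tt) | inr _ => inr tt end) : (unit + unit + unit)%type) drel).
Qed.

Let ltP_ : R -> R -> Prop := fun x y => x < y.
Let gtP_ : R -> R -> Prop := fun x y => y < x.
Let eqP_ : R -> R -> Prop := fun x y => x = y.

Let dlt : definable2 ltP_.
Proof. by apply: (definable_lt HS); exact: polyT_var. Qed.
Let dgt : definable2 gtP_.
Proof. by apply: (definable_lt HS); exact: polyT_var. Qed.
Let deq : definable2 eqP_.
Proof. by apply: (definable_eq HS); exact: polyT_var. Qed.

(** The sets of s with h s > h t and with h s < h t are definable, so each of them has
a constant truth value just after t. *)
Lemma germ_trichotomy_right G h a b t : definable2 G -> graph_on G h a b ->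
  a <= t -> t < b -> [\/ germ G 1 ltP_ t, germ G 1 eqP_ t | germ G 1 gtP_ t].
Proof.
move=> dG hG a_t tb.
have Gh s : a <= s <= b -> G s (h s) by move=> sab; exact/hG.
have [d1 d10 h1] := definable_germ_right t (definable_slice (h t) dG dlt).
have [d2 d20 h2] := definable_germ_right t (definable_slice (h t) dG dgt).
pose d := Num.min (b - t) (Num.min d1 d2).
have d0 : 0 < d by rewrite !lt_min d10 d20 subr_gt0 tb.
have dd s : 0 < 1 * (s - t) -> 1 * (s - t) < d ->
    [/\ a <= s <= b, t < s < t + d1 & t < s < t + d2].
  rewrite !mul1r !lt_min => s0 /and3P[s1 s2 s3]; split; lra.
have tab : a <= t <= b by rewrite a_t ltW.
case: h1 => h1; [apply: Or31|case: h2 => h2; [apply: Or33|apply: Or32]];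
    exists d; split=> // s s0 s1; have [sab st1 st2] := dd s s0 s1;
    exists (h t), (h s); (split; [exact: Gh|split; [exact: Gh|]]).
- by have [y [/(hG _ sab) -> ]] := h1 s st1.
- by have [y [/(hG _ sab) -> ]] := h2 s st2.
- rewrite /eqP_; have [lt|lt|//] := ltgtP (h t) (h s).
    by exfalso; apply: (h1 s st1); exists (h s); split=> //; exact: Gh.
  by exfalso; apply: (h2 s st2); exists (h s); split=> //; exact: Gh.
Qed.

Lemma graph_on_oppl G h a b :
  graph_on G h a b -> graph_on (fun t y => G (- t) y) (fun t => h (- t)) (- b) (- a).
Proof. by move=> hG t tab y; apply: hG; lra. Qed.

Lemma graph_on_oppr G h a b :
  graph_on G h a b -> graph_on (fun t y => G t (- y)) (fun t => - h t) a b.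
Proof.
move=> hG t tab y; split => [/(hG _ tab) <-|->]; first by rewrite opprK.
by rewrite opprK; exact/hG.
Qed.

Lemma germ_oppl G rel t : germ (fun t y => G (- t) y) 1 rel (- t) -> germ G (- 1) rel t.
Proof.
move=> [d [d0 H]]; exists d; split=> // s s0 s1.
by have [||y [y']] := H (- s); [lra|lra|rewrite !opprK => ?; exists y, y'].
Qed.

Lemma germ_trichotomy_left G h a b t : definable2 G -> graph_on G h a b ->
  a < t -> t <= b -> [\/ germ G (-1) ltP_ t, germ G (-1) eqP_ t | germ G (-1) gtP_ t].
Proof.
move=> dG hG a_t tb.
have [] := @germ_trichotomy_right _ _ (- b) (- a) (- t) (definable_compose_opp dG).1 (graph_on_oppl hG).
- lra.
- lra.
- by move=> /germ_oppl; exact: Or31.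
- by move=> /germ_oppl; exact: Or32.
- by move=> /germ_oppl; exact: Or33.
Qed.

(** The type of the germ is a definable function of t with three values. *)
Lemma germ_uniform G a b sg : definable2 G -> a < b ->
  (forall t, a < t < b -> [\/ germ G sg ltP_ t, germ G sg eqP_ t | germ G sg gtP_ t]) ->
  exists p q, [/\ a < p, p < q, q < b &
   [\/ forall t, p <= t <= q -> germ G sg ltP_ t,
       forall t, p <= t <= q -> germ G sg eqP_ t |
       forall t, p <= t <= q -> germ G sg gtP_ t]].
Proof.
move=> dG ab tri.
(* stay away from the endpoints, where one of the germs does not exist *)
have ab' : a + (b - a) / 3 < b - (b - a) / 3 by lra.
have [p [q [ap pq qb H]]] := definable_dichotomy (definable_germ sg dG dlt) ab'.
case: H => H1; first by exists p, q; split; [lra|by []|lra|exact: Or31].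
have [p' [q' [pp' pq' qq' H]]] := definable_dichotomy (definable_germ sg dG deq) pq.
case: H => H2; first by exists p', q'; split; [lra|by []|lra|exact: Or32].
exists p', q'; split; [lra|by []|lra|apply: Or33 => t tpq].
have [|h|h|//] := tri t; first lra.
  by exfalso; apply: (H1 t) => //; lra.
by exfalso; apply: (H2 t).
Qed.

(** Let m be the supremum of the s up to which h stays above h x.  The left germ at m
gives h x < h m, and if m < y the right germ at m pushes the supremum further. *)
Lemma increasing_of_germs G h a b p q : graph_on G h a b ->
  a < p -> q < b ->
  (forall t, p <= t <= q -> germ G 1 ltP_ t) ->
  (forall t, p <= t <= q -> germ G (-1) gtP_ t) ->
  forall x y, p <= x -> x < y -> y <= q -> h x < h y.
Proof.
move=> hG ap qb gr gl x y px xy yq.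
have grh t : p <= t <= q -> exists2 d, 0 < d & forall s, t < s < t + d -> s <= q -> h t < h s.
  move=> tpq; have [d [d0 H]] := gr t tpq; exists d => // s sd sq.
  have [||z [z' [zt [zs]]]] := H s; [lra|lra|].
  have /hG := zt => /(_ ltac:(lra)) ->; have /hG := zs => /(_ ltac:(lra)) ->; exact.
have glh t : p <= t <= q -> exists2 d, 0 < d & forall s, t - d < s < t -> p <= s -> h s < h t.
  move=> tpq; have [d [d0 H]] := gl t tpq; exists d => // s sd sq.
  have [||z [z' [zt [zs]]]] := H s; [lra|lra|].
  have /hG := zt => /(_ ltac:(lra)) ->; have /hG := zs => /(_ ltac:(lra)) ->; exact.
pose E := [set s | x < s <= y /\ forall u, x < u <= s -> h x < h u].
have ext s : (s = x \/ E s) -> s < y -> (forall u, x < u <= s -> h x < h u) ->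
    exists2 s', s < s' & E s'.
  move=> sE sy sh.
  have sx : x <= s by case: sE => [->//|[/andP[/ltW]]].
  have [d d0 H] := grh s ltac:(lra).
  pose s' := Num.min (s + d / 2) y.
  have s1 : s < s' by rewrite lt_min sy andbT; lra.
  have s2 : s' <= s + d / 2 by rewrite /s' ge_min lexx.
  have s3 : s' <= y by rewrite /s' ge_min lexx orbT.
  exists s' => //; split => [|u ux]; first lra.
  have [us|us] := leP u s; first by apply: sh; lra.
  have hs : h s < h u by apply: H; lra.
  case: sE => [<-//|[/andP[xs _] hE]].
  by rewrite (lt_trans _ hs)// hE// xs lexx.
have [s0 xs0 Es0] : exists2 s', x < s' & E s'.
  by apply: ext => //; [left|move=> u; lra].
have hsE : has_sup E by split; [exists s0|exists y => s [/andP[]]].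
pose m := sup E.
have mE s : E s -> s <= m by move=> Es; apply: ub_le_sup => //; case: hsE.
have my : m <= y by apply: ge_sup; [exists s0|move=> s [/andP[]]].
have xm : x < m by rewrite (lt_le_trans xs0)// mE.
have hm u : x < u -> u < m -> h x < h u.
  move=> xu um; have [|s Es us] := @sup_adherent _ E (m - u) _ hsE; first by rewrite subr_gt0.
  by case: Es => _; apply; rewrite xu/= ltW//; move: us; rewrite /m; lra.
have hxm : h x < h m.
  have [d d0 H] := glh m ltac:(lra).
  pose u := (Num.max x (m - d) + m) / 2.
  have : Num.max x (m - d) < m by rewrite gt_max xm; lra.
  have : x <= Num.max x (m - d) by rewrite le_max lexx.
  have : m - d <= Num.max x (m - d) by rewrite le_max lexx orbT.
  move=> k1 k2 k3.
  rewrite (@lt_trans _ _ (h u))//; first by apply: hm; rewrite /u; lra.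
  by apply: H; rewrite /u; lra.
have hm' u : x < u <= m -> h x < h u.
  by move=> /andP[xu]; rewrite le_eqVlt => /orP[/eqP->//|um]; exact: hm.
have [my'|ym] := ltP m y; last by rewrite (_ : y = m)//; apply/eqP; rewrite eq_le ym my.
have Em : E m by split => //; rewrite xm my.
by have [s' ms' /mE] := ext m (or_intror Em) my' hm'; rewrite leNgt ms'.
Qed.

Lemma itv_not_countable (p q : R) (f : R -> nat) : p < q ->
  (forall x y, p <= x <= q -> p <= y <= q -> f x = f y -> x = y) -> False.
Proof.
move=> pq finj; have : countable `[p, q]%classic.
  by apply/countable_injP; exists f => x y; rewrite !inE /= !in_itv/=; exact: finj.
move=> /countable_lebesgue_measure0; rewrite lebesgue_measure_itv/= lte_fin pq.
by move=> /eqP; rewrite -EFinD eqe subr_eq0 gt_eqF.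
Qed.

(** Rational intervals separate strict local minima, so there are countably many of
them. *)
Lemma no_strict_local_min G h a b p q : graph_on G h a b -> a < p -> p < q -> q < b ->
  (forall t, p <= t <= q -> germ G 1 ltP_ t) ->
  (forall t, p <= t <= q -> germ G (-1) ltP_ t) -> False.
Proof.
move=> hG ap pq qb gr gl.
have loc t : p <= t <= q -> exists r : rat * rat, [/\ ratr r.1 < t, t < ratr r.2 &
    forall s, ratr r.1 < s < ratr r.2 -> p <= s <= q -> s != t -> h t < h s].
  move=> tpq; have [d [d0 H]] := gr t tpq; have [e [e0 K]] := gl t tpq.
  have [r1] := @rat_in_itvoo R (t - e) t ltac:(lra); rewrite in_itv/= => /andP[r11 r12].
  have [r2] := @rat_in_itvoo R t (t + d) ltac:(lra); rewrite in_itv/= => /andP[r21 r22].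
  exists (r1, r2); split => //= s /andP[s1 s2] spq st.
  have hz z : G t z -> z = h t by move/hG; apply; lra.
  have hz' z : G s z -> z = h s by move/hG; apply; lra.
  have [ts|ts|ts] := ltgtP t s; last by rewrite ts eqxx in st.
    have [||z [z' [/hz -> [/hz' -> //]]]] := H s; lra.
  have [||z [z' [/hz -> [/hz' -> //]]]] := K s; lra.
pose f t := if pselect (p <= t <= q) is left k then projT1 (cid (loc t k)) else (0, 0).
have fP t : p <= t <= q -> [/\ ratr (f t).1 < t, t < ratr (f t).2 &
    forall s, ratr (f t).1 < s < ratr (f t).2 -> p <= s <= q -> s != t -> h t < h s].
  by move=> tpq; rewrite /f; case: pselect => // k; case: cid.
apply: (@itv_not_countable p q (pickle \o f) pq) => x y xpq ypq.
move=> /(pcan_inj (@pickleK _)) fxy; apply/eqP; apply/negPn/negP => nxy.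
have [x1 x2 x3] := fP x xpq; have [y1 y2 y3] := fP y ypq.
have := x3 y; rewrite fxy y1 y2 ypq eq_sym nxy => /(_ isT isT isT) h1.
have := y3 x; rewrite -fxy x1 x2 xpq nxy => /(_ isT isT isT) h2.
by have := lt_trans h1 h2; rewrite ltxx.
Qed.

Definition monotone_fun (c : R -> R) :=
  {homo c : x y / x <= y} \/ {homo c : x y / x <= y >-> y <= x}.

(** h agrees on some subinterval of [a, b] with a function that is continuous and
monotone on the whole line; a total function composes more easily. *)
Definition continuous_piece (h : R -> R) (a b : R) :=
  exists p q c, [/\ a <= p, p < q, q <= b & [/\ continuous c, monotone_fun c &
    forall t, p <= t <= q -> h t = c t]].

Lemma continuous_pieceN h a b : continuous_piece (fun t => - h t) a b -> continuous_piece h a b.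
Proof.
move=> [p [q [c [ap pq qb [cc mc hc]]]]]; exists p, q, (fun t => - c t); split => //; split.
- by move=> t; apply: cvgN; exact: cc.
- by case: mc => mc; [right|left] => x y xy; rewrite lerN2 mc.
- by move=> t /hc <-; rewrite opprK.
Qed.

(** The range of h is definable and infinite, hence contains an interval, and a
strictly monotone function onto an interval is continuous. *)
Lemma continuous_piece_increasing G h a b p q : definable2 G -> graph_on G h a b ->
  a < p -> p < q -> q < b -> (forall x y, p <= x -> x < y -> y <= q -> h x < h y) ->
  continuous_piece h a b.
Proof.
move=> dG hG ap pq qb hinc.
have hinj x y : p <= x <= q -> p <= y <= q -> h x = h y -> x = y.
  move=> xpq ypq hxy; have [xy|yx|//] := ltgtP x y.
    by have := hinc x y ltac:(lra) xy ltac:(lra); rewrite hxy ltxx.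
  by have := hinc y x ltac:(lra) yx ltac:(lra); rewrite hxy ltxx.
pose W y := exists t, p <= t <= q /\ G t y.
have dW : definable1 W.
  apply: (definable_exR HS (P := fun (e : unit -> R) t => p <= t <= q /\ G t (e tt))).
  apply: (definable_and HS).
    apply: (@definable_ext _ _ _ (fun e : unit + unit -> R => p <= e (inr tt) /\ e (inr tt) <= q)).
      by move=> e; split=> [[-> ->]|/andP[]].
    by apply: (definable_and HS); apply: (definable_le HS);
      by [exact: polyT_var|exact: polyT_cst].
  exact: (definable_reindex HS (fun u : unit + unit =>
    (match u with inl _ => inr tt | inr _ => inl tt end) : (unit + unit)%type) dG).
have Wh t : p <= t <= q -> W (h t) by move=> tpq; exists t; split=> //; apply/hG => //; lra.
have hW y : W y -> exists2 t, p <= t <= q & y = h t.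
  by move=> [t [tpq]]; exists t => //; apply/hG => //; lra.
have [finW|[c [d [cd cdW]]]] := definable_finite_or_itv dW.
  have /countable_injP[f fi] := finite_set_countable finW.
  exfalso; apply: (@itv_not_countable p q (f \o h) pq) => x y xpq ypq /= fxy.
  by apply: hinj => //; apply: fi => //; rewrite inE; exact: Wh.
have [t1 t1pq ct1] := hW c (cdW c ltac:(lra)).
have [t2 t2pq dt2] := hW d (cdW d ltac:(lra)).
have hmono x y : p <= x <= q -> p <= y <= q -> (h x <= h y) = (x <= y).
  move=> xpq ypq; have [->|xy] := eqVneq x y; first by rewrite !lexx.
  have [xy'|xy'] := leP x y.
    by rewrite ltW// hinc//; [lra|rewrite lt_def eq_sym xy|lra].
  by apply/negbTE; rewrite -ltNge; apply: hinc; lra.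
have t12 : t1 < t2 by rewrite ltNge -hmono// -ct1 -dt2 -ltNge.
have hc : {within `[t1, t2], continuous h}.
  apply: segment_inc_surj_continuous.
    by move=> x y; rewrite !in_itv/= => xt yt; apply: hmono; lra.
  move=> y /=; rewrite in_itv/= -ct1 -dt2 => ycd.
  have [t tpq yt] := hW y (cdW y ycd).
  by exists t => //=; rewrite in_itv/= -(hmono t1 t)// -(hmono t t2)// -ct1 -dt2 -yt.
(* continuity of h at p' and q' needs room on both sides *)
pose p' := (2 * t1 + t2) / 3; pose q' := (t1 + 2 * t2) / 3.
have p'q' : p' < q' by rewrite /p' /q'; lra.
have p'E : t1 < p' by rewrite /p'; lra.
have q'E : q' < t2 by rewrite /q'; lra.
exists p', q', (fun t => h (clamp p' q' t)); split; [lra|by []|lra|split].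
- move=> t; apply: (@continuous_comp _ _ _ (clamp p' q') h).
    exact: clamp_continuous.
  have : {within `]t1, t2[, continuous h}.
    by apply: continuous_subspaceW hc => x /=; rewrite !in_itv/=; lra.
  rewrite continuous_open_subspace; last exact: interval_open.
  apply; rewrite inE/= in_itv/=.
  by have := clamp_itv t (ltW p'q'); lra.
- left => x y xy; rewrite hmono; [exact: clamp_homo| |].
    by have := clamp_itv x (ltW p'q'); lra.
  by have := clamp_itv y (ltW p'q'); lra.
- by move=> t tpq; rewrite clamp_id.
Qed.

Lemma continuous_piece_cst h a b p q : a <= p -> p < q -> q <= b ->
  (forall t, p < t < q -> h t = h ((p + q) / 2)) -> continuous_piece h a b.
Proof.
move=> ap pq qb hcst.
exists ((2 * p + q) / 3), ((p + 2 * q) / 3), (fun=> h ((p + q) / 2)).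
split; [lra|lra|lra|split].
- exact: cst_continuous.
- by left.
- by move=> t tpq; apply: hcst; lra.
Qed.

(** The monotonicity theorem, for one subinterval.  On a subinterval the germs on
both sides have a constant type.  If one of them is equality, h is locally constant;
if they are opposite, h is strictly monotone; otherwise every point would be a strict
local extremum. *)
Theorem definable_monotone_continuous G h a b : a < b -> definable2 G -> graph_on G h a b ->
  continuous_piece h a b.
Proof.
move=> ab dG hG.
have triR t : a < t < b -> [\/ germ G 1 ltP_ t, germ G 1 eqP_ t | germ G 1 gtP_ t].
  by move=> /andP[/ltW at_ tb]; exact: germ_trichotomy_right hG at_ tb.
have triL t : a < t < b -> [\/ germ G (-1) ltP_ t, germ G (-1) eqP_ t | germ G (-1) gtP_ t].
  by move=> /andP[at_ /ltW tb]; exact: germ_trichotomy_left hG at_ tb.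
have [p0 [q0 [ap0 pq0 q0b HR]]] := germ_uniform dG ab triR.
have triL' t : p0 < t < q0 -> [\/ germ G (-1) ltP_ t, germ G (-1) eqP_ t | germ G (-1) gtP_ t].
  by move=> tpq; apply: triL; lra.
have [p [q [p0p pq qq0 HL]]] := germ_uniform dG pq0 triL'.
have sub t : p <= t <= q -> p0 <= t <= q0 by lra.
have ap : a < p by lra.
have qb : q < b by lra.
have hz t z : G t z -> a <= t <= b -> z = h t by move=> Gz tab; exact/hG.
have hN := graph_on_oppr hG; have dN := (definable_compose_opp dG).2.
have gN sg (r1 r2 : R -> R -> Prop) : (forall x y, r1 x y -> r2 (- x) (- y)) ->
    (forall t, p <= t <= q -> germ G sg r1 t) ->
    forall t, p <= t <= q -> germ (fun t y => G t (- y)) sg r2 t.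
  move=> r12 g t /g[d [d0 H]]; exists d; split=> // s s0 s1.
  have [y [y' [Gy [Gy' ry]]]] := H s s0 s1; exists (- y), (- y').
  by rewrite !opprK; split => //; split => //; exact: r12.
have ltgt x y : ltP_ x y -> gtP_ (- x) (- y) by rewrite /gtP_ ltrN2.
have gtlt x y : gtP_ x y -> ltP_ (- x) (- y) by rewrite /ltP_ ltrN2.
case: HR => HR'.
- have {HR'}HR t : p <= t <= q -> germ G 1 ltP_ t by move=> /sub; exact: HR'.
  case: HL => HL.
  + by exfalso; exact: (no_strict_local_min hG ap pq qb HR HL).
  + have [d [d0 H]] := HL q ltac:(lra).
    pose e := Num.min d (q - a).
    have e0 : 0 < e by rewrite lt_min d0; lra.
    have ed : e <= d by rewrite /e ge_min lexx.
    have eqa : e <= q - a by rewrite /e ge_min lexx orbT.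
    have hq t : q - e < t < q -> h t = h q.
      move=> tq; have [||z [z' [/hz zE [/hz z'E zz']]]] := H t; [lra|lra|].
      by rewrite -zE -?z'E//; lra.
    apply: (@continuous_piece_cst _ _ _ (q - e) q); [lra|lra|lra|].
    by move=> t tq; rewrite !hq//; lra.
  + apply: (continuous_piece_increasing dG hG ap pq qb).
    exact: (increasing_of_germs hG ap qb HR HL).
- have [d [d0 H]] := HR' p ltac:(lra).
  pose e := Num.min d (b - p).
  have e0 : 0 < e by rewrite lt_min d0; lra.
  have ed : e <= d by rewrite /e ge_min lexx.
  have eqa : e <= b - p by rewrite /e ge_min lexx orbT.
  have hq t : p < t < p + e -> h t = h p.
    move=> tq; have [||z [z' [/hz zE [/hz z'E zz']]]] := H t; [lra|lra|].
      by rewrite -zE -?z'E//; lra.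
  apply: (@continuous_piece_cst _ _ _ p (p + e)); [lra|lra|lra|].
  by move=> t tq; rewrite !hq//; lra.
- have {HR'}HR t : p <= t <= q -> germ G 1 gtP_ t by move=> /sub; exact: HR'.
  case: HL => HL.
  + apply: continuous_pieceN; apply: (continuous_piece_increasing dN hN ap pq qb).
    apply: (increasing_of_germs hN ap qb).
      exact: gN gtlt HR.
    exact: gN ltgt HL.
  + have [d [d0 H]] := HL q ltac:(lra).
    pose e := Num.min d (q - a).
    have e0 : 0 < e by rewrite lt_min d0; lra.
    have ed : e <= d by rewrite /e ge_min lexx.
    have eqa : e <= q - a by rewrite /e ge_min lexx orbT.
    have hq t : q - e < t < q -> h t = h q.
      move=> tq; have [||z [z' [/hz zE [/hz z'E zz']]]] := H t; [lra|lra|].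
      by rewrite -zE -?z'E//; lra.
    apply: (@continuous_piece_cst _ _ _ (q - e) q); [lra|lra|lra|].
    by move=> t tq; rewrite !hq//; lra.
  + exfalso; apply: (no_strict_local_min hN ap pq qb).
      exact: gN gtlt HR.
    exact: gN gtlt HL.
Qed.

End Monotone.

(** * Definable selection from compact fibers *)

Section Selection.
Variables (R : realType) (S : forall n : nat, set (set 'rV[R]_n)).
Hypothesis HS : o_minimal S.
Variable n : nat.
Local Notation definable := (definable S).

Definition definable_rel (A : 'rV[R]_n -> R -> Prop) :=
  definable (fun e : 'I_n + unit -> R => A (\row_l e (inl l)) (e (inr tt))).

(** The part of A over [p, q]; its compactness makes minima over fibers exist. *)
Definition slab (A : 'rV[R]_n -> R -> Prop) (p q : R) : set ('rV[R]_n * R) :=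
  [set u | A u.1 u.2 /\ p <= u.2 <= q].

Lemma row_env (z : 'rV[R]_n) : \row_l z 0 l = z.
Proof. by apply/rowP => l; rewrite mxE. Qed.

Lemma definable_exV (I : finType) (P : (I -> R) -> 'rV[R]_n -> Prop) :
  definable (fun h : I + 'I_n -> R => P (fun i => h (inl i)) (\row_l h (inr l))) ->
  definable (fun e => exists z : 'rV[R]_n, P e z).
Proof.
move=> /(@definable_ex _ _ HS I _ (fun e g => P e (\row_l g l))); apply: definable_ext => e.
split=> [[g]|[z Pz]]; first by exists (\row_l g l).
by exists (z 0); rewrite row_env.
Qed.

Lemma definable_allV (I : finType) (P : (I -> R) -> 'rV[R]_n -> Prop) :
  definable (fun h : I + 'I_n -> R => P (fun i => h (inl i)) (\row_l h (inr l))) ->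
  definable (fun e => forall z : 'rV[R]_n, P e z).
Proof.
move=> /(@definable_all _ _ HS I _ (fun e g => P e (\row_l g l))); apply: definable_ext => e.
split=> [h z|h g]; last exact: h.
by have := h (z 0); rewrite row_env.
Qed.

(** The least value of coordinate l on the fiber over t is a definable function of t,
continuous and monotone on a subinterval.  Keeping the minimizers only, the part
of the relation over this subinterval is still compact: it is cut out of A by a
continuous equation. *)
Lemma selection_step A p q (l : 'I_n) : p < q -> compact (slab A p q) -> definable_rel A ->
  (forall t, p <= t <= q -> exists z, A z t) ->
  exists B p' q' c, [/\ p <= p', p' < q', q' <= q &
    [/\ compact (slab B p' q'), definable_rel B,
      forall t, p' <= t <= q' -> exists z, B z t,
      forall z t, B z t -> A z t &
      [/\ continuous c, monotone_fun c &
          forall z t, p' <= t <= q' -> B z t -> z 0 l = c t]]].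
Proof.
move=> pq cA dA fib.
pose G t y := (exists z, A z t /\ z 0 l = y) /\ forall z, A z t -> y <= z 0 l.
have dA0 : definable (fun e : 'I_n + unit -> R => A (\row_j e (inl j)) (e (inr tt))) := dA.
pose I2 := (unit + unit + 'I_n)%type.
have dA2 (s : unit -> unit + unit) :
    definable (fun h : I2 -> R => A (\row_j h (inr j)) (h (inl (s tt)))).
  have := definable_reindex HS (fun u : 'I_n + unit =>
    match u with inl j => inr j | inr _ => inl (s tt) end : I2) dA0.
  exact.
have dG : definable (fun e : unit + unit -> R => G (e (inl tt)) (e (inr tt))).
  apply: (definable_and HS).
    apply: (@definable_exV _ (fun (e : unit + unit -> R) z => A z (e (inl tt)) /\ z 0 l = e (inr tt))).
    apply: (definable_and HS); first exact: (dA2 (fun=> inl tt)).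
    have := definable_eq HS (polyT_var R (inr l : I2)) (polyT_var R (inl (inr tt) : I2)).
    by apply: definable_ext => e; rewrite mxE.
  apply: (@definable_allV _ (fun (e : unit + unit -> R) z => A z (e (inl tt)) -> e (inr tt) <= z 0 l)).
  apply: (definable_imp HS); first exact: (dA2 (fun=> inl tt)).
  have := definable_le HS (polyT_var R (inl (inr tt) : I2)) (polyT_var R (inr l : I2)).
  by apply: definable_ext => e; rewrite mxE.
have Guniq t y y' : G t y -> G t y' -> y = y'.
  move=> [[z [Az <-]] h] [[z' [Az' <-]] h'].
  by apply/eqP; rewrite eq_le h// h'.
have Gex t : p <= t <= q -> exists y, G t y.
  move=> tpq; have [z Az] := fib t tpq.
  pose K := slab A p q `&` [set u | u.2 = t].
  have cK : compact K.
    apply: compact_closedI => //.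
    apply: (@closed_comp _ _ snd [set t]) => [u _|]; first exact: cvg_snd.
    exact: closed_eq.
  have K0 : K !=set0 by exists (z, t).
  have cf : {within K, continuous (fun u : 'rV[R]_n * R => u.1 0 l)}.
    apply: continuous_subspaceT => u.
    by apply: (@continuous_comp _ _ _ fst (fun z : 'rV[R]_n => z 0 l));
      [exact: cvg_fst|exact: continuous_coord].
  have [[z0 t0]] := compact_EVT_min K0 cK cf.
  rewrite inE => -[[/= Az0 _] /= t0E] hmin; rewrite {}t0E in Az0.
  exists (z0 0 l); split; first by exists z0.
  by move=> z' Az'; have := hmin (z', t); rewrite inE => /(_ (conj (conj Az' tpq) erefl)).
pose h t := if pselect (exists y, G t y) is left k then projT1 (cid k) else 0.
have hG : graph_on G h p q.
  move=> t tpq y; rewrite /h; case: pselect => [k|/(_ (Gex t tpq))//].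
  case: cid => y0 /= Gy0; split => [/Guniq|->//]; exact.
have [p' [q' [c [pp' pq' qq' [cc mc hc]]]]] := definable_monotone_continuous HS pq dG hG.
exists (fun z t => A z t /\ forall z', A z' t -> z 0 l <= z' 0 l), p', q', c.
have BE z t : p' <= t <= q' ->
    (A z t /\ forall z', A z' t -> z 0 l <= z' 0 l) <-> (A z t /\ z 0 l = c t).
  move=> tpq; rewrite -hc//; split=> -[Az].
    by move=> zmin; split => //; apply/hG; [lra|split => //; exists z].
  move=> zh; split => // z' Az'.
  have [_ hmin] : G t (h t) by apply/hG => //; lra.
  by rewrite zh hmin.
split => //; split => //.
- rewrite (_ : slab _ _ _ = slab A p q `&` [set u | p' <= u.2 <= q'] `&`
      [set u : 'rV[R]_n * R | u.1 0 l - c u.2 = 0]); last first.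
    apply/seteqP; split => -[z t] /=; rewrite /slab/=.
      move=> [Bz tpq]; have /BE[//|Az ->] := Bz; rewrite subrr.
      by do 2!split => //; split => //; lra.
    move=> [[[Az tpq] tpq'] /eqP]; rewrite subr_eq0 => /eqP zc; split => //.
    exact/BE.
  apply: compact_closedI; last first.
    apply: (@closed_comp _ _ (fun u : 'rV[R]_n * R => u.1 0 l - c u.2) [set 0]); last exact: closed_eq.
    move=> u _; apply: (@continuousB _ _ _ (fun u : 'rV[R]_n * R => u.1 0 l) (fun u => c u.2)).
      by apply: (@continuous_comp _ _ _ fst (fun z : 'rV[R]_n => z 0 l));
        [exact: cvg_fst|exact: continuous_coord].
    by apply: (@continuous_comp _ _ _ snd c); [exact: cvg_snd|exact: cc].
  apply: compact_closedI => //.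
  rewrite (_ : [set u | _] = snd @^-1` `[p', q']%classic); last first.
    by apply/seteqP; split => u /=; rewrite in_itv/=.
  apply: closed_comp => [u _|]; [exact: cvg_snd|exact: interval_closed].
- apply: (definable_and HS) => //.
  apply: (@definable_allV _ (fun (e : 'I_n + unit -> R) z' => A z' (e (inr tt)) ->
     (\row_l e (inl l)) 0 l <= z' 0 l)).
  apply: (definable_imp HS).
    exact: (definable_reindex HS (fun u : 'I_n + unit =>
      match u with inl j => inr j | inr _ => inl (inr tt) end : ('I_n + unit + 'I_n)%type) dA0).
  have := definable_le HS (polyT_var R (inl (inl l) : ('I_n + unit + 'I_n)%type))
    (polyT_var R (inr l : ('I_n + unit + 'I_n)%type)).
  by apply: definable_ext => e; rewrite !mxE.
- move=> t tpq; have [[z [Az zh]] hmin] : G t (h t) by apply/hG => //; lra.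
  by exists z; split => // z'; rewrite zh; exact: hmin.
- by move=> z t [].
- by split => // z t tpq /(BE _ _ tpq)[].
Qed.

(** After one step for each coordinate, every fiber has a single point, its
lexicographic minimum. *)
Lemma definable_selection A a b : a < b -> compact (slab A a b) -> definable_rel A ->
  (forall t, a <= t <= b -> exists z, A z t) ->
  exists p q (c : 'I_n -> R -> R), [/\ a <= p, p < q, q <= b &
   [/\ forall l, continuous (c l), forall l, monotone_fun (c l) &
       forall t, p <= t <= q -> A (\row_l c l t) t]].
Proof.
move=> ab cA dA fib.
suff H k : (k <= n)%N -> exists B p q (c : 'I_n -> R -> R), [/\ a <= p, p < q, q <= b &
   [/\ compact (slab B p q), definable_rel B, forall t, p <= t <= q -> exists z, B z t,
     forall z t, B z t -> A z t &
     forall l : 'I_n, [/\ continuous (c l), monotone_fun (c l) &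
       (l < k)%N -> forall z t, p <= t <= q -> B z t -> z 0 l = c l t]]].
  have [B [p [q [c [ap pq qb [_ _ Bex BA cP]]]]]] := H n (leqnn n).
  exists p, q, c; split => //; split => [l|l|t tpq]; [by case: (cP l)|by case: (cP l)|].
  have [z Bz] := Bex t tpq.
  rewrite (_ : \row_l c l t = z); first exact: BA.
  by apply/rowP => l; rewrite mxE; have [_ _ /(_ (ltn_ord l) _ _ tpq Bz)] := cP l.
elim: k => [|k IH] kn.
  exists A, a, b, (fun _ _ => 0); split => //; split => // l; split => //.
    exact: cst_continuous.
  by left.
have [B [p [q [c [ap pq qb [cB dB Bex BA cP]]]]]] := IH (ltnW kn).
have [B' [p' [q' [c' [pp' pq' qq' [cB' dB' Bex' BA' [cc' mc' cP']]]]]]] :=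
  selection_step (Ordinal kn) pq cB dB Bex.
exists B', p', q', (fun l => if l == Ordinal kn then c' else c l).
split => //; [lra|lra|split => //].
  by move=> z t /BA' /BA.
move=> l; case: eqVneq => [->|lk]; first by split.
have [c1 c2 c3] := cP l; split => // lk1 z t tpq /BA' Bz; apply: c3 => //; last lra.
by rewrite ltn_neqAle -ltnS lk1 andbT; apply: contraNneq lk => e; apply/eqP/val_inj.
Qed.

End Selection.

(** * Critical points of the regularized function *)

Section Sard.
Variables (R : realType) (S : forall n : nat, set (set 'rV[R]_n)).
Hypothesis HS : o_minimal S.
Variables (n N : nat) (f_ : 'I_N -> 'rV[R]_n -> R)
  (D_ : 'I_N -> 'rV[R]_n -> set 'rV[R]_n) (sigma M : R).
Hypothesis N0 : (0 < N)%N.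
Hypothesis sigma0 : 0 < sigma.
Hypothesis Hlip : forall i, locally_lipschitz (f_ i).
Hypothesis Hf_def : forall i, definable_fun S (f_ i).
Hypothesis HD_def : forall i, definable_map S (D_ i).
Hypothesis DM : forall i x d, D_ i x d -> `|d| <= M.
Hypothesis Dcons : forall i, admits_conservative_field (f_ i) (D_ i).
Variable cbelow : R.
Hypothesis Hbelow : forall x, cbelow <= mean_fun f_ x.
Local Notation definable := (definable S).
Local Notation H := (reg_suppf D_ sigma).
Local Notation g := (reg_fun sigma f_).

Lemma locally_lipschitz_continuous (f : 'rV[R]_n -> R) : locally_lipschitz f -> continuous f.
Proof.
move=> fl x; have [U Ux fU] := fl x.
have [L /= [L0 fL]] := pinfty_ex_gt0 fU.
move=> A /nbhs_ballP[e /= e0 eA].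
have e1 : 0 < L^-1 * e by rewrite mulr_gt0// invr_gt0.
have Bx : nbhs x (ball x (L^-1 * e)) by apply/nbhs_ballP; exists (L^-1 * e).
apply: (@filterS _ (nbhs x) (nbhs_filter x) (U `&` ball x (L^-1 * e))); last first.
  exact: (@filterI _ (nbhs x) (nbhs_filter x)).
move=> y [Uy]; rewrite mx_norm_ball /ball_/= => xy; apply: eA.
have := fL (x, y) (conj (nbhs_singleton Ux) Uy); rewrite /= => h.
by rewrite /ball/= (le_lt_trans h)// -ltr_pdivlMl.
Qed.

Lemma reg_fun_continuous : continuous g.
Proof.
have -> : g = (fun x => N%:R^-1 * \sum_(i < N) f_ i x + sigma / 2 * dotv x x).
  by apply/funext => x; rewrite /reg_fun enorm_sqr.
move=> x; apply: (@continuousD _ _ _ (fun x => N%:R^-1 * \sum_(i < N) f_ i x)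
  (fun x => sigma / 2 * dotv x x)).
  apply: (@continuousM _ _ (fun=> N%:R^-1) (fun x => \sum_(i < N) f_ i x)).
    exact: cst_continuous.
  by apply: (continuous_big_sum (F := f_)) => i; exact: locally_lipschitz_continuous.
apply: (@continuousM _ _ (fun=> sigma / 2) (fun x => dotv x x)).
  exact: cst_continuous.
exact: continuous_dotvv.
Qed.

(** f is bounded below and the quadratic term is not. *)
Lemma reg_fun_coercive (b : R) : exists B, forall x, g x <= b -> `|x| <= B.
Proof.
exists (Num.sqrt (2 / sigma * (b - cbelow))) => x.
rewrite /reg_fun enorm_sqr => gx.
have h : dotv x x <= 2 / sigma * (b - cbelow).
  rewrite -mulrA -ler_pdivrMl// -ler_pdivrMl ?invr_gt0// invrK.
  by have := Hbelow x; lra.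
rewrite (le_trans (norm_le_enorm x))// /enorm ler_wsqrtr//.
Qed.

Lemma reg_suppf_usc p z (c : R) : H p z < c -> \forall x \near z, H p x < c.
Proof.
move=> hc; pose e := (c - H p z) / 2.
have e0 : 0 < e by rewrite divr_gt0// subr_gt0.
have hi (i : 'I_N) : \forall x \near z, suppf (D_ i x) p < suppf (D_ i z) p + e.
  have [[Dcl D0 _ _] _] := Dcons i.
  by apply: (suppf_usc (M := M)) => //; [exact: (DM (i := i))|rewrite ltrDl].
have hl : \forall x \near z, sigma * dotv p x < sigma * dotv p z + e.
  have : {for z, continuous (fun x : 'rV[R]_n => sigma * dotv p x)}.
    apply: (@continuousM _ _ (fun=> sigma) (dotv p)); first exact: cst_continuous.
    exact: continuous_dotv.
  by move=> /cvgr_lt; apply; rewrite ltrDl.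
have hall : \forall x \near z, forall i, suppf (D_ i x) p < suppf (D_ i z) p + e.
  exact: (@filter_forall _ _ (fun i x => suppf (D_ i x) p < suppf (D_ i z) p + e) (nbhs z) (nbhs_filter z)).
near=> x; rewrite /reg_suppf.
have h1 : forall i, suppf (D_ i x) p < suppf (D_ i z) p + e by near: x.
have h2 : sigma * dotv p x < sigma * dotv p z + e by near: x.
have h3 : N%:R^-1 * (\sum_(i < N) suppf (D_ i x) p) <= N%:R^-1 * (\sum_(i < N) suppf (D_ i z) p) + e.
  have NR : (N%:R : R) != 0 by rewrite pnatr_eq0 -lt0n.
  have -> : e = N%:R^-1 * (\sum_(i < N) e).
    by rewrite sumr_const card_ord -[e *+ N]mulr_natl mulKf.
  rewrite -mulrDr ler_wpM2l ?invr_ge0// -big_split/=; apply: ler_sum => i _.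
  exact: ltW.
move: hc; rewrite /e /reg_suppf in h2 h3 *; lra.
Unshelve. all: by end_near. Qed.

Lemma suppf_attained i x p : exists2 d, D_ i x d & dotv p d = suppf (D_ i x) p.
Proof.
have [[Dcl D0 Dcp _] _] := Dcons i.
have [d] := compact_EVT_min (D0 x) (Dcp x) (continuous_subspaceT (@continuous_dotv _ _ (- p))).
rewrite inE => Dd dmin; exists d => //; apply/eqP; rewrite eq_le (suppf_ub (D0 x) (@DM i x))//=.
apply: (suppf_le (D0 x) (@DM i x)) => d' Dd'.
by have := dmin d'; rewrite inE => /(_ Dd'); rewrite !dotvNl lerN2.
Qed.

Lemma definable_D (I : finType) i (s t : 'I_n -> I) :
  definable (fun e => D_ i (\row_l e (s l)) (\row_l e (t l))).
Proof.
have := HD_def i.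
rewrite /definable_map => dD.
have dD' : dfn S (fun f : 'I_(n + n) -> R => D_ i (\row_l f (lshift n l)) (\row_l f (rshift n l))).
  apply: (dfnI (P := fun f : 'I_(n + n) -> R =>
    D_ i (\row_l f (lshift n l)) (\row_l f (rshift n l))) dD) => x /=.
  have -> : lsubmx x = \row_l x 0 (lshift n l) by apply/rowP => l; rewrite !mxE.
  by have -> : rsubmx x = \row_l x 0 (rshift n l) by apply/rowP => l; rewrite !mxE.
have := dfn_definable HS (glue s t) dD'; apply: definable_ext => e.
have -> : \row_l e (glue s t (lshift n l)) = \row_l e (s l).
  by apply/rowP => l; rewrite !mxE glue_l.
by have -> : \row_l e (glue s t (rshift n l)) = \row_l e (t l)
  by apply/rowP => l; rewrite !mxE glue_r.
Qed.

Lemma definable_f (I : finType) i (s : 'I_n -> I) (t : I) :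
  definable (fun e => e t = f_ i (\row_l e (s l))).
Proof.
have df : dfn S (fun f : 'I_(n + 1) -> R => f (rshift n ord0) = f_ i (\row_l f (lshift 1 l))).
  apply: (dfnI (P := fun f : 'I_(n + 1) -> R =>
    f (rshift n ord0) = f_ i (\row_l f (lshift 1 l))) (Hf_def i)) => x /=.
  have -> : lsubmx x = \row_l x 0 (lshift 1 l) by apply/rowP => l; rewrite !mxE.
  by rewrite !mxE.
have := dfn_definable HS (glue s (fun _ : 'I_1 => t)) df; apply: definable_ext => e.
rewrite glue_r; have -> : \row_l e (glue s (fun _ : 'I_1 => t) (lshift 1 l)) = \row_l e (s l).
  by apply/rowP => l; rewrite !mxE glue_l.
by [].
Qed.

Definition critical_at (z : 'rV[R]_n) (t : R) := g z = t /\ forall p, 0 <= H p z.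

(** The support functions are eliminated: H p z >= 0 iff some d_i in D_i z make the
mean of the <p, d_i>, plus sigma <p, z>, nonnegative, and this is a first-order condition. *)
Lemma definable_critical_at : definable_rel S critical_at.
Proof.
apply: (definable_and HS).
  apply: (@definable_ext _ _ _ (fun e : 'I_n + unit -> R => exists y : 'I_N -> R,
      (forall i, y i = f_ i (\row_l e (inl l))) /\
      N%:R^-1 * (\sum_i y i) + sigma / 2 * (\sum_l e (inl l) * e (inl l)) = e (inr tt))).
    move=> e; rewrite /reg_fun /mean_fun enorm_sqr.
    have E : dotv (\row_l e (inl l)) (\row_l e (inl l)) = \sum_l e (inl l) * e (inl l).
      by apply: eq_bigr => l _; rewrite !mxE.
    rewrite E; split=> [[y [yE]]|h]; first by under eq_bigr do rewrite yE.
    by exists (fun i => f_ i (\row_l e (inl l))).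
  apply: (definable_ex HS (P := fun (e : 'I_n + unit -> R) (y : 'I_N -> R) =>
      (forall i, y i = f_ i (\row_l e (inl l))) /\
      N%:R^-1 * (\sum_i y i) + sigma / 2 * (\sum_l e (inl l) * e (inl l)) = e (inr tt))).
  apply: (definable_and HS).
    apply: (definable_forall_fin HS) => i.
    exact: (definable_f i (fun l => inl (inl l) : ('I_n + unit + 'I_N)%type) (inr i)).
  apply: (definable_eq HS); last exact: polyT_var.
  apply: polyTD; apply: polyTM; try exact: polyT_cst.
    by apply: polyT_sum => i; exact: polyT_var.
  by apply: polyT_sum => i; apply: polyTM; exact: polyT_var.
apply: (@definable_allV _ _ HS n _ (fun (e : 'I_n + unit -> R) p => 0 <= H p (\row_l e (inl l)))).
pose I2 := ('I_n + unit + 'I_n)%type.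
apply: (@definable_ext _ _ _ (fun e : I2 -> R => exists d : 'I_N * 'I_n -> R,
   (forall i, D_ i (\row_l e (inl (inl l))) (\row_l d (i, l))) /\
   0 <= N%:R^-1 * (\sum_i \sum_l e (inr l) * d (i, l)) +
      sigma * (\sum_l e (inr l) * e (inl (inl l))))).
  move=> e; rewrite /reg_suppf.
  have E : dotv (\row_l e (inr l)) (\row_l e (inl (inl l))) = \sum_l e (inr l) * e (inl (inl l)).
    by apply: eq_bigr => l _; rewrite !mxE.
  rewrite E; split => [[d [Dd h]]|h].
    apply: (le_trans h); rewrite lerD2r ler_wpM2l ?invr_ge0//; apply: ler_sum => i _.
    have [[_ D0 _ _] _] := Dcons i.
    have := suppf_ub (D0 _) (@DM i _) (\row_l e (inr l)) (Dd i).
    by rewrite /dotv; under eq_bigr do rewrite !mxE.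
  pose d i := projT1 (cid2 (suppf_attained i (\row_l e (inl (inl l))) (\row_l e (inr l)))).
  have [dD dE] : (forall i, D_ i (\row_l e (inl (inl l))) (d i)) /\
     forall i, dotv (\row_l e (inr l)) (d i) = suppf (D_ i (\row_l e (inl (inl l)))) (\row_l e (inr l)).
    by split => i; rewrite /d; case: cid2.
  exists (fun il => d il.1 0 il.2); split => [i|].
    by rewrite [X in D_ i _ X](_ : _ = d i)//; apply/rowP => l; rewrite mxE.
  rewrite (le_trans h)// lerD2r ler_wpM2l ?invr_ge0//; apply: ler_sum => i _.
  by rewrite -dE /dotv; under eq_bigr do rewrite !mxE.
apply: (definable_ex HS (P := fun (e : I2 -> R) (d : 'I_N * 'I_n -> R) =>
   (forall i, D_ i (\row_l e (inl (inl l))) (\row_l d (i, l))) /\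
   0 <= N%:R^-1 * (\sum_i \sum_l e (inr l) * d (i, l)) +
      sigma * (\sum_l e (inr l) * e (inl (inl l))))).
apply: (definable_and HS).
  apply: (definable_forall_fin HS) => i.
  exact: (definable_D i (fun l => inl (inl (inl l)) : (I2 + 'I_N * 'I_n)%type) (fun l => inr (i, l))).
apply: (definable_le HS); first exact: polyT_cst.
apply: polyTD; apply: polyTM; try exact: polyT_cst.
  by do 2!(apply: polyT_sum => ?); apply: polyTM; exact: polyT_var.
by apply: polyT_sum => ?; apply: polyTM; exact: polyT_var.
Qed.

(** Closed because H p is upper semicontinuous, bounded because g is coercive. *)
Lemma compact_slab_critical a b : compact (slab critical_at a b).
Proof.
have [B gB] := reg_fun_coercive b.
have cK : compact ([set x : 'rV[R]_n | `|x| <= B] `*` `[a, b]%classic).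
  by apply: compact_setX; [exact: bounded_closed_ball|exact: segment_compact].
apply: subclosed_compact cK _; last first.
  move=> [z t] [/= [gz _] tab]; split => /=; last by rewrite in_itv/=.
  by apply: gB; rewrite gz; case/andP: tab.
rewrite (_ : slab _ _ _ = [set u : 'rV[R]_n * R | g u.1 - u.2 = 0] `&`
   (snd @^-1` `[a, b]%classic) `&` \bigcap_p (fst @^-1` [set z | 0 <= H p z])); last first.
  apply/seteqP; split => -[z t] /=; rewrite /slab/= in_itv/=.
    move=> [[<- zp] tab]; split => //; last by move=> p _; exact: zp.
    by rewrite subrr.
  move=> [[/eqP]]; rewrite subr_eq0 => /eqP gz tab zp; split => //; split => // p.
  exact: zp.
apply: closedI; first apply: closedI.
- apply: (@closed_comp _ _ (fun u : 'rV[R]_n * R => g u.1 - u.2) [set 0]); last exact: closed_eq.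
  move=> u _; apply: (@continuousB _ _ _ (fun u : 'rV[R]_n * R => g u.1) snd); last exact: cvg_snd.
  by apply: (@continuous_comp _ _ _ fst g); [exact: cvg_fst|exact: reg_fun_continuous].
- by apply: closed_comp => [u _|]; [exact: cvg_snd|exact: interval_closed].
apply: closed_bigI => p _; apply: closed_comp => [u _|]; first exact: cvg_fst.
rewrite -[X in closed X]setCK; apply: open_closedC; rewrite openE => z /= /negP.
rewrite -ltNge => /reg_suppf_usc; apply: filterS => x /= Hx; apply/negP; rewrite -ltNge//.
Qed.

End Sard.

(** * Critical values have empty interior *)

Section Arc.
Variables (R : realType) (n : nat) (c : 'I_n -> R -> R) (p q : R).
Hypothesis pq : p < q.
Hypothesis cc : forall l, continuous (c l).
Hypothesis cm : forall l, monotone_fun (c l).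

(** Clock time plus the total variation of the coordinates: all coordinates are
Lipschitz functions of it, and it is strictly increasing. *)
Definition arc t := t + \sum_(l < n) `|c l t - c l p|.

Lemma arcD x y : p <= x -> x <= y ->
  arc y - arc x = (y - x) + \sum_(l < n) `|c l y - c l x|.
Proof.
move=> px xy; rewrite /arc opprD addrACA; congr (_ + _).
rewrite -sumrB; apply: eq_bigr => l _.
have [cl|cl] := cm l; have h1 := cl _ _ px; have h2 := cl _ _ xy.
  by rewrite !ger0_norm ?subr_ge0//; [ring|exact: le_trans h1 h2].
by rewrite !ler0_norm ?subr_le0//; [ring|exact: le_trans h2 h1].
Qed.

Lemma coord_le_arc l x y : p <= x -> p <= y -> `|c l x - c l y| <= `|arc x - arc y|.
Proof.
suff Hw x' y' : p <= x' -> x' <= y' -> `|c l x' - c l y'| <= `|arc x' - arc y'|.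
  move=> px py; have [xy|/ltW yx] := leP x y; first exact: Hw.
  by rewrite distrC (distrC (arc _)); exact: Hw.
move=> px xy; rewrite distrC (distrC (arc _)) (le_trans _ (ler_norm _))// arcD//.
by rewrite (bigD1 l)//= addrCA lerDl addr_ge0 ?subr_ge0// sumr_ge0.
Qed.

Lemma arc_continuous : continuous arc.
Proof.
move=> t; apply: (@continuousD _ _ _ id (fun t => \sum_(l < n) `|c l t - c l p|)).
  by move=> ?; exact.
apply: (continuous_big_sum (F := fun l t => `|c l t - c l p|)) => l s.
apply: (@continuous_comp _ _ _ (fun s => c l s - c l p) Num.norm); last exact: norm_continuous.
by apply: (@continuousB _ _ _ (c l) (fun=> c l p)); [exact: cc|exact: cst_continuous].
Qed.

Lemma arc_lt : arc p < arc q.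
Proof.
rewrite -subr_gt0 arcD//; last exact: ltW.
by rewrite ltr_pwDl ?subr_gt0// sumr_ge0.
Qed.

Lemma arc_inj x y : p <= x -> p <= y -> arc x = arc y -> x = y.
Proof.
suff Hw x' y' : p <= x' -> x' <= y' -> arc x' = arc y' -> x' = y'.
  move=> px py; have [xy|/ltW yx] := leP x y; first exact: Hw.
  by move=> /esym e; apply/esym; exact: Hw.
move=> px xy e; apply/eqP; rewrite eq_le xy -subr_le0.
have := arcD px xy; rewrite e subrr => h.
have : 0 <= \sum_(l < n) `|c l y' - c l x'| by rewrite sumr_ge0.
by move: h; lra.
Qed.

(** A continuous curve with monotone coordinates is Lipschitz in the parameter [arc].
It is run backwards, from q to p, as the Sard argument requires. *)
Lemma arc_length_curve : exists gamma : R -> 'rV[R]_n, exists L B, [/\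
  forall s t, `|gamma s - gamma t| <= L * `|s - t|,
  forall t, `|gamma t| <= B,
  gamma 0 = \row_l c l q, gamma 1 = \row_l c l p &
  forall v, exists2 t, p <= t <= q & gamma v = \row_l c l t].
Proof.
have Larc := arc_lt; set L := arc q - arc p.
have L0 : 0 < L by rewrite subr_gt0.
have ivt u : arc p <= u <= arc q -> exists t, p <= t <= q /\ arc t = u.
  move=> upq; have [||t tpq tu] := @IVT R arc p q u (ltW pq).
  - exact: continuous_subspaceT arc_continuous.
  - by rewrite min_l ?max_r// ltW.
  - by exists t; move: tpq; rewrite in_itv.
pose u v := arc q - L * clamp 0 1 v.
have uP v : arc p <= u v <= arc q.
  have /andP[h1 h2] := clamp_itv v (@ler01 R).
  rewrite /u; apply/andP; split.
    have : L * clamp 0 1 v <= L * 1 by rewrite ler_pM2l.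
    by rewrite /L; lra.
  by rewrite gerBl mulr_ge0// ltW.
pose th v := projT1 (cid (ivt _ (uP v))).
have [thpq thE] : (forall v, p <= th v <= q) /\ forall v, arc (th v) = u v.
  by split=> v; rewrite /th; case: cid => ? [].
have pth v : p <= th v by case/andP: (thpq v).
pose gamma v : 'rV[R]_n := \row_l c l (th v).
have gL s t : `|gamma s - gamma t| <= `|u s - u t|.
  by apply: norm_le_coord => // l; rewrite !mxE -!thE coord_le_arc.
exists gamma, L, (`|gamma 0| + L); split.
- move=> s t; rewrite (le_trans (gL s t))//.
  have -> : u s - u t = - (L * (clamp 0 1 s - clamp 0 1 t)) by rewrite /u; ring.
  by rewrite normrN normrM gtr0_norm// ler_pM2l// clamp_lip.
- move=> t; rewrite -[gamma t](subrK (gamma 0)) addrC (le_trans (ler_normD _ _))// lerD2l.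
  rewrite (le_trans (gL t 0))// ler_norml; have := uP t; have := uP 0; rewrite /L; lra.
- apply/rowP => l; rewrite !mxE; congr (c l _); apply: arc_inj => //; first exact: ltW.
  by rewrite thE /u clamp_id ?lexx ?ler01// mulr0 subr0.
- apply/rowP => l; rewrite !mxE; congr (c l _); apply: arc_inj => //.
  by rewrite thE /u clamp_id ?lexx ?ler01// mulr1 /L; ring.
- by move=> v; exists (th v).
Qed.

End Arc.

Section SardTheorem.
Variables (R : realType) (S : forall n : nat, set (set 'rV[R]_n)).
Hypothesis HS : o_minimal S.
Variables (n N : nat) (f_ : 'I_N -> 'rV[R]_n -> R)
  (D_ : 'I_N -> 'rV[R]_n -> set 'rV[R]_n) (sigma M : R).
Hypothesis N0 : (0 < N)%N.
Hypothesis sigma0 : 0 < sigma.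
Hypothesis Hlip : forall i, locally_lipschitz (f_ i).
Hypothesis Hf_def : forall i, definable_fun S (f_ i).
Hypothesis HD_def : forall i, definable_map S (D_ i).
Hypothesis DM : forall i x d, D_ i x d -> `|d| <= M.
Hypothesis Dcons : forall i, admits_conservative_field (f_ i) (D_ i).
Variable cbelow : R.
Hypothesis Hbelow : forall x, cbelow <= mean_fun f_ x.
Local Notation H := (reg_suppf D_ sigma).
Local Notation g := (reg_fun sigma f_).

(** Otherwise a Lipschitz curve of critical points exists along which the value runs
from q down to p < q, although the support function is nonnegative along it. *)
Theorem critical_values_codense a b : a < b ->
  exists2 t, a < t < b & forall z, g z = t -> exists p, H p z < 0.
Proof.
move=> ab; apply: contrapT => no.
have fib t : a < t < b -> exists z, critical_at f_ D_ sigma z t.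
  move=> tab; apply: contrapT => noz; apply: no; exists t => // z gz.
  apply: contrapT => nop; apply: noz; exists z; split=> // p.
  by rewrite leNgt; apply/negP => Hp; apply: nop; exists p.
(* fibers are known to be nonempty over the open interval only *)
pose a' := (2 * a + b) / 3; pose b' := (a + 2 * b) / 3.
have a'b' : a' < b' by rewrite /a' /b'; lra.
have cS : compact (slab (critical_at f_ D_ sigma) a' b').
  exact: (compact_slab_critical N0 sigma0 Hlip DM Dcons Hbelow).
have [p [q [c [a'p pq qb' [cc cm cA]]]]] := definable_selection HS a'b'
  cS
  (definable_critical_at HS sigma Hf_def HD_def DM Dcons)
  (fun t tab => fib t ltac:(move: tab; rewrite /a' /b'; lra)).
have [gamma [L [B [gL gB g0 g1 gE]]]] := arc_length_curve pq cc cm.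
have := reg_fun_curve (sigma := sigma) DM Dcons (delta := 0) gL gB.
rewrite g0 g1.
have [-> _] := cA p ltac:(lra); have [-> _] := cA q ltac:(lra).
rewrite addr0 => h; suff : q <= p by rewrite leNgt pq.
apply: h => v _ _; have [t tpq ->] := gE v.
by have [_ ->] := cA t tpq.
Qed.

End SardTheorem.

(** * Stochastic approximation: the deterministic argument *)

(** With an ultrafilter, limits exist for all times at once; this replaces the
extraction of subsequences. *)
Lemma ultra_compact_cvg (T : topologicalType) (I : Type) (U : set_system I)
    (f : I -> T) (K : set T) :
  UltraFilter U -> compact K -> (forall i, K (f i)) -> exists z : T, f i @[i --> U] --> z.
Proof.
move=> UU cK fK.
have [z [_ zc]] : K `&` cluster (f @ U) !=set0.
  by apply: cK; apply: (@filterS _ U _ setT) => [i _|]; [exact: fK|exact: filterT].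
exists z => A zA; rewrite /= nbhs_filterE.
have [//|UC] := in_ultra_setVsetC (f @^-1` A) UU.
have [x [/= + Ax]] := zc (~` A) A UC zA; by [].
Qed.

Lemma derive1_coord (R : realType) (n : nat) (f : R -> 'rV[R]_n) t l :
  derivable f t 1 -> derive1 f t 0 l = derive1 (fun t => f t 0 l) t.
Proof.
move=> df; have := derive_mx df => /(congr1 (fun u : 'rV[R]_n => u 0 l)).
by rewrite mxE -!derive1E.
Qed.

(** Here al is the step, tau the clock, and H p the support function at p of a set-valued
map F.  [drift] is the discrete form of the inclusion y' in - F(y): near a point where
H p < c, the scalar product with - p grows at most at rate c.  [curve] is the chain
rule for g, and [codense] is the density of noncritical values. *)
Section StochasticApproximation.
Variables (R : realType) (n : nat).
Variables (al : nat -> R) (y : nat -> 'rV[R]_n) (B L : R).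
Variables (H : 'rV[R]_n -> 'rV[R]_n -> R) (g : 'rV[R]_n -> R).
Hypothesis al0 : forall k, 0 < al k.
Hypothesis al_cvg : al @ \oo --> (0 : R).
Definition tau k : R := \sum_(0 <= j < k) al j.
Hypothesis tau_cvg : tau @ \oo --> +oo.
Hypothesis yB : forall k, `|y k| <= B.
Hypothesis L0 : 0 <= L.
Hypothesis yL : forall i j, (i <= j)%N -> `|y j - y i| <= L * (tau j - tau i).
Hypothesis H_usc : forall p z c, H p z < c -> \forall x \near z, H p x < c.
Hypothesis HZ : forall a q x, 0 <= a -> H (a *: q) x = a * H q x.
Hypothesis g_cont : continuous g.
Hypothesis drift : forall p z c, H p z < c -> exists2 d, 0 < d &
  forall e T, 0 < e -> \forall i \near \oo, forall j, (i <= j)%N -> tau j - tau i <= T ->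
    (forall k, (i <= k < j)%N -> `|y k - z| < d) ->
    - dotv p (y j - y i) <= c * (tau j - tau i) + e.
Hypothesis curve : forall (gamma : R -> 'rV[R]_n) (L B delta : R),
  (forall s t, `|gamma s - gamma t| <= L * `|s - t|) -> (forall t, `|gamma t| <= B) ->
  (forall t, t \in `]0, 1[ -> derivable gamma t 1 ->
     delta <= H (derive1 gamma t) (gamma t)) ->
  g (gamma 0) + delta <= g (gamma 1).
Hypothesis codense : forall a b, a < b ->
  exists2 t, a < t < b & forall z, g z = t -> exists p, H p z < 0.

Lemma tauS k : tau k.+1 = tau k + al k.
Proof. by rewrite /tau big_nat_recr. Qed.

Lemma tau_homo i j : (i <= j)%N -> tau i <= tau j.
Proof.
move=> /subnK <-; elim: (j - i)%N => // k IH.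
by rewrite addSn tauS (le_trans IH)// lerDl ltW.
Qed.

Lemma hit_ex i t : exists m, (i <= m)%N && (tau i + t <= tau m).
Proof.
have /cvgryPge/(_ (tau i + t)) h := tau_cvg.
near \oo => m; exists m; apply/andP; split; near: m => //.
by exists i.
Unshelve. all: by end_near. Qed.

(** The first index, from i on, at which the clock has advanced by t. *)
Definition hit i t := ex_minn (hit_ex i t).

Lemma hitP i t : [/\ (i <= hit i t)%N, tau i + t <= tau (hit i t) &
  forall m, (i <= m)%N -> tau i + t <= tau m -> (hit i t <= m)%N].
Proof.
rewrite /hit; case: ex_minnP => m /andP[im tm] mmin; split => // k ik tk.
by apply: mmin; rewrite ik.
Qed.

Lemma hit_ge i t : (i <= hit i t)%N. Proof. by case: (hitP i t). Qed.

Lemma hit0 i : hit i 0 = i.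
Proof.
apply/eqP; rewrite eqn_leq hit_ge andbT.
by have [_ _ ->] := hitP i 0; rewrite ?addr0.
Qed.

Lemma hit_homo i s t : s <= t -> (hit i s <= hit i t)%N.
Proof.
move=> st; have [_ _ h] := hitP i s; have [h1 h2 _] := hitP i t.
by apply: h => //; rewrite (le_trans _ h2)// lerD2l.
Qed.

Lemma hit_neg i t : t <= 0 -> hit i t = i.
Proof.
move=> t0; apply/eqP; rewrite eqn_leq hit_ge andbT.
by have [_ _ ->] := hitP i t => //; rewrite gerDl.
Qed.

Lemma tau_hit_lt i t m : (i <= m)%N -> (m < hit i t)%N -> tau m < tau i + t.
Proof.
by move=> im; have [_ _ h] := hitP i t; rewrite ltnNge ltNge; apply: contra; exact: h.
Qed.

Lemma tau_hit e : 0 < e -> \forall i \near \oo, forall t, 0 <= t ->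
  t <= tau (hit i t) - tau i <= t + e.
Proof.
move=> e0; have /cvgrPdist_lt/(_ e e0)[K _ KP] := al_cvg.
exists K => // i /= Ki t t0; have [ii it imin] := hitP i t.
rewrite lerBrDl it/= lerBlDl.
move: ii; rewrite leq_eqVlt => /orP[/eqP <-|ii].
  by rewrite lerDl addr_ge0// ltW.
case: (hit i t) ii it (@tau_hit_lt i t) => // k ik it /(_ k ik (ltnSn _)) kt.
rewrite tauS addrA lerD//; first exact: ltW.
have := KP k (leq_trans Ki ik); rewrite /= sub0r normrN gtr0_norm//.
exact: ltW.
Qed.

Section Limit.
Variables (U : set_system nat) (phi : nat -> nat).
Hypothesis UU : UltraFilter U.
Hypothesis Uoo : \oo `<=` U.
Hypothesis phi_ge : forall j, (j <= phi j)%N.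

Lemma U_near (P : nat -> Prop) : (\forall i \near \oo, P i) -> \forall j \near U, P (phi j).
Proof. by move=> [K _ KP]; apply: Uoo; exists K => // j /= Kj; apply: KP => /=; exact: leq_trans Kj _. Qed.

Lemma limit_exists t : exists z : 'rV[R]_n, y (hit (phi j) t) @[j --> U] --> z.
Proof. by apply: (ultra_compact_cvg _ (@bounded_closed_ball R n B)) => // j; exact: yB. Qed.

(** The limit curve of the paths started at the indices phi j. *)
Definition Y t := projT1 (cid (limit_exists t)).

Lemma Y_cvg t : y (hit (phi j) t) @[j --> U] --> Y t.
Proof. by rewrite /Y; case: cid. Qed.

Lemma Y_bounded t : `|Y t| <= B.
Proof.
apply: (cvgr_to_le (F := U) (f := fun j => `|y (hit (phi j) t)|)).
  exact: cvg_norm (@Y_cvg t).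
by apply: (@filterS _ U _ setT) => [j _|]; [exact: yB|exact: filterT].
Qed.

Lemma y_hit_dist e : 0 < e -> \forall j \near U, forall s t, 0 <= s <= t ->
  forall k, (hit (phi j) s <= k <= hit (phi j) t)%N ->
  `|y k - y (hit (phi j) s)| <= L * (t - s + e).
Proof.
move=> e0; have := U_near (tau_hit e0); apply: filterS => j jP s t /andP[s0 st] k /andP[sk kt].
rewrite (le_trans (yL sk))// ler_wpM2l//.
have := jP s s0; have := jP t (le_trans s0 st); have := tau_homo kt; lra.
Qed.

Lemma Y_lipschitz s t : `|Y s - Y t| <= L * `|s - t|.
Proof.
suff Hw s' t' : s' <= t' -> `|Y s' - Y t'| <= L * `|s' - t'|.
  by have [/Hw//|/ltW/Hw] := leP s t; rewrite distrC (distrC t).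
move=> {s t}; set s := s'; set t := t' => st.
have YD : `|y (hit (phi j) s) - y (hit (phi j) t)| @[j --> U] --> `|Y s - Y t|.
  by apply: cvg_norm; apply: cvgB; exact: Y_cvg.
apply/ler_addgt0Pr => e e0; apply: (cvgr_to_le YD).
have e1 : 0 < e / (L + 1) by rewrite divr_gt0// ltr_wpDl.
have := y_hit_dist e1; apply: filterS => j jP.
have eL : L * (e / (L + 1)) <= e.
  by rewrite mulrCA ger_pMr// ler_pdivrMr ?ltr_wpDl// mul1r lerDl.
rewrite distrC ler0_norm ?subr_le0// opprB.
have [s0|s0] := leP 0 s.
  have i1 : (hit (phi j) s <= hit (phi j) t <= hit (phi j) t)%N by rewrite hit_homo ?leqnn.
  rewrite (le_trans (jP s t ltac:(lra) _ i1))//.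
  by rewrite mulrDr lerD2l.
have -> : hit (phi j) s = hit (phi j) 0 by rewrite hit0 hit_neg// ltW.
have [t0|t0] := leP 0 t.
  have i1 : (hit (phi j) 0 <= hit (phi j) t <= hit (phi j) t)%N by rewrite hit_homo ?leqnn.
  rewrite (le_trans (jP 0 t ltac:(lra) _ i1))//.
  rewrite mulrDr lerD// ler_wpM2l//; lra.
have -> : hit (phi j) t = hit (phi j) 0 by rewrite hit0 hit_neg// ltW.
rewrite subrr normr0.
by rewrite addr_ge0 ?mulr_ge0 ?subr_ge0// ltW.
Qed.

(** For small h the path stays in the ball where [drift] applies, by the Lipschitz
bound, during the whole window from s to s + h. *)
Lemma Y_forward p s c : 0 <= s -> H p (Y s) < c -> exists2 h0, 0 < h0 &
  forall h, 0 < h < h0 -> - dotv p (Y (s + h) - Y s) <= c * h.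
Proof.
move=> s0 Hc; have [d d0 dP] := drift Hc.
have L1 : 0 < L + 1 by rewrite ltr_wpDl.
pose h0 := d / (4 * (L + 1)).
have h00 : 0 < h0 by rewrite divr_gt0// mulr_gt0.
exists h0 => // h /andP[hh hh0].
have YD : - dotv p (y (hit (phi j) (s + h)) - y (hit (phi j) s)) @[j --> U]
    --> - dotv p (Y (s + h) - Y s).
  apply: cvgN; apply: (@continuous_cvg _ _ _ U _
    (fun j => y (hit (phi j) (s + h)) - y (hit (phi j) s)) (dotv p)); first exact: continuous_dotv.
  by apply: cvgB; exact: Y_cvg.
apply/ler_addgt0Pr => e e0; apply: (cvgr_to_le YD).
pose e' := Num.min h0 (Num.min (h / 2) (e / (2 * (`|c| + 1)))).
have e'0 : 0 < e'.
  by rewrite !lt_min h00 !divr_gt0// mulr_gt0// ltr_wpDl.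
have e'1 : e' <= h0 by rewrite /e' ge_min lexx.
have e'2 : e' <= e / (2 * (`|c| + 1)) by rewrite /e' !ge_min lexx !orbT.
have e'3 : e' <= h / 2 by rewrite /e' !ge_min lexx !orbT.
have h0E : L * (h + e') < d / 2.
  have : L * (h + e') <= L * (2 * h0) by rewrite ler_wpM2l//; lra.
  move=> /le_lt_trans; apply.
  have -> : L * (2 * h0) = (L / (L + 1)) * (d / 2) by rewrite /h0; field; rewrite gt_eqF.
  by rewrite gtr_pMl ?divr_gt0// ltr_pdivrMr// mul1r ltrDl.
have Yn : \forall j \near U, `|Y s - y (hit (phi j) s)| < d / 2.
  by have /cvgrPdist_lt/(_ (d / 2)) := @Y_cvg s; apply; rewrite divr_gt0.
have e2 : 0 < e / 2 by rewrite divr_gt0.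
have dn : \forall j \near U, forall i, (phi j <= i)%N ->
    forall k, (i <= k)%N -> tau k - tau i <= 2 * h ->
    (forall l, (i <= l < k)%N -> `|y l - Y s| < d) ->
    - dotv p (y k - y i) <= c * (tau k - tau i) + e / 2.
  have [K _ KP] := dP (e / 2) (2 * h) e2.
  apply: Uoo; exists K => // j /= Kj i ji; apply: KP => /=.
  exact: leq_trans Kj (leq_trans (phi_ge j) ji).
near=> j.
have D1 : forall s t, 0 <= s <= t ->
  forall k, (hit (phi j) s <= k <= hit (phi j) t)%N ->
  `|y k - y (hit (phi j) s)| <= L * (t - s + e').
  by near: j; exact: y_hit_dist.
have D2 : `|Y s - y (hit (phi j) s)| < d / 2 by near: j.
have D3 : forall t, 0 <= t -> t <= tau (hit (phi j) t) - tau (phi j) <= t + e'.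
  by near: j; exact: U_near (tau_hit e'0).
have D4 : forall i, (phi j <= i)%N ->
    forall k, (i <= k)%N -> tau k - tau i <= 2 * h ->
    (forall l, (i <= l < k)%N -> `|y l - Y s| < d) ->
    - dotv p (y k - y i) <= c * (tau k - tau i) + e / 2.
  by near: j.
have t1 := D3 s s0; have t2 := D3 (s + h) ltac:(lra).
have st : s <= s + h by lra.
rewrite (le_trans (D4 (hit (phi j) s) (hit_ge _ _) (hit (phi j) (s + h)) (hit_homo _ st) _ _))//.
- by move: t1 t2; lra.
- move=> l /andP[l1 l2].
  rewrite -(subrKA (y (hit (phi j) s))) (le_lt_trans (ler_normD _ _))//.
  have := D1 s (s + h) ltac:(lra) l ltac:(by rewrite l1 ltnW).
  by rewrite distrC in D2; rewrite (addrC s) addrK; lra.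
set a := tau _ - tau _.
have ah : `|a - h| <= e' by rewrite ler_norml /a; move: t1 t2; lra.
have : c * a <= c * h + e / 2.
  rewrite -lerBlDl -mulrBr (le_trans (ler_norm _))// normrM.
  rewrite (@le_trans _ _ (`|c| * e'))//; first exact: ler_wpM2l.
  rewrite (@le_trans _ _ ((`|c| + 1) * e'))//; first by rewrite ler_wpM2r ?lerDl// ltW.
  by rewrite -ler_pdivlMl ?ltr_wpDl// (le_trans e'2)// invfM mulrA mulrC mulrA lexx.
by move=> ?; lra.
Unshelve. all: by end_near. Qed.

Lemma Y_derivative p s : 0 <= s -> derivable Y s 1 ->
  - dotv p (derive1 Y s) <= H p (Y s).
Proof.
move=> s0 dY; apply/ler_addgt0Pr => e e0.
have Hc : H p (Y s) < H p (Y s) + e by rewrite ltrDl.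
have [h0 h00 hP] := Y_forward s0 Hc.
have dc : h^-1 *: (Y (h + s) - Y s) @[h --> 0^'+] --> derive1 Y s.
  apply: cvg_dnbhs_at_right; rewrite derive1E; move: dY; rewrite /derivable /derive.
  under eq_fun do rewrite /= [_%:A]mulr1.
  by [].
have dd : - dotv p (h^-1 *: (Y (h + s) - Y s)) @[h --> 0^'+] --> - dotv p (derive1 Y s).
  apply: cvgN; apply: (@continuous_cvg _ _ _ 0^'+ _
    (fun h : R => h^-1 *: (Y (h + s) - Y s)) (dotv p)); last exact: dc.
  exact: continuous_dotv.
apply: (cvgr_to_le dd); near=> h.
have hh : 0 < h by near: h; exact: nbhs_right_gt.
have hh0 : h < h0 by near: h; exact: nbhs_right_lt.
rewrite dotvZr -mulrN mulrC ler_pdivrMr// addrC.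
by rewrite addrC (addrC h) hP// hh.
Unshelve. all: by end_near. Qed.

Lemma Y_reversed_derivative (T t : R) : 0 < T -> t \in `]0, 1[ ->
  derivable (fun t : R => Y (T * (1 - t))) t 1 ->
  derivable Y (T * (1 - t)) 1 /\
  derive1 (fun t : R => Y (T * (1 - t))) t = - T *: derive1 Y (T * (1 - t)).
Proof.
move=> T0 t01 dg; set gamma := (fun t : R => Y (T * (1 - t))) in dg *.
have Tn : T != 0 by rewrite gt_eqF.
have dl l : derivable (fun t => gamma t 0 l) t 1 by have /derivable_mxP := dg; apply.
have aff : is_derive t 1 (fun t : R => T * (1 - t)) (- T).
  rewrite (_ : (fun t : R => _) = T \*: (cst 1 - id)); last by apply/funext.
  apply: is_derive_eq; rewrite sub0r /GRing.scale/=; ring.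
have inv : is_derive (T * (1 - t)) 1 (fun s : R => 1 - s / T) (- T^-1).
  rewrite (_ : (fun s : R => _) = cst 1 - T^-1 \*: id); last first.
    by apply/funext => s /=; rewrite mulrC.
  by apply: is_derive_eq; rewrite sub0r /GRing.scale/= mulr1.
have invE : 1 - T * (1 - t) / T = t by rewrite mulrC mulKf// subKr.
have YE l : (fun s => Y s 0 l) = (fun t => gamma t 0 l) \o (fun s => 1 - s / T).
  apply/funext => s /=; rewrite /gamma; congr (Y _ 0 l).
  by rewrite subKr mulrC divfK.
have dYl l : derivable (fun s => Y s 0 l) (T * (1 - t)) 1.
  rewrite YE; apply/derivable1_diffP; apply: differentiable_comp.
    by apply/derivable1_diffP.
  by apply/derivable1_diffP; rewrite invE.
have dY : derivable Y (T * (1 - t)) 1 by apply/derivable_mxP => i l; rewrite (ord1 i).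
split => //; apply/rowP => l.
have E1 := derive1_coord l dg.
have E2 := derive1_coord l dY.
have E3 : derive1 (fun t => gamma t 0 l) t =
    derive1 (fun s => Y s 0 l) (T * (1 - t)) * derive1 (fun t : R => T * (1 - t)) t.
  by apply: (@derive1_comp R (fun t : R => T * (1 - t)) (fun s => Y s 0 l)).
have E4 : derive1 (fun t : R => T * (1 - t)) t = - T by rewrite derive1E derive_val.
by rewrite E1 E3 E4 mxE E2 mulrC.
Qed.

(** The bound on - <p, Y'> with p = - Y' says |Y'|^2 <= H(- Y', Y), and - T Y' is the
velocity of Y run backwards on [0, T] in unit time; so [curve] applies to this
reversed curve. *)
Lemma Y_descent (T delta : R) : 0 < T ->
  (forall s, 0 < s < T -> derivable Y s 1 -> delta <= T * dotv (derive1 Y s) (derive1 Y s)) ->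
  g (Y T) + delta <= g (Y 0).
Proof.
move=> T0 hd.
have := @curve (fun t : R => Y (T * (1 - t))) (L * T) B delta.
rewrite subr0 mulr1 subrr mulr0; apply.
- move=> s t; rewrite (le_trans (Y_lipschitz _ _))// -mulrA ler_wpM2l//.
  have -> : T * (1 - s) - T * (1 - t) = - (T * (s - t)) by ring.
  by rewrite normrN normrM gtr0_norm.
- by move=> t; exact: Y_bounded.
move=> t t01 dg; have [dY ->] := Y_reversed_derivative T0 t01 dg.
move: t01; rewrite in_itv/= => /andP[t0 t1].
have s0 : 0 < T * (1 - t) by rewrite mulr_gt0// subr_gt0.
have sT : T * (1 - t) < T by rewrite gtr_pMr//; lra.
set q := derive1 Y _ in dY *.
rewrite scaleNr -scalerN HZ; last exact: ltW.
have := Y_derivative (- q) (ltW s0) dY; rewrite -/q dotvNl opprK => h.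
by rewrite (le_trans (hd _ _ dY))//; [rewrite s0|rewrite ler_pM2l].
Qed.

Lemma Y_nonincreasing T : 0 <= T -> g (Y T) <= g (Y 0).
Proof.
rewrite le_eqVlt => /orP[/eqP <-//|T0].
rewrite -[leLHS]addr0; apply: Y_descent => // s _ _.
by rewrite mulr_ge0 ?dotv_ge0// ltW.
Qed.

(** By upper semicontinuity H p < c < 0 along Y for a short time.  There <p, Y'> > - c,
so |Y'|^2 is at least c^2 / (|p|^2 + 1). *)
Lemma Y_decreasing p : H p (Y 0) < 0 -> exists2 T, 0 < T & g (Y T) < g (Y 0).
Proof.
move=> Hp; pose c := H p (Y 0) / 2.
have c0 : c < 0 by rewrite /c; lra.
have Hc : H p (Y 0) < c by rewrite /c; lra.
have nearY : \forall s \near (0 : R), H p (Y s) < c.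
  have Yc : {for 0, continuous Y} by exact: (lipschitz_continuous Y_lipschitz).
  exact: Yc _ (H_usc Hc).
have [d /= d0 dP] := (nbhs_ballP _ _).1 nearY.
exists (d / 2); first by rewrite divr_gt0.
pose P := dotv p p.
have P0 : 0 <= P by exact: dotv_ge0.
pose eta := c ^+ 2 / (P + 1).
have eta0 : 0 < eta by rewrite divr_gt0 ?exprn_even_gt0//= ?lt_eqF// ltr_wpDl.
suff : g (Y (d / 2)) + d / 2 * eta <= g (Y 0).
  by apply: lt_le_trans; rewrite ltrDl mulr_gt0// divr_gt0.
apply: Y_descent => [|s /andP[s0 sd] dY]; first by rewrite divr_gt0.
rewrite ler_pM2l ?divr_gt0//.
have Hs : H p (Y s) < c.
  by apply: dP; rewrite /ball/= sub0r normrN gtr0_norm//; lra.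
have := le_lt_trans (Y_derivative p (ltW s0) dY) Hs.
set q := derive1 Y s => pq.
pose a := - c / (P + 1).
have a0 : 0 < a by rewrite divr_gt0 ?oppr_gt0// ltr_wpDl.
have aP : a * (P + 1) = - c by rewrite divfK// gt_eqF// ltr_wpDl.
have etaE : eta = a * a * (P + 1).
  by rewrite -mulrA aP /eta /a expr2; field; rewrite gt_eqF// ltr_wpDl.
have := dotv_ge0 (q - a *: p).
rewrite dotvBl !dotvBr !dotvZl !dotvZr (dotvC q p) -/P.
set x := dotv p q in pq *; set z := dotv q q.
have ax : - (a * x) <= a * c by rewrite -mulrN ler_pM2l// ltW.
have aac : a * c = - (a * a * (P + 1)) by rewrite -mulrA aP mulrN opprK.
have aa0 : 0 <= a * a by rewrite mulr_ge0// ltW.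
rewrite etaE; nra.
Qed.

Lemma gY_cvg t : g (y (hit (phi j) t)) @[j --> U] --> g (Y t).
Proof.
apply: (@continuous_cvg _ _ _ U _ (fun j => y (hit (phi j) t)) g); last exact: Y_cvg.
exact: g_cont.
Qed.

Lemma Y0_cvg : y (phi j) @[j --> U] --> Y 0.
Proof.
have := @Y_cvg 0; rewrite (_ : (fun j => y (hit (phi j) 0)) = y \o phi)//.
by apply/funext => j /=; rewrite hit0.
Qed.

Lemma gY0_cvg : g (y (phi j)) @[j --> U] --> g (Y 0).
Proof.
have := @gY_cvg 0; rewrite (_ : (fun j => g (y (hit (phi j) 0))) = g \o y \o phi)//.
by apply/funext => j /=; rewrite hit0.
Qed.

(** The values g(y_k) converge, so g is constant along Y. *)
Lemma Y0_critical (l : R) : g (y k) @[k --> \oo] --> l -> forall p, 0 <= H p (Y 0).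
Proof.
move=> gl p; rewrite leNgt; apply/negP => /Y_decreasing[T T0].
have gU (psi : nat -> nat) : (forall j, (j <= psi j)%N) -> g (y (psi j)) @[j --> U] --> l.
  move=> psi_ge A /gl [K _ KP]; apply: Uoo; exists K => // j /= Kj; apply: KP => /=.
  exact: leq_trans Kj (psi_ge j).
have -> : g (Y T) = l.
  apply: (@cvg_unique _ _ ((fun j => g (y (hit (phi j) T))) @ U)) => //.
    exact: gY_cvg.
  by apply: (gU (fun j => hit (phi j) T)) => j; exact: leq_trans (phi_ge j) (hit_ge _ _).
have -> : g (Y 0) = l.
  by apply: (@cvg_unique _ _ ((fun j => g (y (phi j))) @ U)) => //; [exact: gY0_cvg|exact: gU].
by rewrite ltxx.
Qed.

(** The start of the excursions converges to a point of level c: it is at most c there,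
and above c one step later.  As c is not critical, g drops below c along Y after a
time T, so the excursions last at most T, and their ends converge to a point of Y
where g is at least b. *)
Lemma no_excursion (c b : R) (m : nat -> nat) : c < b ->
  (forall z, g z = c -> exists p, H p z < 0) ->
  (forall j, [/\ (phi j < m j)%N, g (y (phi j)) <= c, b <= g (y (m j)) &
     forall k, (phi j < k <= m j)%N -> c < g (y k)]) -> False.
Proof.
move=> cb ncrit hm.
have gY0c : g (Y 0) = c.
  apply/eqP; rewrite eq_le; apply/andP; split.
    apply: (cvgr_to_le gY0_cvg); apply: (@filterS _ U _ setT) => [j _|]; last exact: filterT.
    by case: (hm j).
  have yS : y (phi j).+1 @[j --> U] --> Y 0.
    apply/cvgrPdist_lt => e e0.
    have al_small : \forall j \near U, al (phi j) < e / 2 / (L + 1).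
      apply: (U_near (P := fun k => al k < e / 2 / (L + 1))).
      by apply: cvgr_lt al_cvg _ _; rewrite !divr_gt0// ltr_wpDl.
    have Yn : \forall j \near U, `|Y 0 - y (phi j)| < e / 2.
      by have /cvgrPdist_lt/(_ (e / 2)) := Y0_cvg; apply; rewrite divr_gt0.
    apply: filterS2 al_small Yn => j aj Yj.
    rewrite -(subrKA (y (phi j))) (le_lt_trans (ler_normD _ _))// (splitr e) ltr_leD//.
    rewrite distrC (le_trans (yL (leqnSn _)))// tauS addrC addKr.
    move: aj; rewrite ltr_pdivlMr ?ltr_wpDl// => aj.
    by rewrite (le_trans _ (ltW aj))// mulrC ler_wpM2l ?lerDl// ltW.
  have gS : g (y (phi j).+1) @[j --> U] --> g (Y 0).
    apply: (@continuous_cvg _ _ _ U _ (fun j => y (phi j).+1) g); last exact: yS.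
    exact: g_cont.
  apply: (cvgr_to_ge gS); apply: (@filterS _ U _ setT) => [j _|]; last exact: filterT.
  by have [h1 _ _ h4] := hm j; apply/ltW/h4; rewrite ltnSn h1.
have [p /Y_decreasing[T T0 gT]] := ncrit _ gY0c.
(* the duration of the j-th excursion *)
pose s j := tau (m j) - tau (phi j).
have after : \forall j \near U, 0 <= s j <= T.
  have : \forall j \near U, g (y (hit (phi j) T)) < c.
    by have /cvgr_lt := @gY_cvg T; apply; rewrite -gY0c.
  apply: filterS => j gj; have [h1 h2 h3 h4] := hm j.
  rewrite /s subr_ge0 tau_homo ?(ltnW h1)//= lerBlDl ltW//.
  apply: tau_hit_lt; first exact: ltnW.
  rewrite ltnNge; apply/negP => im; have := h4 (hit (phi j) T).
  rewrite im andbT ltNge (ltW gj) => h; have {h}// : false; apply: h.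
  rewrite ltn_neqAle hit_ge andbT; apply/negP => /eqP e.
  have [_ + _] := hitP (phi j) T; rewrite -e leNgt => /negP; apply.
  by rewrite ltrDl.
have [s0 s0T sc] : exists2 s0 : R, 0 <= s0 <= T & s j @[j --> U] --> s0.
  pose s' j := if 0 <= s j <= T then s j else 0.
  have s'T j : `[0, T]%classic (s' j).
    by rewrite /= in_itv/= /s'; case: ifP => // _; rewrite lexx ltW.
  have [s0 s0c] := ultra_compact_cvg UU (@segment_compact R 0 T) s'T.
  exists s0.
    apply/andP; split.
      apply: (cvgr_to_ge s0c); apply: (@filterS _ U _ setT) => [j _|]; last exact: filterT.
      by have := s'T j; rewrite /= in_itv/= => /andP[].
    apply: (cvgr_to_le s0c); apply: (@filterS _ U _ setT) => [j _|]; last exact: filterT.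
    by have := s'T j; rewrite /= in_itv/= => /andP[].
  apply: cvg_trans s0c; apply: near_eq_cvg.
  by apply: filterS after => j; rewrite /s' => ->.
have ym : y (m j) @[j --> U] --> Y s0.
  apply/cvgrPdist_lt => e e0.
  have L1 : 0 < L + 1 by rewrite ltr_wpDl.
  pose e1 := e / 2 / 2 / (L + 1).
  have e10 : 0 < e1 by rewrite !divr_gt0.
  have Yn : \forall j \near U, `|Y s0 - y (hit (phi j) s0)| < e / 2.
    by have /cvgrPdist_lt/(_ (e / 2)) := @Y_cvg s0; apply; rewrite divr_gt0.
  have sn : \forall j \near U, `|s0 - s j| < e1 by have /cvgrPdist_lt/(_ e1) := sc; apply.
  have tn := U_near (tau_hit e10).
  have yLabs i1 i2 : `|y i1 - y i2| <= L * `|tau i1 - tau i2|.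
    have [ab|/ltnW ba] := leqP i1 i2.
      by rewrite distrC (distrC (tau i1)) (le_trans (yL ab))// ler_wpM2l// ler_norm.
    by rewrite (le_trans (yL ba))// ler_wpM2l// ler_norm.
  near=> j.
  rewrite -(subrKA (y (hit (phi j) s0))) (le_lt_trans (ler_normD _ _))// (splitr e) ltr_leD//.
    by near: j.
  rewrite (le_trans (yLabs _ _))//.
  have h1 : `|s0 - s j| < e1 by near: j.
  have h2 : forall t, 0 <= t -> t <= tau (hit (phi j) t) - tau (phi j) <= t + e1 by near: j.
  have {}h2 := h2 s0 ltac:(by case/andP: s0T).
  rewrite (@le_trans _ _ ((L + 1) * (2 * e1)))//; last first.
    have -> : (L + 1) * (2 * e1) = e / 2 by rewrite /e1; field; rewrite gt_eqF.
    by [].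
  apply: ler_pM => //; first by rewrite lerDl.
  by move: h1; rewrite ltr_norml ler_norml /s; lra.
have gm : g (y (m j)) @[j --> U] --> g (Y s0).
  apply: (@continuous_cvg _ _ _ U _ (fun j => y (m j)) g); last exact: ym.
  exact: g_cont.
have : b <= g (Y s0).
  apply: (cvgr_to_ge gm); apply: (@filterS _ U _ setT) => [j _|]; last exact: filterT.
  by case: (hm j).
have := Y_nonincreasing (T := s0) _; rewrite gY0c => h1 h2.
have := h1 ltac:(by case/andP: s0T); lra.
Unshelve. all: by end_near. Qed.

End Limit.

Lemma cvgn_of_no_oscillation (u : nat -> R) (C : R) : (forall k, `|u k| <= C) ->
  (forall a b, a < b -> (forall K, exists2 k, (K <= k)%N & u k < a) ->
     (forall K, exists2 k, (K <= k)%N & b < u k) -> False) ->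
  cvgn u.
Proof.
move=> uC osc.
pose E := [set x | \forall k \near \oo, u k <= x].
have E0 : E C by exists 0%N => // k _ /=; rewrite (le_trans (ler_norm _)).
have Elb : lbound E (- C).
  move=> x [K _ Kx]; rewrite (le_trans _ (Kx K _))//=.
  by have := uC K; rewrite ler_norml => /andP[].
have hE : has_inf E by split; [exists C|exists (- C)].
apply/cvg_ex; exists (inf E); apply/cvgrPdist_le => e e0.
have up : \forall k \near \oo, u k <= inf E + e.
  have [x Ex xe] := inf_adherent e0 hE.
  by apply: filterS Ex => k /le_trans; apply; exact: ltW.
have low : \forall k \near \oo, inf E - e <= u k.
  apply: contrapT => nlow; apply: (osc (inf E - e) (inf E - e / 2)); first lra.
    move=> K; apply: contrapT => h; apply: nlow; exists K => // k /= Kk.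
    by rewrite leNgt; apply/negP => uk; apply: h; exists k.
  move=> K; apply: contrapT => h.
  have : E (inf E - e / 2).
    by exists K => // k /= Kk; rewrite leNgt; apply/negP => uk; apply: h; exists k.
  by move=> /(ge_inf (proj2 hE)); lra.
near=> k; rewrite ler_norml.
have h1 : u k <= inf E + e by near: k.
have h2 : inf E - e <= u k by near: k.
lra.
Unshelve. all: by end_near. Qed.

(** Across two levels that are crossed infinitely often there is a noncritical level c;
the last index with value at most c before a crossing of b starts an excursion. *)
Theorem approximation_convergence :
  cvgn (fun k => g (y k)) /\
  forall z, cluster (y k @[k --> \oo]) z -> forall p, 0 <= H p z.
Proof.
have [U [UU Uoo]] := @ultraFilterLemma nat \oo _.
have gcvg : cvgn (fun k => g (y k)).
  have B0 : [set x : 'rV[R]_n | `|x| <= B] !=set0 by exists (y 0); exact: yB.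
  have [x1 _ x1P] := compact_EVT_max B0 (@bounded_closed_ball R n B) (continuous_subspaceT g_cont).
  have [x2 _ x2P] := compact_EVT_min B0 (@bounded_closed_ball R n B) (continuous_subspaceT g_cont).
  apply: (@cvgn_of_no_oscillation _ (`|g x1| + `|g x2|)) => [k|a b ab ia ib].
    have := x1P (y k); rewrite inE => /(_ (yB k)) h1.
    have := x2P (y k); rewrite inE => /(_ (yB k)) h2.
    rewrite ler_norml; have := ler_norm (g x1); have := ler_norm (- g x2); rewrite normrN.
    have := normr_ge0 (g x1); have := normr_ge0 (g x2); lra.
  have [c /andP[ac cb] ncrit] := codense ab.
  have exc j : exists r : nat * nat, [/\ (j <= r.1)%N, (r.1 < r.2)%N, g (y r.1) <= c,
      b <= g (y r.2) & forall k, (r.1 < k <= r.2)%N -> c < g (y k)].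
    have [k0 jk0 gk0] := ia j; have [k1 k01 gk1] := ib k0.
    pose Q k := (k <= k1)%N && (g (y k) <= c).
    have exQ : exists k, Q k by exists k0; rewrite /Q k01 ltW// (lt_trans gk0).
    have Qub k : Q k -> (k <= k1)%N by case/andP.
    have := ex_maxnP exQ Qub; case: ex_maxnP => k2 Qk2 k2max _.
    have /andP[k21 gk2] := Qk2.
    exists (k2, k1); split => /=.
    - by rewrite (leq_trans jk0)// k2max// /Q k01 ltW// (lt_trans gk0).
    - rewrite ltn_neqAle k21 andbT; apply/eqP => e; move: gk2; rewrite e leNgt.
      by rewrite (lt_trans cb gk1).
    - by [].
    - exact: ltW.
    - move=> k /andP[k2k kk1]; rewrite ltNge; apply/negP => gk.
      by have := k2max k; rewrite /Q kk1 gk => /(_ isT); rewrite leqNgt k2k.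
  pose r j := projT1 (cid (exc j)).
  have rP j : [/\ (j <= (r j).1)%N, ((r j).1 < (r j).2)%N, g (y (r j).1) <= c,
      b <= g (y (r j).2) & forall k, ((r j).1 < k <= (r j).2)%N -> c < g (y k)].
    by rewrite /r; case: cid.
  apply: (@no_excursion U (fun j => (r j).1) UU Uoo _ c b (fun j => (r j).2)) => //.
    by move=> j; case: (rP j).
  by move=> j; case: (rP j).
split => // z zc p.
have [l gl] := (cvg_ex _).1 gcvg.
have ex j : exists2 k, (j <= k)%N & `|z - y k| < j.+1%:R^-1.
  have A : (y k @[k --> \oo]) [set y k | k in [set k | (j <= k)%N]].
    by exists j => // k /= jk; exists k.
  have Bz : nbhs z (ball z j.+1%:R^-1) by apply: nbhsx_ballx; rewrite invr_gt0.
  have [_ [[k jk <-]]] := zc _ _ A Bz.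
  by rewrite mx_norm_ball /ball_/= => h; exists k.
pose phi j := projT1 (cid2 (ex j)).
have phi_ge j : (j <= phi j)%N by rewrite /phi; case: cid2.
have phi_z j : `|z - y (phi j)| < j.+1%:R^-1 by rewrite /phi; case: cid2.
have phic : y (phi j) @[j --> U] --> z.
  apply/cvgrPdist_lt => e e0.
  have : \forall j \near \oo, j.+1%:R^-1 < e by exact: (near_infty_natSinv_lt (PosNum e0)).
  move=> /Uoo; apply: filterS => j; exact: lt_trans.
have <- : Y phi UU 0 = z.
  by apply: (@cvg_unique _ _ ((fun j => y (phi j)) @ U)) => //; exact: Y0_cvg.
exact: (Y0_critical (phi := phi) UU Uoo phi_ge gl).
Unshelve. all: by end_near. Qed.

End StochasticApproximation.

(** * Support functions and stationarity *)

Lemma continuous_big_sum_rV (R : realType) (n : nat) (T : topologicalType) (I : Type)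
    (r : seq I) (F : I -> T -> 'rV[R]_n) :
  (forall i, continuous (F i)) -> continuous (fun u => \sum_(i <- r) F i u).
Proof.
move=> Fc; elim: r => [|i r IH] u.
  by under eq_fun do rewrite big_nil; exact: cst_continuous.
under eq_fun do rewrite big_cons.
by apply: (@continuousD _ _ _ (F i)); [exact: Fc|exact: IH].
Qed.

Section Stationary.
Variables (R : realType) (n N : nat) (f_ : 'I_N -> 'rV[R]_n -> R)
  (D_ : 'I_N -> 'rV[R]_n -> set 'rV[R]_n) (sigma M : R).
Hypothesis DM : forall i x d, D_ i x d -> `|d| <= M.
Hypothesis Dcons : forall i, admits_conservative_field (f_ i) (D_ i).

Lemma compact_selection_means z : compact [set N%:R^-1 *: \sum_(i < N) d i
  | d in [set d : 'I_N -> 'rV[R]_n | forall i, D_ i z (d i)]].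
Proof.
pose K : 'I_N -> topologicalType := fun=> 'rV[R]_n.
have cD : compact [set d : prod_topology K | forall i, D_ i z (d i)].
  apply: (@tychonoff _ K (fun i => D_ i z)).
  by move=> i; have [[_ _ h _] _] := Dcons i; exact: h.
apply: (@continuous_compact (prod_topology K) _ (fun d => N%:R^-1 *: \sum_(i < N) d i)) => //.
apply: continuous_subspaceT => d.
apply: (@continuous_comp _ _ _ (fun d : prod_topology K => \sum_(i < N) (d i : 'rV[R]_n))
  (fun u => N%:R^-1 *: u)); last exact: scaler_continuous.
apply: (continuous_big_sum_rV (F := fun i (d : prod_topology K) => d i : 'rV[R]_n)) => i.
exact: (@proj_continuous _ K i).
Qed.

(** The point - sigma z is in the mean field by separation; the maximizers over each
D_i z provide the point of the compact set that dominates it. *)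
Lemma reg_suppf_ge0_stationary z :
  (forall p, 0 <= reg_suppf D_ sigma p z) -> stationary (reg_field sigma D_) z.
Proof.
move=> H0; apply: sub_gen_smallest.
exists (- (sigma *: z)); last by rewrite addNr.
apply: convex_hull_separation; first exact: compact_selection_means.
move=> p.
have [d dP] := choice (fun i => let: ex_intro2 d h1 h2 := suppf_attained DM Dcons i z p in
  ex_intro (fun d => D_ i z d /\ dotv p d = suppf (D_ i z) p) d (conj h1 h2)).
exists (N%:R^-1 *: \sum_(i < N) d i); first by exists d => // i; have [] := dP i.
rewrite dotvZr dotv_sumr (eq_bigr (fun i => suppf (D_ i z) p)); last by move=> i _; have [] := dP i.
by have := H0 p; rewrite /reg_suppf dotvNr dotvZr; lra.
Qed.

End Stationary.

(** * Exponential bounds for adapted noise *)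

Section RestrictedIntegral.
Context d (T : measurableType d) (R : realType) (P : {measure set T -> \bar R}).
Local Open Scope ereal_scope.

Lemma integral_mrestr (B : set T) (mB : measurable B) (u : T -> \bar R) :
  \int[mrestr P mB]_x u x = \int[P]_(x in B) u x.
Proof.
transitivity (\int[mrestr P mB]_(x in B) u x).
  rewrite [RHS]integral_mkcond.
  apply: (@integral_eq_null _ _ _ (mrestr P mB) _ _ setT (~` B)).
  - exact: measurableC.
  - by change (P (~` B `&` B) = 0); rewrite setICl measure0.
  - by move=> x _ /= /contrapT Bx; rewrite patchE mem_set.
apply: eq_measure_integral => A mA AB.
by change (P (A `&` B) = P A); rewrite setIidl.
Qed.

(** On <<s G>> the restriction of P to B is q P, so both have the same integral of a
function that is measurable for <<s G>>. *)
Lemma independent_integral (G : set (set T)) (B : set T) (q : R) (u : T -> \bar R) :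
  measurable B -> (0 <= q)%R -> (forall A, <<s G >> A -> measurable A) ->
  (forall A, <<s G >> A -> P (A `&` B) = P A * q%:E) ->
  (forall x, 0 <= u x) ->
  measurable_fun setT (u : g_sigma_algebraType G -> \bar R) ->
  \int[P]_(x in B) u x = q%:E * \int[P]_x u x.
Proof.
move=> mB q0 Gm GB u0 mu.
pose pr : T -> g_sigma_algebraType G := fun x => x.
have mpr : measurable_fun setT pr by move=> _ A mA; rewrite setTI; exact: Gm.
have E1 := @ge0_integral_pushforward _ _ _ _ _ pr mpr (mrestr P mB) setT u measurableT mu (fun x _ => u0 x).
have E2 := @ge0_integral_pushforward _ _ _ _ _ pr mpr P setT u measurableT mu (fun x _ => u0 x).
rewrite -integral_mrestr -[LHS]E1 -[X in _ * X]E2.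
rewrite -(@ge0_integral_mscale _ _ _ (pushforward P pr) setT measurableT (NngNum q0) u mu (fun x _ => u0 x)).
apply: eq_measure_integral => A mA _.
rewrite /= /mscale /= /pushforward /mrestr preimage_id muleC; exact: GB.
Qed.

End RestrictedIntegral.

Lemma expR_le_quadratic (R : realType) (x : R) : `|x| <= 3^-1 -> expR x <= 1 + x + x ^+ 2.
Proof.
rewrite ler_norml => /andP[x1 x2].
have h : 1 - x / 2 <= expR (- (x / 2)) by have := @expR_ge1Dx R (- (x / 2)); lra.
have h0 : 0 < 1 - x / 2 by lra.
have e0 := expR_gt0 (x / 2).
have e1 : expR (x / 2) * (1 - x / 2) <= 1.
  by rewrite (le_trans (ler_wpM2l (ltW e0) h))// -expRD subrr expR0.
have -> : x = x / 2 + x / 2 by lra.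
rewrite expRD; set e := expR _ in e0 e1 *; have -> : x / 2 + x / 2 = x by lra.
have e2 : e * e * ((1 - x / 2) * (1 - x / 2)) <= 1.
  rewrite mulrACA -[leRHS]mulr1; apply: ler_pM => //; apply: mulr_ge0; lra.
rewrite -(ler_pM2r (mulr_gt0 h0 h0)) (le_trans e2)//.
rewrite expr2; nra.
Qed.

Section Concentration.
Context d (T : measurableType d) (R : realType) (P : probability T R).
Variables (N : nat) (idx : nat -> T -> 'I_N) (G : nat -> set (set T)).
Hypothesis N0 : (0 < N)%N.
Hypothesis Gm : forall k A, <<s G k >> A -> measurable A.
Hypothesis Gmono : forall k A, <<s G k >> A -> <<s G k.+1 >> A.
Hypothesis Gidx : forall k i, <<s G k.+1 >> (idx k @^-1` [set i]).
Hypothesis Gindep : forall k i A, <<s G k >> A ->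
  P (A `&` idx k @^-1` [set i]) = (P A * (N%:R^-1)%:E)%E.

(** The sigma-algebra generated by G k stands for the past of step k. *)
Definition adapted k (u : T -> R) :=
  measurable_fun setT (u : g_sigma_algebraType (G k) -> R).

Lemma adapted_measurable k u : adapted k u -> measurable_fun setT u.
Proof. by move=> mu _ A mA; apply: Gm (mu measurableT A mA). Qed.

Lemma adaptedS k u : adapted k u -> adapted k.+1 u.
Proof. by move=> mu _ A mA; apply: Gmono (mu measurableT A mA). Qed.

Lemma measurable_idx k i : measurable (idx k @^-1` [set i]).
Proof. exact: Gm (@Gidx k i). Qed.

Variables (phi : nat -> 'I_N -> T -> R) (C : R) (a : nat -> R).
Hypothesis phi_adapted : forall k i, adapted k (phi k i).
Hypothesis phiC : forall k i w, `|phi k i w| <= C.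
Hypothesis phi_mean : forall k w, \sum_i phi k i w = 0.
Hypothesis a0 : forall k, 0 < a k.

Lemma select_sum (V : nmodType) (F : 'I_N -> V) i : F i = \sum_j (if j == i then F j else 0).
Proof. by rewrite -big_mkcond/= big_pred1_eq. Qed.

(** The index takes finitely many values and belongs to the past of step k + 1. *)
Lemma adapted_select k (F : 'I_N -> T -> R) : (forall i, adapted k.+1 (F i)) ->
  adapted k.+1 (fun w => F (idx k w) w).
Proof.
move=> mF; rewrite /adapted.
rewrite (_ : (fun w => _) = (fun w => \sum_i \1_(idx k @^-1` [set i]) w * F i w)).
  apply: measurable_sum => i; apply: measurable_funM; last exact: mF.
  by apply: measurable_indic; exact: Gidx.
apply/funext => w; rewrite (select_sum (fun i => F i w)); apply: eq_bigr => i _.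
rewrite indicE; case: eqVneq => [->|ne]; first by rewrite mem_set ?mul1r.
by rewrite memNset ?mul0r// => /= e; rewrite e eqxx in ne.
Qed.

Section Stopped.
Variables (eps : R) (n : nat).

(** The sum of the noise from step n on, frozen once it has reached eps. *)
Fixpoint stopped_sum (j : nat) (w : T) : R :=
  if j is j'.+1 then
    stopped_sum j' w + (if eps <= stopped_sum j' w then 0
                        else a (n + j') * phi (n + j') (idx (n + j') w) w)
  else 0.

Lemma adapted_stopped_sum j : adapted (n + j) (stopped_sum j).
Proof.
elim: j => [|j IH]; first exact: measurable_cst.
rewrite addnS /adapted /=; apply: measurable_funD; first exact: adaptedS.
apply: (@adapted_select (n + j) (fun i w => if eps <= stopped_sum j w then 0
  else a (n + j) * phi (n + j) i w)) => i.
apply: measurable_fun_ifT; first 1 last.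
- exact: measurable_cst.
- by apply: measurable_funM; [exact: measurable_cst|exact: adaptedS].
by apply: measurable_fun_ler; [exact: measurable_cst|exact: adaptedS].
Qed.

(** e^x <= 1 + x + x^2 for small x, and the linear terms cancel in the mean. *)
Lemma mean_exp_le (x : 'I_N -> R) (c : R) : (forall i, `|x i| <= c) -> c <= 3^-1 ->
  \sum_i x i = 0 -> N%:R^-1 * \sum_i expR (x i) <= expR (c ^+ 2).
Proof.
move=> xc c3 x0.
have NR : (0 : R) < N%:R by rewrite ltr0n.
rewrite ler_pdivrMl//.
have : \sum_i expR (x i) <= \sum_i (1 + x i + c ^+ 2).
  apply: ler_sum => i _; rewrite (le_trans (expR_le_quadratic (le_trans (xc i) c3)))//.
  by rewrite lerD2l -(real_normK (num_real (x i))) lerXn2r// nnegrE (le_trans _ (xc i)).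
move=> /le_trans; apply; rewrite !big_split/= x0 addr0 !sumr_const card_ord.
rewrite -mulrnDl -[leLHS]mulr_natl ler_pM2l//.
exact: expR_ge1Dx.
Qed.

(** Whether the sum is frozen is decided by the past of the step.  The sampled index
is independent of this past, so integrating it out replaces the last factor by its
mean over the indices, to which [mean_exp_le] applies. *)
Lemma integral_stopped_sum lam j : 0 <= lam ->
  (forall i, (i < j)%N -> lam * a (n + i) * C <= 3^-1) ->
  (\int[P]_w (expR (lam * stopped_sum j w))%:E <=
    (expR (\sum_(i < j) (lam * a (n + i) * C) ^+ 2))%:E)%E.
Proof.
move=> lam0; elim: j => [|j IH] small.
  rewrite big_ord0 /= expR0; under eq_integral do rewrite mulr0 expR0.
  rewrite integral_cst// (_ : _ * _ = 1%:E)%E//.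
  by rewrite mul1e; exact: (@probability_setT _ _ _ P).
have {}IH := IH (fun i ij => small i (ltnW ij)).
pose W w := expR (lam * stopped_sum j w).
pose psi i w := expR (lam * (if eps <= stopped_sum j w then 0
                        else a (n + j) * phi (n + j) i w)).
have aW : adapted (n + j) W.
  apply: measurableT_comp => //; apply: measurable_funM; first exact: measurable_cst.
  exact: adapted_stopped_sum.
have apsi i : adapted (n + j) (psi i).
  apply: measurableT_comp => //; apply: measurable_funM; first exact: measurable_cst.
  apply: measurable_fun_ifT; first 1 last.
  - exact: measurable_cst.
  - by apply: measurable_funM; [exact: measurable_cst|exact: phi_adapted].
  by apply: measurable_fun_ler; [exact: measurable_cst|exact: adapted_stopped_sum].
have W0 w : 0 <= W w by exact: expR_ge0.
have psi0 i w : 0 <= psi i w by exact: expR_ge0.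
have mW := adapted_measurable aW; have mpsi i := adapted_measurable (apsi i).
pose E i := idx (n + j) @^-1` [set i].
have mE i : measurable (E i) by exact: measurable_idx.
(* split according to the value of the sampled index *)
have -> : (\int[P]_w (expR (lam * stopped_sum j.+1 w))%:E =
    \int[P]_w \sum_i ((fun w => (W w * psi i w)%:E) \_ (E i)) w)%E.
  apply: eq_integral => w _; rewrite /= mulrDr expRD -/(W w) -/(psi (idx (n + j) w) w).
  rewrite (select_sum (fun i => (W w * psi i w)%:E)%E); apply: eq_bigr => i _.
  rewrite patchE; case: eqVneq => [->|ne]; first by rewrite mem_set.
  by rewrite memNset// => /= e; rewrite -e eqxx in ne.
rewrite ge0_integral_sum//; last 2 first.
- move=> i; apply/(measurable_restrictT _ _).1 => //.
  by apply/measurable_EFinP/measurable_funTS; exact: measurable_funM.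
- by move=> i w _; apply: erestrict_ge0 => w' _; rewrite lee_fin mulr_ge0.
(* both factors belong to the past, of which the index is independent *)
have -> : (\sum_i \int[P]_w ((fun w => (W w * psi i w)%:E) \_ (E i)) w =
   \sum_i ((N%:R^-1)%:E * \int[P]_w (W w * psi i w)%:E))%E.
  apply: eq_bigr => i _; rewrite -integral_mkcond.
  apply: (@independent_integral _ _ _ P (G (n + j))) => //.
  - exact: Gm.
  - by move=> A GA; exact: Gindep.
  - by move=> w; rewrite lee_fin mulr_ge0.
  by apply/measurable_EFinP; apply: measurable_funM; [exact: aW|exact: apsi].
have -> : (\sum_i ((N%:R^-1)%:E * \int[P]_w (W w * psi i w)%:E) =
   \int[P]_w (W w * (N%:R^-1 * \sum_i psi i w))%:E)%E.
  rewrite -ge0_sume_distrr; last first.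
    by move=> i _; apply: integral_ge0 => w _; rewrite lee_fin mulr_ge0.
  rewrite -ge0_integral_sum//; last 2 first.
  - by move=> i; apply/measurable_EFinP; exact: measurable_funM.
  - by move=> i w _; rewrite lee_fin mulr_ge0.
  rewrite -ge0_integralZl_EFin//; last 2 first.
  - by move=> w _; apply: sume_ge0 => i _; rewrite lee_fin mulr_ge0.
  - apply: emeasurable_sum => i; apply/measurable_EFinP; exact: measurable_funM.
  apply: eq_integral => w _; rewrite sumEFin -EFinM; congr EFin.
  by rewrite -mulr_sumr mulrCA.
set c := (lam * a (n + j) * C) ^+ 2.
apply: (@le_trans _ _ (\int[P]_w ((expR c)%:E * (W w)%:E))%E).
  apply: ge0_le_integral => //.
  - by move=> w _; rewrite lee_fin !mulr_ge0// sumr_ge0.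
  - apply/measurable_EFinP; apply: measurable_funM => //; apply: measurable_funM => //.
    exact: measurable_sum.
  - by apply: emeasurable_funM => //; apply/measurable_EFinP.
  move=> w _; rewrite -EFinM lee_fin (mulrC (W w)) ler_wpM2r//.
  have [st|st] := boolP (eps <= stopped_sum j w).
    rewrite /psi st mulr0 expR0 sumr_const card_ord mulVf ?pnatr_eq0 -?lt0n//.
    by rewrite -expR0 ler_expR sqr_ge0.
  rewrite /psi (negbTE st).
  apply: (@mean_exp_le (fun i => lam * (a (n + j) * phi (n + j) i w))) => [i||].
  - rewrite mulrA normrM ger0_norm; last by rewrite mulr_ge0// ltW.
    by rewrite ler_wpM2l// mulr_ge0// ltW.
  - exact: small.
  - by rewrite -mulr_sumr -mulr_sumr phi_mean !mulr0.
rewrite ge0_integralZl_EFin ?expR_ge0//; last 2 first.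
- by move=> w _; rewrite lee_fin.
- exact/measurable_EFinP.
rewrite big_ord_recr/= addrC expRD EFinM lee_wpmul2l// lee_fin expR_ge0.
Qed.

End Stopped.
End Concentration.

Lemma sum_inv_sqr_le (R : realType) n :
  \sum_(k < n) ((k.+1)%:R ^- 2 : R) <= 2.
Proof.
case: n => [|n]; first by rewrite big_ord0.
suff : \sum_(k < n.+1) ((k.+1)%:R ^- 2 : R) <= 2 - n.+1%:R^-1.
  by move=> /le_trans; apply; rewrite lerBlDr lerDl invr_ge0.
elim: n => [|n IH]; first by rewrite big_ord1 expr1n invr1; lra.
rewrite big_ord_recr/= (le_trans (lerD IH (lexx _)))//.
have a0 : (0 : R) < n.+1%:R by rewrite ltr0n.
have -> : (n.+2)%:R = n.+1%:R + 1 :> R by rewrite -natr1.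
set a : R := n.+1%:R in a0 *.
have b0 : 0 < a + 1 by lra.
rewrite -subr_ge0 (_ : _ - _ = (a * (a + 1) ^+ 2)^-1) ?invr_ge0 ?mulr_ge0 ?sqr_ge0 ?ltW//.
by field; rewrite !gt_eqF.
Qed.

Section NoiseControl.
Context d (T : measurableType d) (R : realType) (P : probability T R).
Variables (N : nat) (idx : nat -> T -> 'I_N) (G : nat -> set (set T)).
Hypothesis N0 : (0 < N)%N.
Hypothesis Gm : forall k A, <<s G k >> A -> measurable A.
Hypothesis Gmono : forall k A, <<s G k >> A -> <<s G k.+1 >> A.
Hypothesis Gidx : forall k i, <<s G k.+1 >> (idx k @^-1` [set i]).
Hypothesis Gindep : forall k i A, <<s G k >> A ->
  P (A `&` idx k @^-1` [set i]) = (P A * (N%:R^-1)%:E)%E.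
Variables (phi : nat -> 'I_N -> T -> R) (C : R) (a : nat -> R).
Hypothesis phi_adapted : forall k i, adapted G k (phi k i).
Hypothesis phiC : forall k i w, `|phi k i w| <= C.
Hypothesis phi_mean : forall k w, \sum_i phi k i w = 0.
Hypothesis a0 : forall k, 0 < a k.

Definition noise_sum n j w := \sum_(i < j) a (n + i) * phi (n + i) (idx (n + i) w) w.
Definition window n j := \sum_(i < j) a (n + i).

Lemma measurable_stopped_sum (eps : R) n j :
  measurable_fun setT (stopped_sum idx phi a eps n j).
Proof.
apply: (adapted_measurable Gm (k := (n + j)%N)).
exact: adapted_stopped_sum.
Qed.

(** Once above eps the stopped sum stays there, so the event that some partial sum
within the window reaches eps is contained in an event about the last stopped sum
alone. *)
Lemma noise_sum_le_stopped (eps : R) n j J (w : T) : (j <= J)%N -> eps <= noise_sum n j w ->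
  eps <= stopped_sum idx phi a eps n J w.
Proof.
move=> jJ ej; rewrite leNgt; apply/negP => sJ.
have below i : (i <= J)%N -> stopped_sum idx phi a eps n i w < eps.
  move=> iJ; rewrite -(subnK iJ) addnC in sJ.
  elim: (J - i)%N sJ => [|l IH]; first by rewrite addn0.
  rewrite addnS /=; case: ifP => [h|/negbT]; last by rewrite -ltNge => + _; exact: IH.
  by rewrite addr0; exact: IH.
suff e i : (i <= J)%N -> stopped_sum idx phi a eps n i w = noise_sum n i w.
  by have := below _ jJ; rewrite e// ltNge ej.
elim: i => [_|i IH iJ]; first by rewrite /noise_sum big_ord0.
rewrite /noise_sum big_ord_recr/= -/(noise_sum n i w) -IH 1?ltnW//.
by rewrite leNgt below ?(ltnW iJ).
Qed.

Lemma noise_tail (eps : R) n J (lam : R) : 0 <= lam ->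
  (forall i, (i < J)%N -> lam * a (n + i) * C <= 3^-1) ->
  (P [set w | (eps <= stopped_sum idx phi a eps n J w)%R] <=
   (expR (- (lam * eps) + \sum_(i < J) (lam * a (n + i) * C) ^+ 2))%:E)%E.
Proof.
move=> lam0 small; set Z := stopped_sum _ _ _ _ _ _; set A := [set w | _].
have mZ : measurable_fun setT Z by exact: measurable_stopped_sum.
have mA : measurable A.
  rewrite (_ : A = setT `&` Z @^-1` `[eps, +oo[).
    by apply: mZ => //; exact: measurable_itv.
  by rewrite setTI; apply/seteqP; split=> w /=; rewrite in_itv/= andbT.
have mE : measurable_fun setT (fun w => (expR (lam * Z w))%:E).
  apply/measurable_EFinP; apply: measurableT_comp => //.
  by apply: measurable_funM => //; exact: measurable_cst.
rewrite expRD EFinM expRN lee_pdivlMl ?expR_gt0//.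
have := integral_stopped_sum N0 Gm Gmono Gidx Gindep phi_adapted phiC phi_mean a0 eps lam0 small.
apply: le_trans; rewrite -/Z -integral_cst//.
apply: (@le_trans _ _ (\int[P]_(w in A) (expR (lam * Z w))%:E)%E).
  apply: ge0_le_integral => //.
  - by move=> w _; rewrite lee_fin expR_ge0.
  - exact: measurable_funTS.
  - by move=> w Aw; rewrite lee_fin ler_expR ler_wpM2l.
by apply: ge0_subset_integral => // w _; rewrite lee_fin expR_ge0.
Qed.

Hypothesis C0 : 0 <= C.
Hypothesis a_log : a k * ln k%:R @[k --> \oo] --> (0 : R).
Hypothesis a_div : series a @ \oo --> +oo.

(** The clock diverges, so a window of given length has a last index. *)
Lemma window_max (L : R) n : 0 <= L -> exists J, window n J <= L /\
  forall j, window n j <= L -> (j <= J)%N.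
Proof.
move=> L0.
have [K hK] : exists K, L < window n K.
  have /cvgryPgt/(_ (L + series a n)) [K _ /(_ (n + K)%N)] := a_div.
  rewrite /= leq_addl => /(_ isT) h; exists K; rewrite -(ltrD2r (series a n)) (lt_le_trans h)//.
  rewrite /series/= addrC (big_cat_nat (n := n))//= ?leq_addr// lerD2l.
  by rewrite -{1}[n]add0n big_addn addKn big_mkord; under eq_bigr do rewrite addnC.
have wm i j : (i <= j)%N -> window n i <= window n j.
  move=> ij; rewrite -(subnK ij) addnC /window big_split_ord/= lerDl.
  by apply: sumr_ge0 => l _; exact: ltW.
have ub j : window n j <= L -> (j <= K)%N.
  by move=> h; rewrite leqNgt; apply/negP => /ltnW/wm; lra.
have e0 : exists j, window n j <= L by exists 0%N; rewrite /window big_ord0.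
by exists (ex_maxn e0 ub); case: ex_maxnP => J hJ mJ; split.
Qed.

(** With lam = K log n, where K eps = 3, the exponent of [noise_tail] is at most
- 3 log n + log n: for large n the steps are at most D^-1 / log, which keeps the
quadratic term below log n and the increments below 1/3.  So the tail is at most
n^-2, and Borel-Cantelli applies. *)
Lemma noise_eventually_small (eps L : R) : 0 < eps -> 0 <= L ->
  {ae P, forall w, \forall n \near \oo, forall j, window n j <= L -> noise_sum n j w < eps}.
Proof.
move=> eps0 L0.
pose K := 3 / eps.
have K0 : 0 < K by rewrite divr_gt0.
have KC0 : 0 <= K * C by rewrite mulr_ge0// ltW.
(* D is large enough for D1, which keeps the increments in the range of
   [mean_exp_le], and for D2, which bounds the quadratic term by log n *)
pose D := 3 * (1 + K * C) ^+ 2 * (1 + L).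
have D0 : 0 < D by rewrite !mulr_gt0// ?exprn_gt0//; lra.
have KCL : 0 <= K * C * L by rewrite mulr_ge0.
have KCCL : 0 <= K * C * (K * C) * L by rewrite mulr_ge0// mulr_ge0.
have D1 : K * C * D^-1 <= 3^-1.
  by rewrite ler_pdivrMr// /D expr2; set x := K * C in KC0 KCL KCCL *; nra.
have D2 : K * C * D^-1 * (K * C * L) <= 1.
  rewrite mulrAC ler_pdivrMr// mul1r /D expr2.
  by set x := K * C in KC0 KCL KCCL *; nra.
have [n0 n00 hn0] : exists2 n0, (0 < n0)%N & forall k, (n0 <= k)%N -> a k * ln k%:R <= D^-1.
  have Di : 0 < D^-1 by rewrite invr_gt0.
  have /cvgrPdist_le/(_ _ Di)[n0 _ h] := a_log.
  exists n0.+1 => // k /ltnW /h; rewrite sub0r normrN => /(le_trans (ler_norm _)); exact.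
have [J hJ] := choice (fun n => window_max n L0).
pose F k := [set w | eps <= stopped_sum idx phi a eps (n0 + k) (J (n0 + k)%N) w].
have mF k : measurable (F k).
  rewrite (_ : F k = setT `&` stopped_sum idx phi a eps (n0 + k) (J (n0 + k)%N) @^-1` `[eps, +oo[).
    by apply: measurable_stopped_sum => //; exact: measurable_itv.
  by rewrite setTI; apply/seteqP; split=> w /=; rewrite in_itv/= andbT.
have PF k : (P (F k) <= ((k.+1)%:R ^- 2)%:E)%E.
  set n := (n0 + k)%N in F mF *.
  have nk : (k.+1 <= n)%N by rewrite /n -addn1 addnC leq_add2r.
  have n_gt0 : (0 < n)%N by exact: leq_trans nk.
  have n0R : (0 : R) < n%:R by rewrite ltr0n.
  have ln0 : 0 <= ln n%:R :> R by rewrite ln_ge0// ler1n.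
  have lam0 : 0 <= K * ln n%:R by rewrite mulr_ge0// ltW.
  have small i : K * ln n%:R * a (n + i)%N * C <= K * C * D^-1.
    rewrite (_ : _ * C = K * C * (a (n + i)%N * ln n%:R)); last by ring.
    rewrite ler_wpM2l//; apply: le_trans (hn0 (n + i)%N _); last first.
      by rewrite /n -addnA leq_addr.
    apply: ler_wpM2l; first exact: ltW.
    by rewrite ler_ln ?posrE ?ler_nat ?leq_addr// ltr0n addn_gt0 n_gt0.
  have pos i : 0 <= K * ln n%:R * a (n + i)%N * C.
    by apply: mulr_ge0 => //; apply: mulr_ge0 => //; exact: ltW.
  have := @noise_tail eps n (J n) (K * ln n%:R) lam0 (fun i _ => le_trans (small i) D1).
  move=> /le_trans; apply; rewrite lee_fin.
  apply: (@le_trans _ _ (expR (ln n%:R *- 2))).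
    rewrite ler_expR.
    have -> : K * ln n%:R * eps = ln n%:R * 3 by rewrite /K; field; rewrite gt_eqF.
    suff : \sum_(i < J n) (K * ln n%:R * a (n + i)%N * C) ^+ 2 <= ln n%:R.
      by rewrite mulr2n; lra.
    apply: (@le_trans _ _ (K * C * D^-1 * (K * C * ln n%:R) * window n (J n))).
      rewrite /window mulr_sumr; apply: ler_sum => i _.
      rewrite expr2 (le_trans (ler_wpM2r (pos i) (small i)))//.
      by rewrite le_eqVlt; apply/orP; left; apply/eqP; ring.
    have [wL _] := hJ n.
    apply: (@le_trans _ _ (K * C * D^-1 * (K * C * ln n%:R) * L)).
      by rewrite ler_wpM2l// !mulr_ge0 ?invr_ge0// ltW.
    rewrite (_ : _ * L = K * C * D^-1 * (K * C * L) * ln n%:R); last by ring.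
    by rewrite -[leRHS]mul1r ler_wpM2r.
  rewrite expRN -[ln _ *+ 2]mulr_natr expRM_natr lnK ?posrE// lef_pV2 ?posrE ?exprn_gt0//.
  by rewrite lerXn2r ?nnegrE ?ler0n// ler_nat.
exists (lim_sup_set F); split.
- by apply: bigcap_measurable => // k _; exact: bigcup_measurable.
- apply: lim_sup_set_cvg0 => //; apply: (@le_lt_trans _ _ 2%:E); last exact: ltry.
  apply: lime_le.
    by apply: is_cvg_nneseries => n _ _; exact: measure_ge0.
  apply: nearW => n; rewrite big_mkord.
  apply: (@le_trans _ _ (\sum_(k < n) ((k.+1)%:R ^- 2)%:E)%E).
    by apply: lee_sum => k _; exact: PF.
  by rewrite sumEFin lee_fin sum_inv_sqr_le.
move=> w /= nw k _; apply: contrapT => h; apply: nw.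
exists (n0 + k)%N => // n /= nk j wj; rewrite ltNge; apply/negP => ej; apply: h.
have n0n : (n0 <= n)%N by rewrite (leq_trans _ nk)// leq_addr.
exists (n - n0)%N; first by rewrite /= leq_subRL.
rewrite /F/= subnKC//; apply: noise_sum_le_stopped ej.
by have [_] := hJ n; apply.
Qed.

End NoiseControl.

(** * The oracle noise of AdamD *)

Section AdamDNoise.
Context d (T : measurableType d) (R : realType) (P : probability T R).
Variables (n N : nat) (f_ : 'I_N -> 'rV[R]_n -> R)
  (D_ : 'I_N -> 'rV[R]_n -> set 'rV[R]_n) (M : R).
Hypothesis N0 : (0 < N)%N.
Hypothesis DM : forall i x d, D_ i x d -> `|d| <= M.
Hypothesis Dcons : forall i, admits_conservative_field (f_ i) (D_ i).
Variables (sigma eps eta beta : R) (theta : nat -> R) (x0 m0 v0 : 'rV[R]_n).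
Variables (idx : nat -> T -> 'I_N) (g x m v : nat -> T -> 'rV[R]_n).
Hypothesis eps0 : 0 < eps.
Hypothesis Hadam : adamD P D_ sigma eps eta beta theta x0 m0 v0 idx g x m v.

(** The generating family of [history]. *)
Definition history_generator k : set (set T) :=
  \bigcup_(j in `I_k)
    (preimage_set_system [set: T] (idx j) [set: set 'I_N] `|`
     \bigcup_(l in [set: 'I_n])
       preimage_set_system [set: T] (fun w => g j w 0 l) measurable).
Local Notation G := history_generator.

Lemma history_measurable k A : <<s G k >> A -> measurable A.
Proof.
apply: smallest_sub => [|B]; first exact: sigma_algebra_measurable.
move=> [j _ [[I _ <-]|[l _ [C mC <-]]]]; last exact: (adamD_g_measurable Hadam).
rewrite setTI (_ : _ @^-1` _ = \bigcup_(i in I) (idx j @^-1` [set i])).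
  apply: fin_bigcup_measurable; first exact: finite_finset.
  by move=> i _; exact: (adamD_idx_measurable Hadam).
by apply/seteqP; split=> w /= => [Iw|[i Ii ->]] //; exists (idx j w).
Qed.

Lemma history_mono k A : <<s G k >> A -> <<s G k.+1 >> A.
Proof.
apply: sub_sigma_algebra2 => B [j /= jk GB]; exists j => //=.
exact: ltn_trans jk _.
Qed.

Lemma history_idx k i : <<s G k.+1 >> (idx k @^-1` [set i]).
Proof.
apply: sub_sigma_algebra; exists k => //=; left.
by exists [set i] => //; rewrite setTI.
Qed.

Lemma history_indep k i A : <<s G k >> A ->
  P (A `&` idx k @^-1` [set i]) = (P A * (N%:R^-1)%:E)%E.
Proof.
by move=> GA; rewrite (adamD_idx_indep Hadam)// (adamD_idx_uniform Hadam).
Qed.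

Lemma adapted_g k l : adapted G k.+1 (fun w => g k w 0 l).
Proof.
move=> _ A mA; apply: sub_sigma_algebra; exists k => //=; right.
by exists l => //; exists A.
Qed.

Lemma continuous_precond : continuous (fun s : R => (Num.sqrt s + eps)^-1).
Proof.
move=> s; apply: (@continuousV _ _ (fun s : R => Num.sqrt s + eps)).
  by rewrite gt_eqF// ltr_wpDl// sqrtr_ge0.
apply: (@continuousD _ _ _ (@Num.sqrt R) (fun=> eps)); last exact: cst_continuous.
exact: sqrt_continuous.
Qed.

Lemma adapted_iterates k l : [/\ adapted G k (fun w => m k w 0 l),
  adapted G k (fun w => v k w 0 l) & adapted G k (fun w => x k w 0 l)].
Proof.
elim: k => [|k [am av ax]].
  split; rewrite /adapted.
  - by under eq_fun do rewrite (adamD_m0 Hadam); exact: measurable_cst.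
  - by under eq_fun do rewrite (adamD_v0 Hadam); exact: measurable_cst.
  - by under eq_fun do rewrite (adamD_x0 Hadam); exact: measurable_cst.
have S := @adaptedS _ T R G history_mono k.
have am' : adapted G k.+1 (fun w => m k.+1 w 0 l).
  rewrite /adapted; under eq_fun do rewrite (adamD_m Hadam) !mxE.
  apply: measurable_funD; apply: measurable_funM; try exact: measurable_cst.
    exact: S.
  exact: adapted_g.
have av' : adapted G k.+1 (fun w => v k.+1 w 0 l).
  rewrite /adapted; under eq_fun do rewrite (adamD_v Hadam) !mxE.
  apply: measurable_funD; apply: measurable_funM; try exact: measurable_cst.
    exact: S.
  by apply: measurable_funX; exact: adapted_g.
split => //.
rewrite /adapted; under eq_fun do rewrite (adamD_x Hadam) !mxE.
apply: measurable_funB; first exact: S.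
apply: measurable_funM; first exact: measurable_cst.
apply: measurable_funM.
  apply: (measurableT_comp (f := fun s : R => (Num.sqrt s + eps)^-1)) => //.
  by apply: continuous_measurable_fun => s; exact: continuous_precond.
apply: measurable_funD; first exact: am'.
by apply: measurable_funM; [exact: measurable_cst|exact: S].
Qed.

(** The support function at p of the sampled field, minus its mean over the indices.
It bounds the excess of <p, g_k> over the mean for every selection g_k. *)
Definition oracle_noise k p i w :=
  suppf (D_ i (x k w)) p - N%:R^-1 * \sum_i' suppf (D_ i' (x k w)) p.

Lemma field_nonempty i z : D_ i z !=set0.
Proof. by have [[_ h _ _] _] := Dcons i; exact: h. Qed.

Lemma bound_ge0 : 0 <= M.
Proof. by have [e De] := field_nonempty (Ordinal N0) 0; rewrite (le_trans _ (DM De)). Qed.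

Lemma mean_le (F : 'I_N -> R) c : (forall i, F i <= c) -> N%:R^-1 * \sum_i F i <= c.
Proof.
move=> Fc; rewrite ler_pdivrMl ?ltr0n//.
have : \sum_i F i <= \sum_(i < N) c by apply: ler_sum.
by move=> /le_trans; apply; rewrite sumr_const card_ord mulr_natl.
Qed.

Lemma adapted_oracle_noise k p i : adapted G k (oracle_noise k p i).
Proof.
have mx l : adapted G k (fun w => x k w 0 l) by have [] := adapted_iterates k l.
have mh i' : adapted G k (fun w => suppf (D_ i' (x k w)) p).
  have mp l : measurable_fun setT (fun _ : g_sigma_algebraType (G k) => p 0 l) by exact: measurable_cst.
  exact: (measurable_suppf DM Dcons i' mp mx).
apply: measurable_funB; first exact: mh.
apply: measurable_funM; first exact: measurable_cst.
by apply: measurable_sum => i'; exact: mh.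
Qed.

Lemma oracle_noise_mean k p w : \sum_i oracle_noise k p i w = 0.
Proof.
rewrite sumrB sumr_const card_ord -[X in _ - X]mulr_natl mulVKf ?subrr// pnatr_eq0 -lt0n//.
Qed.

Lemma oracle_noise_lip k p q i w :
  oracle_noise k p i w <= oracle_noise k q i w + 2 * (n%:R * M) * `|p - q|.
Proof.
have h i' := @suppf_lip _ _ _ _ (field_nonempty i' (x k w)) (DM (i := i') (x := x k w)).
have h1 := h i p q.
have h2 : N%:R^-1 * \sum_i' suppf (D_ i' (x k w)) q <=
    N%:R^-1 * \sum_i' suppf (D_ i' (x k w)) p + n%:R * M * `|p - q|.
  rewrite -lerBlDl -mulrBr -sumrB; apply: mean_le => i'.
  by rewrite lerBlDl distrC; exact: h.
rewrite /oracle_noise; lra.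
Qed.

Lemma oracle_noise_bound k p i w : `|oracle_noise k p i w| <= 2 * (n%:R * M) * `|p|.
Proof.
have h i' := @suppf_norm _ _ _ _ (field_nonempty i' (x k w)) (DM (i := i') (x := x k w)).
have h2 : `|N%:R^-1 * \sum_i' suppf (D_ i' (x k w)) p| <= n%:R * M * `|p|.
  rewrite normrM ger0_norm ?invr_ge0//.
  apply: le_trans (mean_le (F := fun i' => `|suppf (D_ i' (x k w)) p|) (fun i' => h i' p)).
  by rewrite ler_wpM2l ?invr_ge0// ler_norm_sum.
rewrite (le_trans (ler_normB _ _))// (le_trans (lerD (h i p) h2))//.
by rewrite le_eqVlt; apply/orP; left; apply/eqP; ring.
Qed.

Variable al : nat -> R.
Hypothesis al0 : forall k, 0 < al k.
Hypothesis al_log : al k * ln k%:R @[k --> \oo] --> (0 : R).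
Hypothesis al_div : series al @ \oo --> +oo.

(** Countably many directions, tolerances and lengths suffice, because the noise is
Lipschitz in p uniformly in k and the weights of a window sum up to at most L. *)
Lemma oracle_noise_vanishes : {ae P, forall w, forall p e L, 0 < e ->
  \forall i \near \oo, forall j, (i <= j)%N -> \sum_(i <= k < j) al k <= L ->
    \sum_(i <= k < j) al k * oracle_noise k p (idx k w) w <= e}.
Proof.
pose rv (q : 'rV[rat]_n) : 'rV[R]_n := \row_l ratr (q 0 l).
pose Q (c : 'rV[rat]_n * nat * nat) w := \forall i \near \oo, forall j,
  window al i j <= c.2%:R ->
  noise_sum idx (fun k i w => oracle_noise k (rv c.1.1) i w) al i j w < c.1.2.+1%:R^-1.
have : {ae P, forall w, forall k, if unpickle k is Some c then Q c w else True}.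
  apply: ae_foralln => k; case: unpickle => [[[q a] b]|]; last exact: aeW.
  have C0 : 0 <= 2 * (n%:R * M) * `|rv q| by rewrite !mulr_ge0// bound_ge0.
  exact: (noise_eventually_small N0 history_measurable history_mono history_idx
    history_indep (fun k i => @adapted_oracle_noise k (rv q) i)
    (fun k i w => oracle_noise_bound k (rv q) i w) (fun k w => oracle_noise_mean k (rv q) w)
    al0 C0 al_log al_div).
apply: filterS => w hw p e L e0.
have [b Lb] : exists b : nat, L <= b%:R.
  by exists (Num.truncn `|L|).+1; rewrite (le_trans (ler_norm _))// ltW// truncnS_gt.
have [a ae] : exists a : nat, a.+1%:R^-1 < e / 2.
  have e2 : 0 < e / 2 by rewrite divr_gt0.
  near \oo => a; exists a.
  by near: a; exact: (near_infty_natSinv_lt (PosNum e2)).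
(* the error from replacing p by q is at most e / 2 over a window of length b *)
pose r := e / 2 / (2 * (n%:R * M) * b%:R + 1).
have D0 : 0 <= 2 * (n%:R * M) * b%:R by rewrite !mulr_ge0// bound_ge0.
have r0 : 0 < r by rewrite !divr_gt0// ltr_wpDl.
have [q pq] := rV_rat_approx p r0.
have {}pq : `|p - rv q| <= r.
  by apply: norm_le_coord => [|l]; [exact: ltW|rewrite !mxE ltW].
have := hw (pickle (q, a, b)); rewrite pickleK /Q /=.
apply: filterS => i hi j ij wL.
have E (F : nat -> R) : \sum_(i <= k < j) F k = \sum_(k < j - i) F (i + k)%N.
  by rewrite -{1}[i]add0n big_addn big_mkord; apply: eq_bigr => k _; rewrite addnC.
rewrite E in wL; have {}hi := hi (j - i)%N (le_trans wL Lb).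
rewrite E.
apply: (@le_trans _ _ (\sum_(k < j - i) (al (i + k)%N * oracle_noise (i + k) (rv q) (idx (i + k) w) w
   + al (i + k)%N * (2 * (n%:R * M) * r)))).
  apply: ler_sum => k _; rewrite -mulrDr; apply: ler_wpM2l; first exact: ltW.
  rewrite (le_trans (oracle_noise_lip _ _ (rv q) _ _))// lerD2l ler_wpM2l//.
  by rewrite !mulr_ge0// bound_ge0.
rewrite big_split/= -mulr_suml.
have -> : e = e / 2 + e / 2 by lra.
apply: lerD; first exact: ltW (lt_trans hi ae).
have M2 : 0 <= 2 * (n%:R * M) * r.
  by apply: mulr_ge0; [rewrite !mulr_ge0 ?bound_ge0|exact: ltW].
rewrite (le_trans (ler_wpM2r M2 (le_trans wL Lb)))//.
have <- : r * (2 * (n%:R * M) * b%:R + 1) = e / 2 by rewrite divfK// gt_eqF// ltr_wpDl.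
rewrite (_ : b%:R * _ = r * (2 * (n%:R * M) * b%:R)); last by ring.
apply: ler_wpM2l; first exact: ltW.
by rewrite lerDl.
Unshelve. all: by end_near. Qed.

End AdamDNoise.

(** * One trajectory of AdamD *)

Lemma contraction_cvg0 (R : realType) (rho : R) (u a : nat -> R) :
  0 < rho -> rho <= 1 -> (forall k, 0 <= u k) -> a @ \oo --> (0 : R) ->
  (forall k, u k.+1 <= (1 - rho) * u k + a k) -> u @ \oo --> (0 : R).
Proof.
move=> rho0 rho1 u0 a_cvg uS; apply/cvgrPdist_le => e e0.
have re0 : 0 < rho * (e / 2) by rewrite mulr_gt0// divr_gt0.
have /cvgrPdist_le/(_ _ re0)[K _ aK] := a_cvg.
have geo i : u (i + K)%N <= (1 - rho) ^+ i * u K + e / 2.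
  elim: i => [|i IH]; first by rewrite expr0 mul1r lerDl divr_ge0// ltW.
  have ai : a (i + K)%N <= rho * (e / 2).
    by have := aK (i + K)%N (leq_addl _ _); rewrite sub0r normrN; apply: le_trans (ler_norm _).
  rewrite addSn (le_trans (uS _))// exprS.
  have : (1 - rho) * u (i + K)%N <= (1 - rho) * ((1 - rho) ^+ i * u K + e / 2).
    by rewrite ler_wpM2l// subr_ge0.
  move: ai; set X := (1 - rho) ^+ i * u K => ai h.
  have -> : (1 - rho) * (1 - rho) ^+ i * u K = (1 - rho) * X by rewrite mulrA.
  nra.
have g0 : (1 - rho) ^+ i * u K @[i --> \oo] --> (0 : R).
  rewrite -[0 : R](mul0r (u K)); apply: cvgMr_tmp; apply: cvg_expr.
  by rewrite ltr_norml; apply/andP; split; lra.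
have e2 : 0 < e / 2 by rewrite divr_gt0.
have /cvgrPdist_le/(_ _ e2)[K' _ gK] := g0.
exists (K' + K)%N => // k /= hk; rewrite sub0r normrN ger0_norm//.
have kK : (K <= k)%N by rewrite (leq_trans _ hk)// leq_addl.
have := geo (k - K)%N; rewrite subnK// => /le_trans; apply.
have := gK (k - K)%N; rewrite /= leq_subRL// addnC hk sub0r normrN => /(_ isT).
by move=> /(le_trans (ler_norm _)); lra.
Qed.

Lemma eventually_bounded (R : realType) (n : nat) (u : nat -> 'rV[R]_n) K (b : R) :
  (forall k, (K <= k)%N -> `|u k| <= b) -> exists B, forall k, `|u k| <= B.
Proof.
move=> ub; exists (`|b| + \sum_(i < K) `|u i|) => k.
have s0 : 0 <= \sum_(i < K) `|u i| by exact: sumr_ge0.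
have [kK|Kk] := ltnP k K; last by rewrite (le_trans (ub _ Kk))// (le_trans (ler_norm b))// lerDl.
rewrite (bigD1 (Ordinal kK))//= addrCA lerDl addr_ge0//.
exact: sumr_ge0.
Qed.

Lemma norm_convex_comb (R : realType) (n : nat) (u w : 'rV[R]_n) (t B : R) :
  0 <= t -> t <= 1 -> `|u| <= B -> `|w| <= B -> `|(1 - t) *: u + t *: w| <= B.
Proof.
move=> t0 t1 uB wB; rewrite (le_trans (ler_normD _ _))// !normrZ ger0_norm ?subr_ge0//.
rewrite (ger0_norm t0); nra.
Qed.

Section Trajectory.
Variables (R : realType) (S : forall n : nat, set (set 'rV[R]_n)).
Hypothesis HS : o_minimal S.
Variables (n N : nat) (f_ : 'I_N -> 'rV[R]_n -> R)
  (D_ : 'I_N -> 'rV[R]_n -> set 'rV[R]_n) (sigma M : R).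
Hypothesis N0 : (0 < N)%N.
Hypothesis sigma0 : 0 < sigma.
Hypothesis Hlip : forall i, locally_lipschitz (f_ i).
Hypothesis Hf_def : forall i, definable_fun S (f_ i).
Hypothesis HD_def : forall i, definable_map S (D_ i).
Hypothesis M0 : 0 <= M.
Hypothesis DM : forall i x d, D_ i x d -> `|d| <= M.
Hypothesis Dcons : forall i, admits_conservative_field (f_ i) (D_ i).
Variable cbelow : R.
Hypothesis Hbelow : forall x, cbelow <= mean_fun f_ x.
Variables (eps eta beta : R) (theta : nat -> R).
Hypothesis eps0 : 0 < eps.
Hypothesis eta0 : 0 < eta.
Hypothesis eta_le : eta <= eps / sigma.
Hypothesis beta0 : 0 < beta.
Hypothesis beta1 : beta < 1.
Hypothesis theta0 : forall k, 0 < theta k.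
Hypothesis theta_div : series theta @ \oo --> +oo.
Hypothesis theta_log : theta k * ln k%:R @[k --> \oo] --> (0 : R).
Variables (ix : nat -> 'I_N) (g x m v : nat -> 'rV[R]_n).
Hypothesis v0 : forall l, 0 <= v 0%N 0 l.
Hypothesis gD : forall k, D_ (ix k) (x k) (g k).
Hypothesis mS : forall k, m k.+1 = (1 - theta k) *: m k + theta k *: g k.
Hypothesis vS : forall k, v k.+1 = \row_l ((1 - beta) * v k 0 l + beta * g k 0 l ^+ 2).
Hypothesis xS : forall k, x k.+1 =
  \row_l (x k 0 l - eta * ((Num.sqrt (v k.+1 0 l) + eps)^-1 *
                               (m k.+1 0 l + sigma * x k 0 l))).

Let al k := theta k / sigma.
Let y k := - (sigma^-1 *: m k).

Lemma gM k : `|g k| <= M. Proof. exact: DM (gD k). Qed.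

Lemma theta_cvg0 : theta @ \oo --> (0 : R).
Proof.
apply/cvgrPdist_le => e e0.
have /cvgrPdist_le/(_ _ e0) := theta_log.
apply: filterS2 (nbhs_infty_ger (expR 1)) => k ek.
rewrite !sub0r !normrN !ger0_norm ?(ltW (theta0 _))//.
  move=> h; rewrite (le_trans _ h)// ler_peMr ?(ltW (theta0 _))//.
  have k0 : 0 < k%:R :> R by rewrite (lt_le_trans _ ek)// expR_gt0.
  rewrite -ler_expR lnK; first exact: ek.
  exact: k0.
have k1 : 1 <= k%:R :> R by rewrite (le_trans _ ek)// -expR0 ler_expR.
by rewrite mulr_ge0 ?(ltW (theta0 _))// ln_ge0.
Qed.

Lemma yS k : y k.+1 = y k - al k *: (g k + sigma *: y k).
Proof.
apply/rowP => l; rewrite /y mS !mxE /al; field; exact: lt0r_neq0.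
Qed.

Lemma y_bounded : exists B, forall k, `|y k| <= B.
Proof.
have /cvgrPdist_le/(_ _ ltr01)[K _ tK] := theta_cvg0.
have [B mB] : exists B, forall k, `|m k| <= B.
  apply: (@eventually_bounded _ _ _ K (`|m K| + M)) => k /subnK <-.
  elim: (k - K)%N => [|i IH]; first by rewrite lerDl.
  rewrite addSn mS; apply: norm_convex_comb => //; first exact: ltW.
    have := tK (i + K)%N (leq_addl _ _); rewrite sub0r normrN.
    exact: le_trans (ler_norm _).
  by rewrite (le_trans (gM _))// lerDr.
exists (sigma^-1 * B) => k.
by rewrite normrN normrZ ger0_norm ?invr_ge0 ?(ltW sigma0)// ler_wpM2l// invr_ge0 ltW.
Qed.

Lemma v_bounds k l : 0 <= v k 0 l <= v 0%N 0 l + M ^+ 2.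
Proof.
elim: k => [|k /andP[v1 v2]]; first by rewrite v0 lerDl sqr_ge0.
rewrite vS mxE; have g2 : g k 0 l ^+ 2 <= M ^+ 2.
  rewrite -(real_normK (num_real (g k 0 l))) lerXn2r ?nnegrE//.
  by rewrite (le_trans (coord_le_norm _ _))// gM.
have g0 : 0 <= g k 0 l ^+ 2 by exact: sqr_ge0.
have b1 : 0 <= 1 - beta by rewrite subr_ge0 ltW.
apply/andP; split; first by rewrite addr_ge0// mulr_ge0// ltW.
have h1 := ler_wpM2l b1 v2.
have h2 := ler_wpM2l (ltW beta0) (le_trans g2 (_ : _ <= v 0%N 0 l + M ^+ 2)).
by rewrite (le_trans (lerD h1 (h2 _)))// ?lerDr// -mulrDl subrK mul1r.
Qed.

Lemma y_increment_norm : exists2 L, 0 <= L & forall k, `|y k.+1 - y k| <= al k * L.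
Proof.
have [B yB] := y_bounded.
exists (M + sigma * B) => [|k].
  by rewrite addr_ge0// mulr_ge0 ?(ltW sigma0)// (le_trans _ (yB 0%N)).
have a0 : 0 <= al k by rewrite divr_ge0 ?(ltW sigma0) ?(ltW (theta0 _)).
rewrite yS addrAC subrr sub0r normrN normrZ ger0_norm// ler_wpM2l//.
rewrite (le_trans (ler_normD _ _))// lerD ?gM// normrZ gtr0_norm//.
by rewrite ler_wpM2l// ltW.
Qed.

Lemma al_cvg0 : al @ \oo --> (0 : R).
Proof.
rewrite -[0 : R](mul0r sigma^-1); exact: (cvgMr_tmp theta_cvg0).
Qed.

(** Coordinatewise x_{k+1} - y_{k+1} = (1 - r) (x_k - y_{k+1}) with rho <= r <= 1.  The
upper bound on r comes from eta <= eps / sigma, the lower one from the bound on v. *)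
Lemma x_sub_y_cvg0 : `|x k - y k| @[k --> \oo] --> (0 : R).
Proof.
have [L L0 yL] := y_increment_norm.
have [V vV] : exists V, forall k l, v k 0 l <= V.
  exists (`|v 0%N| + M ^+ 2) => k l; have /andP[_ h] := v_bounds k l.
  by rewrite (le_trans h)// lerD2r (le_trans (ler_norm _))// coord_le_norm.
pose rho := eta * sigma * (Num.sqrt V + eps)^-1.
have sV : 0 <= Num.sqrt V by exact: sqrtr_ge0.
have rho0 : 0 < rho by rewrite !mulr_gt0// invr_gt0 ltr_wpDl.
have rate k l : rho <= eta * sigma * (Num.sqrt (v k 0 l) + eps)^-1 <= 1.
  have s0 : 0 <= Num.sqrt (v k 0 l) by exact: sqrtr_ge0.
  have p0 : 0 < Num.sqrt (v k 0 l) + eps by rewrite ltr_wpDl.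
  apply/andP; split.
    apply: ler_wpM2l; first by rewrite mulr_ge0// ltW.
    by rewrite lef_pV2 ?posrE ?ltr_wpDl// lerD2r ler_wsqrtr.
  rewrite ler_pdivrMr// mul1r -ler_pdivlMr// (le_trans eta_le)//.
  by rewrite ler_wpM2r ?invr_ge0 ?(ltW sigma0)// lerDr.
(* rho <= 1 is read off a coordinate, which requires n > 0 *)
have [l0|nl] := pselect (exists l : 'I_n, True); last first.
  have e k : `|x k - y k| = 0.
    apply/eqP; rewrite normr_eq0; apply/eqP/rowP => l; exfalso; apply: nl.
    by exists l.
  by under eq_fun do rewrite e; exact: cvg_cst.
have [l _] := l0.
have rho1 : rho <= 1 by have /andP[h1 h2] := rate 0%N l; exact: le_trans h1 h2.
apply: (@contraction_cvg0 _ rho _ (fun k => al k * L)) => //.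
  by rewrite -[0 : R](mul0r L); exact: (cvgMr_tmp al_cvg0).
move=> k; have [B yB] := y_bounded.
have A0 : 0 <= al k * L by rewrite (le_trans _ (yL k)).
have B0 : 0 <= (1 - rho) * `|x k - y k| by rewrite mulr_ge0// subr_ge0.
apply: norm_le_coord => [|{}l]; first by rewrite addr_ge0.
have /andP[r1 r2] := rate k.+1 l.
set r := eta * sigma * _ in r1 r2.
have -> : (x k.+1 - y k.+1) 0 l = (1 - r) * ((x k - y k) 0 l - (y k.+1 - y k) 0 l).
  have ym : m k.+1 0 l = - sigma * y k.+1 0 l.
    by rewrite /y !mxE; field; exact: lt0r_neq0.
  have -> : (x k - y k) 0 l - (y k.+1 - y k) 0 l = x k 0 l - y k.+1 0 l.
    by move: (y k) (y k.+1) => b b'; rewrite !mxE; ring.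
  have -> : (x k.+1 - y k.+1) 0 l = x k.+1 0 l - y k.+1 0 l.
    by move: (y k.+1) => b; rewrite !mxE.
  by rewrite xS mxE ym /r; ring.
rewrite normrM ger0_norm ?subr_ge0//.
have h1 : `|(x k - y k) 0 l - (y k.+1 - y k) 0 l| <= `|x k - y k| + al k * L.
  rewrite (le_trans (ler_normB _ _))// lerD ?coord_le_norm//.
  by rewrite (le_trans (coord_le_norm _ _))// yL.
have n0 := normr_ge0 ((x k - y k) 0 l - (y k.+1 - y k) 0 l).
have n1 := normr_ge0 (x k - y k).
move: (`|(x k - y k) 0 l - _|) h1 n0 => c h1 c0; nra.
Qed.

Hypothesis noise : forall p e L, 0 < e -> \forall i \near \oo, forall j, (i <= j)%N ->
  \sum_(i <= k < j) al k <= L ->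
  \sum_(i <= k < j) al k *
    (suppf (D_ (ix k) (x k)) p - N%:R^-1 * \sum_(i' < N) suppf (D_ i' (x k)) p) <= e.

Local Notation H := (reg_suppf D_ sigma).
Local Notation G := (reg_fun sigma f_).

Lemma al_gt0 k : 0 < al k. Proof. by rewrite divr_gt0. Qed.

Lemma tau_cvgy : tau al @ \oo --> +oo.
Proof.
apply/cvgryPge => A; have /cvgryPge/(_ (A * sigma)) := theta_div.
apply: filterS => k; rewrite /tau /series/= -mulr_suml ler_pdivlMr//.
Qed.

Lemma tau_sub i j : (i <= j)%N -> tau al j - tau al i = \sum_(i <= k < j) al k.
Proof. by move=> ij; rewrite /tau (big_cat_nat (m := 0%N) (n := i) (p := j))//= addrAC subrr add0r. Qed.

Lemma y_telescope i j : (i <= j)%N -> y j - y i = \sum_(i <= k < j) (y k.+1 - y k).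
Proof. by move=> ij; rewrite telescope_sumr. Qed.

(** For y_k near z, the point x_k is near z as well, so H p (x_k) < c by upper
semicontinuity; the rest of <p, g_k> is noise. *)
Lemma y_drift p z c : H p z < c -> exists2 d, 0 < d &
  forall e T, 0 < e -> \forall i \near \oo, forall j, (i <= j)%N ->
    tau al j - tau al i <= T ->
    (forall k, (i <= k < j)%N -> `|y k - z| < d) ->
    - dotv p (y j - y i) <= c * (tau al j - tau al i) + e.
Proof.
move=> Hc; pose c' := (H p z + c) / 2.
have Hc' : H p z < c' by rewrite /c'; lra.
have /nbhs_ballP[r /= r0 rH] := reg_suppf_usc N0 DM Dcons Hc'.
exists (r / 2) => [|e T e0]; first by rewrite divr_gt0.
(* x_k - y_k below b keeps x_k in the ball, and makes sigma <p, y_k - x_k> at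
   most c - c' *)
pose b := Num.min (r / 2) ((c - c') / (sigma * (n%:R * `|p|) + 1)).
have p0 : 0 < sigma * (n%:R * `|p|) + 1 by rewrite ltr_wpDl// !mulr_ge0// ltW.
have b0 : 0 < b by rewrite lt_min !divr_gt0// /c'; lra.
have /cvgrPdist_lt/(_ _ b0)[K _ xyK] := x_sub_y_cvg0.
apply: filterS2 (nbhs_infty_ge K) (noise p T e0) => i /= Ki ni j ij tT yz.
rewrite tau_sub// in tT *; have {}ni := ni j ij tT.
rewrite y_telescope// dotv_sumr -sumrN.
apply: le_trans (_ : _ <= \sum_(i <= k < j) (c * al k + al k *
    (suppf (D_ (ix k) (x k)) p - N%:R^-1 * \sum_(i' < N) suppf (D_ i' (x k)) p))) _; last first.
  by rewrite big_split/= -mulr_sumr lerD2l.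
rewrite big_nat_cond [leRHS]big_nat_cond; apply: ler_sum => k; rewrite andbT => kij.
have xy : `|x k - y k| < b.
  have := xyK k; rewrite sub0r normrN normr_id; apply.
  by case/andP: kij => h _; exact: leq_trans Ki h.
have Hx : H p (x k) < c'.
  apply: rH; rewrite mx_norm_ball /ball_/= distrC.
  rewrite -(subrKA (y k)) (le_lt_trans (ler_normD _ _))// (_ : r = r / 2 + r / 2); last by lra.
  by rewrite ltrD ?yz// (lt_le_trans xy)// ge_min lexx.
have dp : sigma * dotv p (y k - x k) <= c - c'.
  apply: le_trans (_ : _ <= (sigma * (n%:R * `|p|) + 1) * b) _.
    rewrite mulrDl mul1r -[leLHS]addr0 lerD ?(ltW b0)// -mulrA ler_wpM2l ?(ltW sigma0)//.
    rewrite (le_trans (ler_norm _))// (le_trans (dotv_norm _ _))// -mulrA distrC.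
    by rewrite !ler_wpM2l// ltW.
  by rewrite mulrC -ler_pdivlMr// ge_min lexx orbT.
have [[_ D0 _ _] _] := Dcons (ix k).
have hg := suppf_ub (D0 (x k)) (@DM (ix k) (x k)) p (gD k).
rewrite yS addrAC subrr sub0r dotvNr opprK dotvZr dotvDr dotvZr.
rewrite (mulrC c) -mulrDr; apply: ler_wpM2l; first exact: ltW (al_gt0 k).
by move: Hx dp hg; rewrite /reg_suppf dotvBr; set avg := N%:R^-1 * _; lra.
Qed.

Lemma y_lipschitz : exists2 L, 0 <= L &
  forall i j, (i <= j)%N -> `|y j - y i| <= L * (tau al j - tau al i).
Proof.
have [L L0 yL] := y_increment_norm; exists L => // i j ij.
rewrite y_telescope// tau_sub// mulr_sumr (le_trans (ler_norm_sum _ _ _))//.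
by apply: ler_sum => k _; rewrite mulrC.
Qed.

(** g is uniformly continuous on the ball that contains both sequences. *)
Lemma reg_fun_x_sub_y : G (x k) - G (y k) @[k --> \oo] --> (0 : R).
Proof.
have [B yB] := y_bounded; have xy0 := x_sub_y_cvg0.
apply/cvgrPdist_lt => e e0.
have Gc := @reg_fun_continuous _ _ _ f_ sigma Hlip.
have /compact_near_coveringP cov := @bounded_closed_ball R n (B + 1).
have := cov nat \oo (fun k u => `|u - y k| <= `|x k - y k| -> `|G u - G (y k)| < e) _ _.
move=> /(_ _ _) h.
have {}h : \forall k \near \oo, [set d : 'rV[R]_n | `|d| <= B + 1] `<=`
   (fun u => `|u - y k| <= `|x k - y k| -> `|G u - G (y k)| < e).
  apply: h => z _.
  have e2 : 0 < e / 2 by rewrite divr_gt0.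
  have /cvgrPdist_lt/(_ _ e2)/nbhs_ballP[r /= r0 rG] := Gc z.
  have r2 : 0 < r / 2 by rewrite divr_gt0.
  have /cvgrPdist_lt/(_ _ r2)[K _ xyK] := xy0.
  exists (ball z (r / 2), [set k | (K <= k)%N]).
    by split; [exact: nbhsx_ballx|exact: nbhs_infty_ge].
  move=> [u k] /= [zu Kk] uy.
  have xyk : `|x k - y k| < r / 2 by have := xyK k Kk; rewrite sub0r normrN normr_id.
  rewrite mx_norm_ball /ball_/= in zu.
  have h1 : `|G z - G u| < e / 2.
    by apply: rG; rewrite mx_norm_ball /ball_/=; lra.
  have h2 : `|G z - G (y k)| < e / 2.
    apply: rG; rewrite mx_norm_ball /ball_/= -(subrKA u) (le_lt_trans (ler_normD _ _))//; lra.
  rewrite -(subrKA (G z)) (le_lt_trans (ler_normD _ _))// (distrC (G u)); lra.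
have /cvgrPdist_lt/(_ _ ltr01) := xy0.
apply: filterS2 h => k hk xyk; rewrite sub0r normrN; apply: hk => //=.
rewrite -(subrK (y k) (x k)) (le_trans (ler_normD _ _))// addrC lerD//.
by move: xyk; rewrite sub0r normrN normr_id => /ltW.
Qed.

Lemma cluster_x_y z : cluster (x k @[k --> \oo]) z -> cluster (y k @[k --> \oo]) z.
Proof.
move=> zx A B yA /nbhs_ballP[r /= r0 rB].
have r2 : 0 < r / 2 by rewrite divr_gt0.
have /cvgrPdist_lt/(_ _ r2) xy := x_sub_y_cvg0.
have xA : nbhs (x k @[k --> \oo]) [set u | exists2 w, A w & `|u - w| < r / 2].
  apply: filterS2 xy yA => k; rewrite sub0r normrN normr_id => h Ay; exists (y k) => //.
have [u [[w Aw uw] zu]] := zx _ _ xA (nbhsx_ballx z (r / 2) r2).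
exists w; split => //; apply: rB.
rewrite mx_norm_ball /ball_/= in zu *.
by rewrite -(subrKA u) (le_lt_trans (ler_normD _ _))//; lra.
Qed.

Lemma reg_suppfZ a q u : 0 <= a -> H (a *: q) u = a * H q u.
Proof.
move=> a0; rewrite /reg_suppf dotvZl.
rewrite (eq_bigr (fun i => a * suppf (D_ i u) q)) => [|i _]; first by rewrite -mulr_sumr; ring.
have [[_ D0 _ _] _] := Dcons i.
by rewrite (suppfZ (D0 _) (@DM i u)).
Qed.

(** [approximation_convergence] for y, carried over to x because x_k - y_k tends to 0. *)
Theorem trajectory_convergence :
  (forall z, cluster (x k @[k --> \oo]) z -> stationary (reg_field sigma D_) z) /\
  cvgn (fun k => G (x k)).
Proof.
have [B yB] := y_bounded; have [L L0 yL] := y_lipschitz.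
have [Gy crit] : cvgn (fun k => G (y k)) /\
    forall z, cluster (y k @[k --> \oo]) z -> forall p, 0 <= H p z.
  apply: (@approximation_convergence _ _ al y B L H G al_gt0 al_cvg0 tau_cvgy yB L0 yL).
  - by move=> p z c; exact: (reg_suppf_usc N0 DM Dcons).
  - exact: reg_suppfZ.
  - exact: reg_fun_continuous.
  - exact: y_drift.
  - exact: (reg_fun_curve (sigma := sigma) DM Dcons).
  by move=> a b; exact: (critical_values_codense HS N0 sigma0 Hlip Hf_def HD_def DM Dcons Hbelow).
split.
  by move=> z /cluster_x_y/crit; exact: (reg_suppf_ge0_stationary DM Dcons).
have /cvg_ex[l Gl] := Gy; apply/cvg_ex; exists (l + 0).
rewrite (_ : (fun k => G (x k)) = (fun k => G (y k) + (G (x k) - G (y k)))).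
  exact: (cvgD Gl reg_fun_x_sub_y).
by apply/funext => k; rewrite addrC subrK.
Qed.

End Trajectory.

(** * The convergence theorem *)

Lemma set_enorm_bound (R : realType) (n N : nat) (D_ : 'I_N -> 'rV[R]_n -> set 'rV[R]_n) :
  (ereal_sup [set set_enorm (D_ p.1 p.2) | p in [set: 'I_N * 'rV[R]_n]] < +oo)%E ->
  exists2 M, 0 <= M & forall i x d, D_ i x d -> `|d| <= M.
Proof.
set s := ereal_sup _ => s_fin.
have ub i x d : D_ i x d -> ((enorm d)%:E <= s)%E.
  move=> Dd; apply: (@le_trans _ _ (set_enorm (D_ i x))).
    by apply: ereal_sup_ubound; exists d.
  by apply: ereal_sup_ubound; exists (i, x).
exists `|fine s| => // i x d Dd; rewrite (le_trans (norm_le_enorm d))//.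
rewrite (le_trans _ (ler_norm _))//.
by move: ub s_fin => /(_ i x d Dd); case: s => [r| |]//=; rewrite ?lee_fin// leeNy_eq.
Qed.

Theorem theorem5p2 (R : realType) (S : forall n : nat, set (set 'rV[R]_n))
  (HS : o_minimal S)
  (n N : nat) (HN : (1 <= N)%N)
  (sigma : R) (Hsigma : 0 < sigma)
  (f_ : 'I_N -> 'rV[R]_n -> R)
  (Hlip : forall i, locally_lipschitz (f_ i))
  (D_ : 'I_N -> 'rV[R]_n -> set 'rV[R]_n)
  (Hf_def : forall i, definable_fun S (f_ i))
  (HD_def : forall i, definable_map S (D_ i))
  (HD_cons : forall i, admits_conservative_field (f_ i) (D_ i))
  (HD_bnd : (ereal_sup [set set_enorm (D_ p.1 p.2)
                       | p in [set: 'I_N * 'rV[R]_n]] < +oo)%E)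
  (Hbelow : exists c : R, forall x, c <= mean_fun f_ x)
  (eps eta beta : R) (Heps : 0 < eps)
  (Heta0 : 0 < eta) (Heta : eta <= eps / sigma)
  (Hbeta0 : 0 < beta) (Hbeta1 : beta < 1)
  (theta : nat -> R) (Htheta_pos : forall k, 0 < theta k)
  (Htheta_sum : series theta @ \oo --> +oo)
  (Htheta_log : theta k * ln k%:R @[k --> \oo] --> (0 : R))
  (x0 m0 v0 : 'rV[R]_n) (Hv0 : forall l, 0 <= v0 0 l)
  (d : measure_display) (T : measurableType d) (P : probability T R)
  (idx : nat -> T -> 'I_N) (g x m v : nat -> T -> 'rV[R]_n)
  (Hadam : adamD P D_ sigma eps eta beta theta x0 m0 v0 idx g x m v) :
  {ae P, forall w,
     (forall z : 'rV[R]_n, cluster (x k w @[k --> \oo]) z ->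
        stationary (reg_field sigma D_) z) /\
     cvgn (fun k => reg_fun sigma f_ (x k w))}.
Proof.
have [M M0 DM] := set_enorm_bound HD_bnd.
have [c fc] := Hbelow.
pose al k := theta k / sigma.
have al0 k : 0 < al k by rewrite divr_gt0.
have al_log : al k * ln k%:R @[k --> \oo] --> (0 : R).
  rewrite -[0 : R](mul0r sigma^-1); under eq_fun do rewrite /al mulrAC.
  exact: (cvgMr_tmp Htheta_log).
have al_div : series al @ \oo --> +oo.
  apply/cvgryPge => A; have /cvgryPge/(_ (A * sigma)) := Htheta_sum.
  by apply: filterS => k; rewrite /series/= -mulr_suml ler_pdivlMr.
apply: filterS (oracle_noise_vanishes HN DM HD_cons Heps Hadam al0 al_log al_div) => w noise.
apply: (trajectory_convergence HS HN Hsigma Hlip Hf_def HD_def M0 DM HD_cons fc Heps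
  Heta0 Heta Hbeta0 Hbeta1 Htheta_pos Htheta_sum Htheta_log (ix := idx ^~ w) (g := g ^~ w)
  (m := m ^~ w) (v := v ^~ w)).
- by move=> l; rewrite (adamD_v0 Hadam).
- by move=> k; exact: (adamD_g Hadam).
- by move=> k; exact: (adamD_m Hadam).
- by move=> k; exact: (adamD_v Hadam).
- by move=> k; exact: (adamD_x Hadam).
- exact: noise.
Qed.
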